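(* Let $\mathcal{P}$ be the set of all probability measures on a measurable space having a density with respect to a $\sigma$-finite measure $\nu$, let $P_0\in\mathcal{P}$, and let $\psi:\mathcal{P}\to\mathbb{R}$ be pathwise differentiable at $P_0$ relative to the maximal tangent space $L_2^0(P_0)$, with efficient influence function $\dot\psi_0\in L_2^0(P_0)$. For each $g\in L_2^0(P_0)$ let $t\mapsto P_{t,g}\in\mathcal{P}$ (for $t$ in a neighborhood of $0$) be a parametric path with $P_{0,g}=P_0$ that is differentiable in quadratic mean (QMD) at $t=0$ with score $g$. Let $L^{(1)}_{n,g}(c),\dots,L^{(4)}_{n,g}(c)$ be the four lower bounds, defined in the context, for the local minimax risk $\inf_T\sup_{|t|<cn^{-1/2}}\mathbb{E}_{P_{t,g}^n}|T(X_1,\dots,X_n)-\psi(P_{t,g})|^2$. Then: (i) for any QMD paths, $\ \sup_{g\in L_2^0(P_0)}\liminf_{c\to\infty}\liminf_{n\to\infty}n\,L^{(1)}_{n,g}(c)\ge\int\dot\psi_0^2\,dP_0$; (ii) if the paths are $dP_{t,g}(x)=C_t^{-1}\kappa(tg(x))\,dP_0(x)$ with $C_t=\int\kappa(tg(x))\,dP_0(x)$, where $\kappa:\mathbb{R}\to[0,\infty)$ is twice differentiable, $\kappa(0)=\kappa'(0)=1$ and $\|\kappa'\|_\infty\le K$, $\|\kappa''\|_\infty\le K$ for some constant $K$, then $\ \sup_{g\in L_2^0(P_0)}\liminf_{c\to\infty}\liminf_{n\to\infty}n\,L^{(2)}_{n,g}(c)\ge\int\dot\psi_0^2\,dP_0$;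 (iii) for any QMD paths, $\ \sup_{g\in L_2^0(P_0)}\liminf_{c\to\infty}\liminf_{n\to\infty}n\,L^{(3)}_{n,g}(c)\ge\int\dot\psi_0^2\,dP_0$; (iv) for any QMD paths, $\ \sup_{g\in L_2^0(P_0)}\liminf_{c\to\infty}\liminf_{n\to\infty}n\,L^{(4)}_{n,g}(c)\ge C\int\dot\psi_0^2\,dP_0$, where $C=\sup_{\varepsilon\ge0}\varepsilon^2\left(\tfrac12e^{-\varepsilon^2/8}-\tfrac14\right)\approx0.28953$. In particular the corresponding (semiparametric efficiency) lower bounds hold for $\sup_g\liminf_c\liminf_n\inf_T\sup_{|t|<cn^{-1/2}}n\,\mathbb{E}_{P^n_{t,g}}|T(X_1,\dots,X_n)-\psi(P_{t,g})|^2$.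
   Context: $L_2^0(P_0)$ is the space of mean-zero functions in $L_2(P_0)$. $P^n$ is the $n$-fold product of $P$. $[x]_+=\max(x,0)$. Infima over $T$ are over measurable real-valued functions. QMD at $0$ with score $g$: $\int[dP_t^{1/2}-dP_0^{1/2}-\tfrac12 t g\,dP_0^{1/2}]^2d\nu=o(t^2)$. Hellinger differentiability at $t$: there is $\dot\xi_t\in L_2(\nu)$ with $\int[dP_{t+h}^{1/2}-dP_t^{1/2}-h\dot\xi_t]^2d\nu=o(h^2)$; the Fisher information at $t$ is $4\int\dot\xi_t^2d\nu$. Pathwise differentiability at $P_0$ relative to $L_2^0(P_0)$: there is $\dot\psi_0$ such that for every $g\in L_2^0(P_0)$ and every QMD path with score $g$, $|\psi(P_t)-\psi(P_0)-t\int\dot\psi_0g\,dP_0|=o(t)$ as $t\to0$. The efficient influence function is the projection of $\dot\psi_0$ on $L_2^0(P_0)$. $H^2(P,P')=\int(dP^{1/2}-dP'^{1/2})^2$; $\chi^2(P'\|P)=\int(dP'/dP-1)^2dP$ if $P'\ll P$, and $\infty$ otherwise. Fix $g$, $n$, $c$, write $P_t=P_{t,g}$, $\psi(t)=\psi(P_{t,g})$, $\Theta_{n}=(-cn^{-1/2},cn^{-1/2})$. The first bound is the one for models $\{P_t:t\in\Theta_n\}$ that are Hellinger differentiable at all $t\in\Theta_n$, with Fisher information $\mathcal{I}_g(t)$ at $t$ (this is what is needed for the bound to be defined): $L^{(1)}_{n,g}(c)=\sup_{\phi,Q}\Big[\frac{|\int\phi'(t)dQ(t)|}{(\mathcal{I}(Q)+n\int\mathcal{I}_g(t)dQ(t))^{1/2}}-\big(\int|\psi(t)-\phi(t)|^2dQ(t)\big)^{1/2}\Big]_+^2$,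 the supremum over absolutely continuous $\phi:\Theta_n\to\mathbb{R}$ and nice priors $Q$: $Q$ has an absolutely continuous Lebesgue density $q$ on $\Theta_n$ vanishing at the endpoints of $\Theta_n$, $\mathcal{I}(Q)=\int (q')^2q^{-1}\mathbf{1}\{q>0\}dt$ is finite and positive, $\phi,\phi'$ are $Q$-integrable, $\int\mathcal{I}_g\,dQ<\infty$. For a diffeomorphism $\varphi:\mathbb{R}\to\Theta_n$, a probability measure $Q$ on $\mathbb{R}$ and $h\in\mathbb{R}$, let $\widetilde{\mathbb{P}}_h$ be the law of $(X,\vartheta-h)$ when $\vartheta\sim Q$ and $X\mid\vartheta\sim P_{\varphi(\vartheta)}^n$, i.e. $d\widetilde{\mathbb{P}}_h(x,t)=dP^n_{\varphi(t+h)}(x)dQ(t+h)$; let $\widetilde\psi=\psi\circ\varphi$, $D=\left|\int(\widetilde\psi(t)-\widetilde\psi(t-h))dQ(t)\right|^2$ and $B=\int|\widetilde\psi(t)-\widetilde\psi(t-h)|^2dQ(t)$. Then $$L^{(2)}_{n,g}(c)=\sup_{\varphi,Q,\lambda\in[0,1],h}\Big[(1-\lambda)\Big(\tfrac{D}{\chi^2(\widetilde{\mathbb{P}}_h\|\lambda\widetilde{\mathbb{P}}_h+(1-\lambda)\widetilde{\mathbb{P}}_0)}\Big)^{1/2}-(\lambda B)^{1/2}\Big]_+^2,\qquad L^{(3)}_{n,g}(c)=\sup_{\varphi,Q,h}\Big[\Big(\tfrac{D}{4H^2(\widetilde{\mathbb{P}}_0,\widetilde{\mathbb{P}}_h)}\Big)^{1/2}-B^{1/2}\Big]_+^2,$$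 $$L^{(4)}_{n,g}(c)=\sup_{t_1,t_2\in\Theta_n}\Big[\tfrac{1-H^2(P^n_{t_1},P^n_{t_2})}{4}\Big]_+|\psi(t_1)-\psi(t_2)|^2 .$$ Conventions: $0/0=0$, the first term in $L^{(2)}$ is $0$ for $\lambda=1$, the suprema run over choices for which the integrals are well defined.
   Formalization: In (i) each path is also assumed to be Hellinger differentiable near 0, with t↦ψ(P_{t,g}) Lebesgue measurable near 0 and Fisher information continuous at t=0; without this continuity (i) fails, e.g. for Bernoulli paths with parameter ½(1+a(t+t² sin t⁻²)). *)

(* Defs.v *)
From HB Require Import structures.
From mathcomp Require Import all_boot all_order all_algebra.
From mathcomp Require Import all_classical all_reals all_analysis.
From mathcomp Require Import measurable_realfun giry.
Set Implicit Arguments.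
Unset Strict Implicit.
Unset Printing Implicit Defensive.
Import Order.TTheory GRing.Theory Num.Theory.
Import numFieldNormedType.Exports.

Local Open Scope classical_set_scope.
Local Open Scope ring_scope.
Local Open Scope ereal_scope.

(* Samples are modelled by [n.-tuple X]; an observation x_1 is consed onto
   the remaining n observations. *)
Section iid_product.
Context d (X : measurableType d) (R : realType).

Definition consT n (z : X * n.-tuple X) : n.+1.-tuple X :=
  [the n.+1.-tuple X of z.1 :: z.2].

Let measurable_consT n : measurable_fun [set: X * n.-tuple X] (@consT n).
Proof. by apply: measurable_cons. Qed.

HB.instance Definition _ n :=
  isMeasurableFun.Build _ _ _ _ (@consT n) (@measurable_consT n).

Fixpoint iid (P : probability X R) (n : nat) : probability (n.-tuple X) R :=
  match n with
  | 0%N => \d_([tuple] : 0.-tuple X)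
  | m.+1 => distribution (P \x iid P m) (@consT m)
  end.

Lemma iid_box (P : probability X R) n (A : 'I_n -> set X) :
  (forall i, measurable (A i)) ->
  iid P n [set x | forall i, A i (tnth x i)] = \prod_(i < n) P (A i).
Proof.
elim: n A => [|n IH] A mA /=.
  by rewrite big_ord0 diracE mem_set// => -[].
rewrite /distribution /pushforward big_ord_recl.
rewrite (_ : _ @^-1` _ = A ord0 `*`
    [set x : n.-tuple X | forall i, A (lift ord0 i) (tnth x i)]); last first.
  apply/seteqP; split => -[x y] /=.
    move=> H; split; first by have := H ord0; rewrite tnth0.
    by move=> i; have := H (lift ord0 i); rewrite tnthS.
  move=> [/= Ax Ay] i; have [->|i0] := eqVneq i ord0; first by rewrite tnth0.
  by have [j ->|ei] := unliftP ord0 i; [rewrite tnthS; exact: Ay|rewrite ei tnth0].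
rewrite product_measure1E//; last first.
  rewrite (_ : [set x | _] = \bigcap_(i in [set: 'I_n])
      ((@tnth n X)^~ i @^-1` A (lift ord0 i))).
    apply: fin_bigcap_measurable => // i _.
    by rewrite -[X in measurable X]setTI; apply: measurable_tnth.
  by apply/seteqP; split => x /= H i; [move=> _|]; exact: H.
congr (_ * _); exact: (IH (fun i => A (lift ord0 i))).
Qed.

End iid_product.

(* The law of (X, theta - h) when theta ~ Q and X | theta = u ~ k u. *)
Section joint_law.
Context d (X : measurableType d) (R : realType).
Variables (Q : probability R R) (k : R.-pker R ~> X) (h : R).

Definition joint_law (C : set (X * R)) : \bar R :=
  \int[Q]_u k u [set x | C (x, (u - h)%R)].

Let shift (C : set (X * R)) : set (R * X) :=
  (fun z => (z.2, (z.1 - h)%R)) @^-1` C.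

Let mshift C : measurable C -> measurable (shift C).
Proof.
move=> mC; rewrite -[X in measurable X]setTI.
suff mf : measurable_fun [set: R * X] (fun z : R * X => (z.2, (z.1 - h)%R)).
  exact: mf.
apply/measurable_fun_pairP; split.
  exact: (@measurable_snd _ _ R X).
exact: (measurable_funB measurable_fst (measurable_cst h)).
Qed.

Let sect C u : [set x | C (x, (u - h)%R)] = xsection (shift C) u.
Proof. by rewrite xsectionE. Qed.

Let joint_law0 : joint_law set0 = 0.
Proof. by apply: integral0_eq => u _; rewrite measure0. Qed.

Let joint_law_ge0 C : 0 <= joint_law C.
Proof. by apply: integral_ge0 => u _; exact: measure_ge0. Qed.

Let joint_law_sigma_additive : semi_sigma_additive joint_law.
Proof.
move=> F mF tF mUF; rewrite [X in _ --> X](_ : _ = \sum_(n <oo) joint_law (F n)).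
  by apply/cvg_closeP; split; [exact: is_cvg_nneseries|rewrite closeE].
rewrite /joint_law -integral_nneseries//; last first.
  move=> n; rewrite (_ : (fun u => _) = (fun u => k u (xsection (shift (F n)) u))).
    by apply: measurable_fun_xsection_finite_kernel; rewrite inE; exact: mshift.
  by apply/funext => u; rewrite -sect.
apply: eq_integral => u _; apply/esym/cvg_lim => //=.
have tF' : trivIset [set: nat] (fun n => [set x | F n (x, (u - h)%R)]).
  by move=> i j _ _ [x [/= Fi Fj]]; apply: tF => //; exists (x, (u - h)%R).
rewrite (_ : [set x | _] = \bigcup_n [set x | F n (x, (u - h)%R)])//.
apply: (measure_sigma_additive _ tF') => n.
by rewrite (sect (F n)); exact: measurable_xsection (mshift (mF n)).
Qed.

HB.instance Definition _ := isMeasure.Build _ _ _ joint_law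
  joint_law0 joint_law_ge0 joint_law_sigma_additive.

Let joint_law_setT : joint_law setT = 1.
Proof.
rewrite /joint_law (eq_integral (cst 1)) ?integral_cst ?mul1e//.
  exact: probability_setT.
by move=> u _; exact: prob_kernel.
Qed.

HB.instance Definition _ := Measure_isProbability.Build _ _ _ joint_law
  joint_law_setT.

End joint_law.

Section divergences.
Context d (X : measurableType d) (R : realType).

Definition mixture (l : {i01 R}) (P P' : probability X R) : set X -> \bar R :=
  measure_add (mscale (l%:num%R)%:nng%R P) (mscale (1 - l%:num)%:nng%R P').

HB.instance Definition _ l P P' := Measure.on (mixture l P P').

Let mixture_setT l P P' : mixture l P P' setT = 1.
Proof.
rewrite /mixture measure_addE.
rewrite [X in X + _](_ : _ = l%:num%:E * P setT)//.
rewrite [X in _ + X](_ : _ = (1 - l%:num)%:E * P' setT)//.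
by rewrite !probability_setT !mule1 -EFinD addrC subrK.
Qed.

HB.instance Definition _ l P P' :=
  Measure_isProbability.Build _ _ _ (mixture l P P') (mixture_setT l P P').

Definition sum_measure (P P' : probability X R) : set X -> \bar R :=
  measure_add P P'.

HB.instance Definition _ P P' := Measure.on (sum_measure P P').

Let sum_measure_fin P P' : fin_num_fun (sum_measure P P').
Proof.
move=> A mA; rewrite /sum_measure measure_addE.
by rewrite fin_numD !fin_num_measure.
Qed.

HB.instance Definition _ P P' := Measure_isFinite.Build _ _ _
  (sum_measure P P') (sum_measure_fin P P').

(* A real-valued version of dP/dmu. *)
Definition density (mu : {sigma_finite_measure set X -> \bar R})
    (P : probability X R) (x : X) : R :=
  fine (Radon_Nikodym (charge_of_finite_measure P) mu x).

(* The integral does not depend on the dominating measure: take P + P'. *)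
Definition hellinger2 (P P' : probability X R) : \bar R :=
  let mu := sum_measure P P' in
  \int[mu]_x ((Num.sqrt (density mu P x) - Num.sqrt (density mu P' x)) ^+ 2)%:E.

(* chi^2 (P' || P) *)
Definition chi2 (P' P : probability X R) : \bar R :=
  if `[< P' `<< P >] then \int[P]_x ((density P P' x - 1) ^+ 2)%:E else +oo.

End divergences.

Section almost_everywhere.
Context d (X : measurableType d) (R : realType).
Variables (mu : {measure set X -> \bar R}) (D : set X) (f : X -> R).

Definition ae_measurable :=
  exists2 f' : X -> R, measurable_fun D f' & ae_eq mu D f f'.

Definition ae_integrable :=
  exists2 f' : X -> R, mu.-integrable D (EFin \o f') & ae_eq mu D f f'.

End almost_everywhere.

Section real_functions.
Context (R : realType).
Implicit Types (I : set R) (f : R -> R).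

Definition abs_continuous I f :=
  forall e : R, (0 < e)%R -> exists2 dl : R, (0 < dl)%R &
    forall (m : nat) (a b : 'I_m -> R),
      (forall i, [/\ I (a i), I (b i) & (a i <= b i)%R]) ->
      trivIset [set: 'I_m] (fun i => `]a i, b i[%classic) ->
      (\sum_(i < m) (b i - a i) < dl)%R ->
      (\sum_(i < m) `|f (b i) - f (a i)| < e)%R.

Definition continuously_derivable I f :=
  (forall t, I t -> derivable f t 1) /\ (forall t, I t -> {for t, continuous (derive1 f)}).

(* phi is a C^1 diffeomorphism from R onto the open set I. *)
Definition diffeomorphism_onto I (phi : R -> R) :=
  exists g : R -> R,
    [/\ forall u, I (phi u), cancel phi g, forall t, I t -> phi (g t) = t,
        continuously_derivable setT phi & continuously_derivable I g].

End real_functions.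

Section model.
Context d (X : measurableType d) (R : realType).
Variable nu : {sigma_finite_measure set X -> \bar R}.

Record model := Model {
  law :> probability X R ;
  has_density : exists p : X -> \bar R,
    [/\ measurable_fun setT p, forall x, 0 <= p x &
        forall A, measurable A -> law A = \int[nu]_(x in A) p x] }.

(* Paths are total functions of t, but only their germ at 0 matters: a path
   given on a neighbourhood of 0 may be extended by P_0. *)
Implicit Types (P : R -> model) (psi : model -> R) (g : X -> R).

Definition root_density (P : model) (x : X) : R := Num.sqrt (density nu P x).

(* \int [dP_{t+h}^{1/2} - dP_t^{1/2} - h xi]^2 dnu = o(h^2) *)
Definition root_expansion P (t : R) (xi : X -> R) :=
  (h ^- 2)%:E * \int[nu]_x ((root_density (P (t + h)%R) x
      - root_density (P t) x - h * xi x) ^+ 2)%:E @[h --> 0%R^'] --> 0.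

Definition qmd P g :=
  root_expansion P 0 (fun x => 2^-1 * g x * root_density (P 0%R) x)%R.

Definition hellinger_derivative P t : set (X -> R) :=
  [set xi | xi \in Lfun nu 2%:E /\ root_expansion P t xi].

Definition hellinger_differentiable P t := hellinger_derivative P t !=set0.

(* The derivative is unique up to nu-negligible sets. *)
Definition fisher_information P t : \bar R :=
  4%:E * \int[nu]_x ((xget (cst 0%R) (hellinger_derivative P t) x) ^+ 2)%:E.

Definition L20 (P0 : model) : set (X -> R) :=
  [set g | g \in Lfun P0 2%:E /\ 'E_P0[g] = 0].

Definition pathwise_gradient (P0 : model) psi (dpsi : X -> R) :=
  dpsi \in Lfun P0 2%:E /\
  forall g P, L20 P0 g -> P 0%R ≡μ P0 -> qmd P g ->
    (`|psi (P t) - psi P0 - t * \int[P0]_x (dpsi x * g x)| / `|t|)%R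
      @[t --> (0%R : R)^'] --> (0%R : R).

Definition projection_L20 (P0 : model) (f e : X -> R) :=
  L20 P0 e /\
  forall g, L20 P0 g -> (\int[P0]_x ((f x - e x) * g x))%R = 0%R.

Definition efficient_influence_function (P0 : model) psi (e : X -> R) :=
  exists2 dpsi, pathwise_gradient P0 psi dpsi & projection_L20 P0 dpsi e.

Section bounds.
Variables (psi : model -> R) (P : R -> model) (c : R) (n : nat).

Definition theta_radius : R := (c / Num.sqrt n%:R)%R.

Definition Theta : set R := `](- theta_radius)%R, theta_radius[%classic.

Definition bracket2 (x y : \bar R) : \bar R := maxe 0 (x - y) ^+ 2.

Definition minimax_risk : \bar R :=
  ereal_inf [set ereal_sup
      [set \int[iid (P t) n]_x ((T x - psi (P t)) ^+ 2)%:E | t in Theta]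
    | T in [set T : n.-tuple X -> R | measurable_fun setT T]].

Definition prior_information (q : R -> R) : \bar R :=
  \int[lebesgue_measure]_(t in [set t | (0 < q t)%R]) (derive1 q t ^+ 2 / q t)%:E.

(* q is extended by 0 outside Theta, so that it vanishes at the endpoints. *)
Definition nice_prior (q : R -> R) (Q : probability R R) :=
  [/\ forall t, (0 <= q t)%R,
      forall t, ~ Theta t -> q t = 0%R,
      abs_continuous `[(- theta_radius)%R, theta_radius]%classic q,
      forall A, measurable A -> Q A = \int[lebesgue_measure]_(t in A) (q t)%:E &
      0 < prior_information q < +oo].

Definition admissible1 (phi q : R -> R) (Q : probability R R) :=
  [/\ nice_prior q Q,
      abs_continuous Theta phi,
      ae_integrable Q Theta phi /\ ae_integrable Q Theta (derive1 phi),
      \int[Q]_(t in Theta) fisher_information P t < +oo &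
      ae_measurable Q Theta (fun t => psi (P t) - phi t)%R].

Definition bound1 : \bar R :=
  ereal_sup [set v | exists phi q Q, admissible1 phi q Q /\
    v = bracket2
      (`| \int[Q]_(t in Theta) (derive1 phi t)%:E | /
         sqrte (prior_information q
                + n%:R%:E * \int[Q]_(t in Theta) fisher_information P t))
      (sqrte (\int[Q]_(t in Theta) ((psi (P t) - phi t) ^+ 2)%:E))].

(* k is a regular version, for Q, of u |-> P_{phi u}^n: its existence is what
   makes the law of (X, theta) meaningful, and this law does not depend on its
   choice. *)
Definition admissible (phi : R -> R) (Q : probability R R) (h : R)
    (k : R.-pker R ~> n.-tuple X) :=
  [/\ diffeomorphism_onto Theta phi,
      {ae Q, forall u, k u ≡μ iid (P (phi u)) n} &
      ae_integrable Q setT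
        (fun t => psi (P (phi t)) - psi (P (phi (t - h))))%R].

Definition shift_mean2 (phi : R -> R) (Q : probability R R) (h : R) : \bar R :=
  `| \int[Q]_t (psi (P (phi t)) - psi (P (phi (t - h)%R)))%:E | ^+ 2.

Definition mean_shift2 (phi : R -> R) (Q : probability R R) (h : R) : \bar R :=
  \int[Q]_t ((psi (P (phi t)) - psi (P (phi (t - h)%R))) ^+ 2)%:E.

Definition bound2 : \bar R :=
  ereal_sup [set v | exists phi Q (l : {i01 R}) h k, admissible phi Q h k /\
    v = bracket2
      ((1 - l%:num)%:E * sqrte (shift_mean2 phi Q h /
         chi2 (joint_law Q k h)
              (mixture l (joint_law Q k h) (joint_law Q k 0%R))))
      (sqrte (l%:num%:E * mean_shift2 phi Q h))].

Definition bound3 : \bar R :=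
  ereal_sup [set v | exists phi Q h k, admissible phi Q h k /\
    v = bracket2
      (sqrte (shift_mean2 phi Q h /
         (4%:E * hellinger2 (joint_law Q k 0%R) (joint_law Q k h))))
      (sqrte (mean_shift2 phi Q h))].

Definition bound4 : \bar R :=
  ereal_sup [set v | exists t1 t2, [/\ Theta t1, Theta t2 &
    v = maxe 0 ((1 - hellinger2 (iid (P t1) n) (iid (P t2) n)) / 4%:E)
        * (`|psi (P t1) - psi (P t2)| ^+ 2)%:E]].

End bounds.

(* sup_{g in L_2^0(P0)} liminf_{c -> oo} liminf_{n -> oo} n L_{n,g}(c), where
   L takes a path, c and n. *)
Definition local_limit (P0 : model) (P : (X -> R) -> R -> model)
    (L : (R -> model) -> R -> nat -> \bar R) : \bar R :=
  ereal_sup [set limf_einf (fun c : R =>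
      limn_einf (fun n : nat => n%:R%:E * L (P g) c n)) (pinfty_nbhs R)
    | g in L20 P0].

(* Conditions under which bound1 is defined near 0, and continuity at 0 of the
   Fisher information.  Without the latter the asymptotics of bound1 fails: for
   P_t = Bernoulli(1/2 + tau(t)/2), tau(t) = t + t^2 sin(t^-2), the path is
   Hellinger differentiable near 0 and QMD at 0, but \int I dQ blows up on
   Theta as n tends to infinity and n * bound1 tends to 0. *)
Definition regular_near0 psi P :=
  [/\ exists2 r : R, (0 < r)%R &
        (forall t, `](- r)%R, r[%classic t -> hellinger_differentiable P t) /\
        ae_measurable lebesgue_measure `](- r)%R, r[%classic (fun t => psi (P t)) &
      fisher_information P t @[t --> (0%R : R)] --> fisher_information P 0%R].

Definition tilted_path (P0 : model) (kappa : R -> R) g P :=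
  \forall t \near (0%R : R), forall A, measurable A ->
    P t A = \int[P0]_(x in A)
      ((\int[P0]_y kappa (t * g y))^-1 * kappa (t * g x))%:E.

End model.
Arguments root_expansion {d X R nu} P t xi.

Definition tilting_function (R : realType) (kappa : R -> R) :=
  [/\ forall x, (0 <= kappa x)%R,
      forall x, derivable kappa x 1 /\ derivable (derive1 kappa) x 1,
      kappa 0%R = 1%R /\ derive1 kappa 0%R = 1%R &
      exists K : R, forall x,
        (`|derive1 kappa x| <= K)%R /\ (`|derive1 (derive1 kappa) x| <= K)%R].

Definition two_point_constant (R : realType) : R :=
  sup [set eps ^+ 2 * (2^-1 * expR (- (eps ^+ 2 / 8)) - 4^-1)
      | eps in [set eps : R | 0 <= eps]]%R.

(* Main.v *)
From HB Require Import structures.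
Require Import Defs.
From mathcomp Require Import all_boot all_order all_algebra.
From mathcomp Require Import all_classical all_reals all_analysis.
From mathcomp Require Import measurable_realfun giry.
From mathcomp Require Import ring lra.
Set Implicit Arguments.
Unset Strict Implicit.
Unset Printing Implicit Defensive.
Import Order.TTheory GRing.Theory Num.Theory.
Import numFieldNormedType.Exports.
Local Open Scope classical_set_scope.
Local Open Scope ring_scope.
Local Open Scope ereal_scope.

(** Only one path matters: the one whose score is the efficient influence
function [eif].  Put [V = \int eif^2 dP0].  Along this path [psi] has slope [V]
at 0, by pathwise differentiability and because [eif] is the projection of the
gradient, and the Fisher information at 0 is [V] as well.  Each supremum over
scores is therefore bounded below by the value of the bound along this path,
and in the local scale [t = s / sqrt n] that value tends to [V], or to
[C * V] for the two-point bound.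

Apart from the continuity of its Fisher information at 0, on which [bound1]
depends, all that is used of the path is [locally_gaussian]: [psi (P t)] is
[psi (P 0) + t * V + o(t)], and the Hellinger affinity of [P t] and [P t'] is
at least [1 - V (t - t')^2 / 8 - o(t^2 + t'^2)].  The affinity is handled
through its variational form: [a] is a lower bound for it exactly when
[2 a <= \int f dP + \int f^-1 dP'] for all measurable [f > 0].  This is
[affinity_ge].  It needs no common dominating measure, so it passes at once to
images, to products by Tonelli ([affinity_ge_prod], [affinity_ge_iid]) and to
joint laws with a discrete prior ([affinity_ge_joint_lattice_law]).  An affinity
of at least [a] bounds by [2 - 2 a] both the squared Hellinger distance
([hellinger2_le]) and the chi-square distance to the midpoint
([chi2_mixture_le]); and a well-chosen [f] bounds the difference of the means
of a statistic ([affinity_ge_mean_difference]).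

[bound2] and [bound3] share one witness: the uniform prior on [N] consecutive points of
a lattice of step [h / sqrt n], shifted by one step.  The shifted and unshifted
joint laws overlap on all but one atom each, so their squared Hellinger distance
is at most [2 / N + h^2 V / 4 + o(1)], while [psi] moves by [h V / sqrt n] per
step.  With [N] large and [h] small the ratio [h V / (2 (h^2 V / 4)^(1/2))] is
[sqrt V], and the subtracted term, about [h V], is small.  In [bound2]
[lambda = 1/2] is chosen, where it dominates [bound3].

[bound4] compares [P 0] with [P (s / sqrt n)], the affinity of the [n]-fold
products being about [exp (- s^2 V / 8)].

The minimax bound walks along the same lattice.  If an estimator had risk below
[y / n] at all its points, with [y < V], then between neighbours its mean could
not grow as fast as [psi] does, because the growth is limited by the affinity
and the risk.  After sufficiently many steps the bias would exceed what the risk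
allows ([risk_telescoping]).

For [bound1], take the prior with density proportional to [(1 - (t/r)^2)^2] on
[Theta], where [r = c / sqrt n], whose information is [10 / r^2 = 10 n / c^2],
and the affine [phi] of slope [V]: the bound is then about
[V^2 / (V + 10 / c^2)] after multiplication by [n]. *)

(** * Integrals of possibly non-measurable functions, and root densities *)

Section lower_integral.
Context d (T : measurableType d) (R : realType).
Variable mu : {measure set T -> \bar R}.
Import HBNNSimple.

(** For nonnegative functions the integral is a supremum over simple
functions below, so monotonicity requires no measurability.  The Fisher
information and [psi] along a path, which need not be measurable, are bounded
with this. *)
Lemma ge0_le_lower_integral (D : set T) (f g : T -> \bar R) :
  (forall x, D x -> 0 <= f x) -> (forall x, D x -> f x <= g x) ->
  \int[mu]_(x in D) f x <= \int[mu]_(x in D) g x.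
Proof.
move=> f0 fg; rewrite !ge0_integralE//; last first.
  by move=> x Dx; rewrite (le_trans (f0 x Dx))// fg.
apply: ereal_sup_le => _ [h hf <-]; exists h => // x.
apply: (le_trans (hf x)); rewrite /patch; case: ifPn => //.
by rewrite inE => /fg.
Qed.

Lemma ge0_le_integral_off_null (N : set T) (f g : T -> \bar R) :
  measurable N -> mu N = 0 -> (forall x, 0 <= f x) -> (forall x, 0 <= g x) ->
  (forall x, ~ N x -> f x = g x) ->
  \int[mu]_x f x <= \int[mu]_x g x.
Proof.
move=> mN N0 f0 g0 fg; rewrite !ge0_integralTE//.
apply: ge_ereal_sup => _ [h hf <-].
pose k := mul_nnsfun h (indic_nnsfun R (measurableC mN)).
have -> : sintegral mu h = sintegral mu k.
  rewrite -!integralT_nnsfun; apply: ae_eq_integral => //.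
  - exact/measurable_EFinP.
  - exact/measurable_EFinP.
  - exists N; split=> // x; apply: contra_notP => Nx _ /=.
    by rewrite /mindic indicE mem_set// mulr1.
apply: ereal_sup_ubound; exists k => // x /=; rewrite /mindic indicE.
have [/set_mem Nx|/negP Nx] := boolP (x \in ~` N).
  by rewrite mulr1 -fg.
by rewrite mulr0.
Qed.

(** Needed for functions that are arbitrary outside the atoms of a
discrete prior, where almost everywhere equality is available but
measurability is not. *)
Lemma eq_integral_off_null (N : set T) (f g : T -> \bar R) :
  measurable N -> mu N = 0 -> (forall x, ~ N x -> f x = g x) ->
  \int[mu]_x f x = \int[mu]_x g x.
Proof.
move=> mN N0 fg.
have E (u v : T -> \bar R) : (forall x, 0 <= u x) -> (forall x, 0 <= v x) ->
    (forall x, ~ N x -> u x = v x) -> \int[mu]_x u x = \int[mu]_x v x.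
  move=> u0 v0 uv; apply/eqP; rewrite eq_le.
  rewrite (ge0_le_integral_off_null mN)//=.
  by apply: (ge0_le_integral_off_null mN) => // x /uv.
rewrite integralE [RHS]integralE; congr (_ - _); apply: E => // x Nx.
- by rewrite !funeposE fg.
- by rewrite !funenegE fg.
Qed.

End lower_integral.

Section root_density.
Context d (T : measurableType d) (R : realType).
Variables (mu : {sigma_finite_measure set T -> \bar R}) (P : probability T R).
Hypothesis Pmu : P `<< mu.

Lemma measurable_density : measurable_fun setT (density mu P).
Proof.
by apply: measurableT_comp.
Qed.

Lemma measurable_sqrt_density :
  measurable_fun setT (fun x => Num.sqrt (density mu P x)).
Proof.
apply: measurableT_comp measurable_density.
by apply: continuous_measurable_fun; exact: sqrt_continuous.
Qed.

Lemma integrable_density : mu.-integrable setT (EFin \o density mu P).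
Proof.
have Pi : mu.-integrable setT (Radon_Nikodym (charge_of_finite_measure P) mu).
  exact: Radon_Nikodym_integrable.
apply: eq_integrable Pi => // x _; rewrite /= /density fineK//.
exact: Radon_Nikodym_fin_num.
Qed.

Lemma integral_density A : measurable A ->
  \int[mu]_(x in A) (density mu P x)%:E = P A.
Proof.
move=> mA; rewrite [RHS](Radon_Nikodym_integral
  (nu := charge_of_finite_measure P) (mu := mu))//.
apply: eq_integral => x _; rewrite /density fineK//.
exact: Radon_Nikodym_fin_num.
Qed.

(** [density] is only determined almost everywhere, so it may be negative
on a null set. *)
Lemma density_ae_ge0 : {ae mu, forall x, (0 <= density mu P x)%R}.
Proof.
have := ae_eq_Radon_Nikodym_SigmaFinite Pmu measurableT.
apply: filterS => x /(_ I) e; rewrite /density -e fine_ge0//.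
exact: Radon_Nikodym_SigmaFinite.f_ge0.
Qed.

(** Stated with the square of the root density, which is everywhere
nonnegative, in place of [density]. *)
Lemma ge0_integral_density (f : T -> \bar R) :
  measurable_fun setT f -> (forall x, 0 <= f x) ->
  \int[P]_x f x = \int[mu]_x (f x * (Num.sqrt (density mu P x) ^+ 2)%:E).
Proof.
move=> mf f0; rewrite -(Radon_Nikodym_SigmaFinite.change_of_variables Pmu)//.
apply: ae_eq_integral => //.
- apply: emeasurable_funM => //; apply: measurable_int.
  exact: Radon_Nikodym_SigmaFinite.f_integrable.
- apply: emeasurable_funM => //; apply/measurable_EFinP.
  by apply: measurable_funX; exact: measurable_sqrt_density.
- have := ae_eq_Radon_Nikodym_SigmaFinite Pmu measurableT.
  apply: filterS => x /(_ I) e _; rewrite /density -e sqr_sqrtr.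
    by rewrite fineK// Radon_Nikodym_SigmaFinite.f_fin_num.
  by rewrite fine_ge0// Radon_Nikodym_SigmaFinite.f_ge0.
Qed.

Lemma integral_sqr_sqrt_density :
  \int[mu]_x (Num.sqrt (density mu P x) ^+ 2)%:E = 1.
Proof.
rewrite -(@probability_setT _ _ _ P) -[RHS](mul1e) -integral_cst//.
by rewrite ge0_integral_density//; apply: eq_integral => x _; rewrite mul1e.
Qed.

End root_density.

(** * Lower bounds on the Hellinger affinity *)

Section affinity.
Context d (T : measurableType d) (R : realType).
Implicit Types (P : probability T R) (f : T -> R) (a : R).

(** The affinity [\int (dP dP')^(1/2)] is at least [a]: indeed
[2 \int (dP dP')^(1/2)] is the infimum of the right-hand sides, by the
inequality of arithmetic and geometric means, the optimal [f] being
[(dP'/dP)^(1/2)]. *)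
Definition affinity_ge P P' a := forall f, measurable_fun setT f ->
  (forall x, 0 < f x)%R ->
  (2 * a)%:E <= \int[P]_x (f x)%:E + \int[P']_x ((f x)^-1)%:E.

Lemma ge0_integral_shift P f e : measurable_fun setT f ->
  (forall x, 0 <= f x)%R -> (0 <= e)%R ->
  \int[P]_x (f x + e)%:E = \int[P]_x (f x)%:E + e%:E.
Proof.
move=> mf f0 e0; under eq_integral do rewrite EFinD.
rewrite ge0_integralD//; last exact/measurable_EFinP.
  rewrite [X in _ + X](_ : _ = e%:E)//.
  by rewrite integral_cst//= probability_setT mule1.
by move=> x _; rewrite lee_fin.
Qed.

Lemma measurable_inv f : measurable_fun setT f -> (forall x, 0 < f x)%R ->
  measurable_fun setT (fun x => (f x)^-1)%R.
Proof.
move=> mf f0; rewrite (_ : (fun _ => _) = (fun x => f x `^ (-1))%R).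
  exact: (@measurableT_comp _ _ _ _ _ _ (@powR R ^~ (-1)%R) _ f).
by apply/funext => x; rewrite powR_inv1// ltW.
Qed.

(** Truncating [f] to values between [M^-1] and [M] raises each of the two
integrals by at most [M^-1], so bounded test functions suffice; for these all
integrals are finite. *)
Lemma affinity_ge_bounded P P' a :
  (forall f M, measurable_fun setT f -> (0 < M)%R ->
     (forall x, M^-1 <= f x <= M)%R ->
     (2 * a)%:E <= \int[P]_x (f x)%:E + \int[P']_x ((f x)^-1)%:E) ->
  affinity_ge P P' a.
Proof.
move=> H f mf f0; apply/lee_addgt0Pr => e e0.
pose M := (1 + 2 / e)%R.
have e20 : (0 < 2 / e)%R by rewrite divr_gt0.
have M1 : (1 <= M)%R by rewrite lerDl ltW.
have M0 : (0 < M)%R by rewrite (lt_le_trans _ M1).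
have iM0 : (0 < M^-1)%R by rewrite invr_gt0.
have iM1 : (M^-1 <= M)%R by rewrite (le_trans _ M1)// invf_le1.
have iMe : (M^-1 <= e / 2)%R.
  by rewrite -[leRHS]invrK lef_pV2 ?posrE ?invr_gt0 ?divr_gt0// invf_div lerDr.
pose g x := Num.min M (Num.max M^-1 (f x))%R.
have mg : measurable_fun setT g.
  by apply: measurable_minr => //; exact: measurable_maxr.
have gM x : (M^-1 <= g x <= M)%R.
  by rewrite /g le_min iM1 le_max lexx ge_min lexx.
have g0 x : (0 < g x)%R by have /andP[+ _] := gM x; exact: lt_le_trans.
apply: (le_trans (H g M mg M0 gM)).
apply: (@le_trans _ _ (\int[P]_x (f x + e / 2)%:E
    + \int[P']_x ((f x)^-1 + e / 2)%:E)); last first.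
  have e2 : (0 <= e / 2)%R by rewrite ltW// divr_gt0.
  have fi0 x : (0 <= (f x)^-1)%R by rewrite invr_ge0 ltW.
  rewrite !ge0_integral_shift//; last 2 first.
  - exact: measurable_inv.
  - by move=> x; rewrite ltW.
  by rewrite addeACA -EFinD -splitr.
apply: leeD; apply: ge0_le_lower_integral => x _; rewrite lee_fin.
- exact: ltW.
- rewrite /g ge_min; apply/orP; right.
  rewrite ge_max lerDl (ltW (divr_gt0 e0 _))// andbT.
  by rewrite (le_trans iMe)// lerDr ltW.
- by rewrite invr_ge0 ltW.
- have fi0 : (0 < (f x)^-1)%R by rewrite invr_gt0.
  have : (Num.min M (f x) <= g x)%R by rewrite le_min ge_min lexx/= ge_min !le_max lexx !orbT.
  rewrite ge_min => /orP[h|h].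
    have : ((g x)^-1 <= M^-1)%R by rewrite lef_pV2 ?posrE.
    by move=> /le_trans; apply; rewrite (le_trans iMe)// lerDr ltW.
  have : ((g x)^-1 <= (f x)^-1)%R by rewrite lef_pV2 ?posrE.
  by move=> /le_trans; apply; rewrite lerDl ltW// divr_gt0.
Qed.

(** Integrate [2 u v <= f u^2 + f^-1 v^2] for the root densities [u]
and [v], using [2 u v = u^2 + v^2 - (u - v)^2]. *)
Lemma affinity_ge_root_density (mu : {sigma_finite_measure set T -> \bar R})
    P P' (e : R) : P `<< mu -> P' `<< mu ->
  \int[mu]_x ((Num.sqrt (density mu P x) - Num.sqrt (density mu P' x)) ^+ 2)%:E
    <= e%:E ->
  affinity_ge P P' (1 - e / 2).
Proof.
move=> Pmu P'mu He f mf f0.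
set u := fun x => Num.sqrt (density mu P x).
set v := fun x => Num.sqrt (density mu P' x).
have mu_ : measurable_fun setT u by exact: measurable_sqrt_density.
have mv_ : measurable_fun setT v by exact: measurable_sqrt_density.
have mf1 : measurable_fun setT (fun x => (f x)^-1)%R by exact: measurable_inv.
have fi0 x : (0 <= (f x)^-1)%R by rewrite invr_ge0 ltW.
rewrite (ge0_integral_density Pmu)//; last 2 first.
- exact/measurable_EFinP.
- by move=> x; rewrite lee_fin ltW.
rewrite (ge0_integral_density P'mu)//; last exact/measurable_EFinP.
rewrite mulrBr mulr1 mulrCA divff// mulr1 EFinB leeBlDr//.
apply: (@le_trans _ _ (\int[mu]_x (f x * u x ^+ 2)%:E
    + \int[mu]_x ((f x)^-1 * v x ^+ 2)%:E
    + \int[mu]_x ((u x - v x) ^+ 2)%:E)); last first.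
  by apply: leeD => //; apply: leeD.
have m1 : measurable_fun setT (fun x => (f x * u x ^+ 2)%:E).
  by apply/measurable_EFinP/measurable_funM => //; exact: measurable_funX.
have m2 : measurable_fun setT (fun x => ((f x)^-1 * v x ^+ 2)%:E).
  by apply/measurable_EFinP/measurable_funM => //; exact: measurable_funX.
have m3 : measurable_fun setT (fun x => ((u x - v x) ^+ 2)%:E).
  by apply/measurable_EFinP/measurable_funX; exact: measurable_funB.
have p1 x : (0 <= f x * u x ^+ 2)%R by rewrite mulr_ge0 ?sqr_ge0// ltW.
have p2 x : (0 <= (f x)^-1 * v x ^+ 2)%R by rewrite mulr_ge0 ?sqr_ge0.
rewrite -ge0_integralD//; last by move=> x _; rewrite lee_fin.
  2: by move=> x _; rewrite lee_fin.
rewrite -ge0_integralD//; first last.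
- by move=> x _; rewrite lee_fin sqr_ge0.
- exact: emeasurable_funD.
- by move=> x _; rewrite lee_fin addr_ge0.
rewrite [X in X <= _](_ : _ =
    \int[mu]_x ((u x ^+ 2)%:E + (v x ^+ 2)%:E)); last first.
  rewrite ge0_integralD//; last 4 first.
  - by move=> x _; rewrite lee_fin sqr_ge0.
  - by apply/measurable_EFinP; exact: measurable_funX.
  - by move=> x _; rewrite lee_fin sqr_ge0.
  - by apply/measurable_EFinP; exact: measurable_funX.
  by rewrite !integral_sqr_sqrt_density.
apply: ge0_le_lower_integral => x _; rewrite -!EFinD lee_fin.
  by rewrite addr_ge0 ?sqr_ge0.
rewrite -subr_ge0 [leRHS](_ : _ = (f x)^-1 * (f x * u x - v x) ^+ 2)%R.
  by rewrite mulr_ge0// sqr_ge0.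
by field; rewrite gt_eqF.
Qed.

Lemma affinity_geW P P' a b : (b <= a)%R -> affinity_ge P P' a ->
  affinity_ge P P' b.
Proof.
move=> ba H f mf f0; apply: le_trans (H f mf f0).
by rewrite lee_fin ler_pM2l.
Qed.

Lemma affinity_ge0 P P' : affinity_ge P P' 0.
Proof.
move=> f mf f0; rewrite mulr0 adde_ge0// integral_ge0// => x _.
  by rewrite lee_fin ltW.
by rewrite lee_fin invr_ge0 ltW.
Qed.

End affinity.

Section affinity_image.
Context d1 (T1 : measurableType d1) d2 (T2 : measurableType d2) (R : realType).
Implicit Types (P : probability T1 R).

Lemma affinity_ge_distribution P P' a (X : {mfun T1 >-> T2}) :
  affinity_ge P P' a ->
  affinity_ge (distribution P X) (distribution P' X) a.
Proof.
move=> H f mf f0.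
rewrite !ge0_integral_distribution//.
- by apply: (H (f \o X)) => [|x]; [exact: measurableT_comp|exact: f0].
- by apply/measurable_EFinP; exact: measurable_inv.
- by move=> x; rewrite lee_fin invr_ge0 ltW.
- exact/measurable_EFinP.
- by move=> x; rewrite lee_fin ltW.
Qed.

(** Tonelli: for fixed [x] the affinity of [Q] and [Q'] bounds from below the
product of the inner integrals of [f] and [f^-1] by [b^2]; the inner integral of [f],
divided by [b], is then a test function for [P] and [P']. *)
Lemma affinity_ge_prod P P' (Q Q' : probability T2 R) (a b : R) :
  (0 <= a)%R -> (0 <= b)%R -> affinity_ge P P' a -> affinity_ge Q Q' b ->
  affinity_ge (P \x Q) (P' \x Q') (a * b).
Proof.
move=> a0; rewrite le_eqVlt => /predU1P[<- _ _|b0 HP HQ].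
  by rewrite mulr0; exact: affinity_ge0.
apply: affinity_ge_bounded => f M mf M0 fM.
have iM0 : (0 < M^-1)%R by rewrite invr_gt0.
have f0 z : (0 < f z)%R by have /andP[+ _] := fM z; exact: lt_le_trans.
have mif := measurable_inv mf f0.
have sec x : measurable_fun setT (fun y => f (x, y)) by exact: measurableT_comp.
have isec x : measurable_fun setT (fun y => (f (x, y))^-1)%R.
  exact: measurable_inv.
have fi0 z : (0 < (f z)^-1)%R by rewrite invr_gt0.
pose A x := \int[Q]_y (f (x, y))%:E.
pose B x := \int[Q']_y ((f (x, y))^-1)%:E.
have bnd (Q0 : probability T2 R) (g : T2 -> R) : measurable_fun setT g ->
    (forall y, M^-1 <= g y <= M)%R ->
    M^-1%:E <= \int[Q0]_y (g y)%:E <= M%:E.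
  move=> mg gM; have g0 y : (0 <= g y)%R.
    by have /andP[+ _] := gM y; apply: le_trans; rewrite ltW.
  apply/andP; split.
    rewrite -[leLHS]mule1 -(@probability_setT _ _ _ Q0) -integral_cst//.
    apply: ge0_le_lower_integral => y _; rewrite lee_fin; first exact: ltW.
    by have /andP[] := gM y.
  rewrite -[leRHS]mule1 -(@probability_setT _ _ _ Q0) -integral_cst//.
  apply: ge0_le_lower_integral => y _; rewrite lee_fin//.
  by have /andP[] := gM y.
have AM x : M^-1%:E <= A x <= M%:E by apply: bnd.
have BM x : M^-1%:E <= B x <= M%:E.
  apply: bnd => // y; have /andP[h1 h2] := fM (x, y).
  by rewrite lef_pV2 ?posrE// h2/= -[leRHS]invrK lef_pV2 ?posrE.
have finb (z : \bar R) : M^-1%:E <= z <= M%:E -> z = (fine z)%:E /\ (0 < fine z)%R.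
  move: z => [z| |]; rewrite ?leye_eq ?leeNy_eq ?andbF//= lee_fin => /andP[h _].
  by split=> //; exact: lt_le_trans h.
have [Afin A0] : (forall x, A x = (fine (A x))%:E) /\ (forall x, 0 < fine (A x))%R.
  by split=> x; have [] := finb _ (AM x).
have [Bfin B0] : (forall x, B x = (fine (B x))%:E) /\ (forall x, 0 < fine (B x))%R.
  by split=> x; have [] := finb _ (BM x).
have mA : measurable_fun setT A.
  apply: (measurable_fun_fubini_tonelli_F (m2 := Q) (EFin \o f)).
    exact/measurable_EFinP.
  by move=> z; rewrite lee_fin ltW.
have mB : measurable_fun setT B.
  apply: (measurable_fun_fubini_tonelli_F (m2 := Q') (fun z => ((f z)^-1)%:E)).
    exact/measurable_EFinP.
  by move=> z; rewrite lee_fin ltW.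
(* For the section of f rescaled by b / A x, the affinity of Q and Q' reads
   b ^+ 2 <= A x * B x. *)
have key x : (b * (fine (A x) / b)^-1 <= fine (B x))%R.
  set p := fine (A x); set q := fine (B x).
  have p0 : (0 < p)%R by exact: A0.
  have bp0 : (0 < b / p)%R by rewrite divr_gt0.
  have := HQ (fun y => (b / p) * f (x, y))%R (measurable_funM (measurable_cst _) (sec x)).
  move=> /(_ (fun y => mulr_gt0 bp0 (f0 _))).
  under eq_integral do rewrite EFinM.
  rewrite ge0_integralZl//; last 3 first.
  - exact/measurable_EFinP.
  - by move=> y _; rewrite lee_fin ltW.
  - by rewrite lee_fin ltW.
  under [X in _ + X]eq_integral do rewrite invfM EFinM.
  rewrite ge0_integralZl//; last 3 first.
  - exact/measurable_EFinP.
  - by move=> y _; rewrite lee_fin ltW.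
  - by rewrite lee_fin ltW// invr_gt0.
  rewrite -/(A x) -/(B x) Afin Bfin -/p -/q -!EFinM -EFinD lee_fin invf_div.
  rewrite mulfVK ?gt_eqF// => h; rewrite invf_div.
  have : (b <= p / b * q)%R by lra.
  by rewrite mulrAC ler_pdivlMr// => h2; rewrite mulrA ler_pdivrMr// [leRHS]mulrC.
rewrite !fubini_tonelli1//.
- rewrite -/(A) -/(B).
  apply: (@le_trans _ _ (b%:E * (\int[P]_x (fine (A x) / b)%:E
       + \int[P']_x ((fine (A x) / b)^-1)%:E))).
    rewrite (_ : 2 * (a * b) = b * (2 * a))%R; last by ring.
    rewrite EFinM; apply: lee_wpmul2l; first by rewrite lee_fin ltW.
    apply: (HP (fun x => fine (A x) / b)%R).
      by apply: measurable_funM => //; exact: measurableT_comp mA.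
    by move=> x; rewrite divr_gt0.
  have mA' : measurable_fun setT (fun x => fine (A x) / b)%R.
    by apply: measurable_funM => //; exact: measurableT_comp mA.
  have A'0 x : (0 < fine (A x) / b)%R by rewrite divr_gt0.
  rewrite ge0_muleDr; last 2 first.
  - by apply: integral_ge0 => x _; rewrite lee_fin ltW.
  - by apply: integral_ge0 => x _; rewrite lee_fin ltW// invr_gt0.
  rewrite -!ge0_integralZl//; last 6 first.
  - apply/measurable_EFinP; exact: measurable_inv.
  - by move=> x _; rewrite lee_fin ltW// invr_gt0.
  - by rewrite lee_fin ltW.
  - exact/measurable_EFinP.
  - by move=> x _; rewrite lee_fin ltW.
  - by rewrite lee_fin ltW.
  apply: leeD; apply: ge0_le_lower_integral => x _.
  + by rewrite -EFinM lee_fin mulr_ge0// ltW.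
  + by rewrite -EFinM mulrC divfK ?gt_eqF// -Afin.
  + by rewrite -EFinM lee_fin mulr_ge0// ltW// invr_gt0.
  + by rewrite -EFinM [leRHS]Bfin lee_fin.
- exact/measurable_EFinP.
- by move=> z; rewrite lee_fin ltW.
- exact/measurable_EFinP.
- by move=> z; rewrite lee_fin ltW.
Qed.

End affinity_image.

Lemma affinity_ge_iid d (T : measurableType d) (R : realType)
    (P P' : probability T R) (a : R) n : (0 <= a)%R ->
  affinity_ge P P' a -> affinity_ge (iid P n) (iid P' n) (a ^+ n).
Proof.
move=> a0 H; elim: n => [|n IH]; last first.
  rewrite exprS; apply: affinity_ge_distribution.
  by apply: affinity_ge_prod => //; rewrite exprn_ge0.
move=> f mf f0; rewrite !integral_dirac//=; last 2 first.
- by apply/measurable_EFinP; exact: measurable_inv.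
- exact/measurable_EFinP.
rewrite !diracT !mul1e -EFinD lee_fin expr0 mulr1 -subr_ge0.
have := f0 [tuple]; set y := f _ => y0.
rewrite [leRHS](_ : _ = y^-1 * (y - 1) ^+ 2)%R.
  by rewrite mulr_ge0 ?sqr_ge0// invr_ge0 ltW.
by field; rewrite gt_eqF.
Qed.

(** * From the affinity to divergences and to differences of means *)

Section affinity_bounds.
Context d (T : measurableType d) (R : realType).
Implicit Types (P : probability T R) (a : R).

(** The optimal test function [v / u], for root densities [u] and [v], may vanish or
be undefined, so [u] and [v] are first regularised to [U = (u^2 + dl^2)^(1/2)] and
[V = (v^2 + dl^2)^(1/2)]: then [\int V/U u^2] and [\int U/V v^2] are at most
[\int U V], which tends to [\int u v] with [dl] as [m] is finite. *)
Lemma affinity_ge_le_integral (m : {finite_measure set T -> \bar R}) P P' a :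
  P `<< m -> P' `<< m -> affinity_ge P P' a ->
  a%:E <= \int[m]_x (Num.sqrt (density m P x) * Num.sqrt (density m P' x))%:E.
Proof.
move=> Pm P'm aff.
set u := fun x => Num.sqrt (density m P x).
set v := fun x => Num.sqrt (density m P' x).
have mu_ : measurable_fun setT u by exact: measurable_sqrt_density.
have mv_ : measurable_fun setT v by exact: measurable_sqrt_density.
have u0 x : (0 <= u x)%R by exact: sqrtr_ge0.
have v0 x : (0 <= v x)%R by exact: sqrtr_ge0.
have mE : m setT = (fine (m setT))%:E by rewrite fineK// fin_num_measure.
set M := fine (m setT) in mE.
have M0 : (0 <= M)%R by rewrite fine_ge0.
apply/lee_addgt0Pr => e e0.
pose dl := (Num.min 1 (e / (2 * M + 2)))%R.
have D0 : (0 < 2 * M + 2)%R by lra.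
have dl0 : (0 < dl)%R by rewrite lt_min ltr01 divr_gt0.
have dl1 : (dl <= 1)%R by rewrite ge_min lexx.
have dle : (dl * (2 * M + 2) <= e)%R.
  by rewrite -ler_pdivlMr// ge_min lexx orbT.
pose U x := Num.sqrt (u x ^+ 2 + dl ^+ 2)%R.
pose V x := Num.sqrt (v x ^+ 2 + dl ^+ 2)%R.
have posU (w : R) : (0 < w ^+ 2 + dl ^+ 2)%R.
  by rewrite ltr_wpDl ?sqr_ge0// exprn_gt0.
have U0 x : (0 < U x)%R by rewrite sqrtr_gt0.
have V0 x : (0 < V x)%R by rewrite sqrtr_gt0.
have U2 x : (U x ^+ 2 = u x ^+ 2 + dl ^+ 2)%R by rewrite sqr_sqrtr// ltW.
have V2 x : (V x ^+ 2 = v x ^+ 2 + dl ^+ 2)%R by rewrite sqr_sqrtr// ltW.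
have le_shift (w : R) : (0 <= w)%R -> (Num.sqrt (w ^+ 2 + dl ^+ 2) <= w + dl)%R.
  move=> w0; have wd0 : (0 <= w + dl)%R by rewrite addr_ge0// ltW.
  rewrite -[leRHS]ger0_norm// -sqrtr_sqr ler_wsqrtr// sqrrD.
  by rewrite lerD2r lerDl mulrn_wge0// mulr_ge0// ltW.
have msq (w : T -> R) : measurable_fun setT w ->
    measurable_fun setT (fun x => Num.sqrt (w x ^+ 2 + dl ^+ 2)%R).
  move=> mw; apply: (@measurableT_comp _ _ _ _ _ _ (@Num.sqrt R)).
    by apply: continuous_measurable_fun; exact: sqrt_continuous.
  by apply: measurable_funD => //; exact: measurable_funX.
have mU : measurable_fun setT U by exact: msq.
have mV : measurable_fun setT V by exact: msq.
have mf : measurable_fun setT (fun x => V x / U x)%R.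
  by apply: measurable_funM => //; exact: measurable_inv.
have f0 x : (0 < V x / U x)%R by rewrite divr_gt0.
(* The error term has integral dl * (2 * M + 1), which is at most e by the
   choice of dl. *)
have UV x : (U x * V x <= u x * v x + dl * (1 + (u x ^+ 2 / 2 + v x ^+ 2 / 2 + 1)))%R.
  apply: (@le_trans _ _ ((u x + dl) * (v x + dl))%R).
    by apply: ler_pM; rewrite ?le_shift// ltW.
  rewrite -subr_ge0 [leRHS](_ : _ = dl * ((u x - 1) ^+ 2 / 2 + (v x - 1) ^+ 2 / 2 + (1 - dl)))%R.
    apply: mulr_ge0; first exact: ltW.
    by have := sqr_ge0 (u x - 1); have := sqr_ge0 (v x - 1); lra.
  by field.
have key : (2 * a)%:E <= \int[m]_x ((u x * v x + dl * (1 + (u x ^+ 2 / 2 + v x ^+ 2 / 2 + 1)))%:E)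
   + \int[m]_x ((u x * v x + dl * (1 + (u x ^+ 2 / 2 + v x ^+ 2 / 2 + 1)))%:E).
  apply: le_trans (aff _ mf f0) _.
  rewrite (ge0_integral_density Pm)//; last 2 first.
  - exact/measurable_EFinP.
  - by move=> x; rewrite lee_fin ltW.
  rewrite (ge0_integral_density P'm)//; last 2 first.
  - by apply/measurable_EFinP; exact: measurable_inv.
  - by move=> x; rewrite lee_fin invr_ge0 ltW.
  apply: leeD; apply: ge0_le_lower_integral => x _; rewrite -EFinM lee_fin.
  - by rewrite mulr_ge0 ?sqr_ge0// ltW.
  - apply: le_trans (UV x); rewrite -/(u x).
    apply: (@le_trans _ _ (V x / U x * U x ^+ 2)%R).
      by rewrite ler_wpM2l ?(ltW (f0 x))// U2 lerDl sqr_ge0.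
    by rewrite expr2 mulrA divfK ?gt_eqF// mulrC.
  - by rewrite mulr_ge0 ?sqr_ge0// invr_ge0 ltW.
  - apply: le_trans (UV x); rewrite -/(v x) invf_div.
    apply: (@le_trans _ _ (U x / V x * V x ^+ 2)%R).
      by rewrite ler_wpM2l ?divr_ge0 ?(ltW (U0 x)) ?(ltW (V0 x))// V2 lerDl sqr_ge0.
    by rewrite expr2 mulrA divfK ?gt_eqF// mulrC.
have IE : \int[m]_x ((u x * v x + dl * (1 + (u x ^+ 2 / 2 + v x ^+ 2 / 2 + 1)))%:E) =
   \int[m]_x (u x * v x)%:E + (dl * (2 * M + 1))%:E.
  have mu2 : measurable_fun setT (fun x => (u x ^+ 2 / 2)%:E).
    by apply/measurable_EFinP/measurable_funM => //; exact: measurable_funX.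
  have mv2 : measurable_fun setT (fun x => (v x ^+ 2 / 2)%:E).
    by apply/measurable_EFinP/measurable_funM => //; exact: measurable_funX.
  have half (w : T -> R) : measurable_fun setT w -> \int[m]_x (w x ^+ 2)%:E = 1 ->
      \int[m]_x (w x ^+ 2 / 2)%:E = (2^-1)%:E.
    move=> mw w1; under eq_integral do rewrite mulrC EFinM.
    rewrite ge0_integralZl//; first by rewrite w1 mule1.
    - by apply/measurable_EFinP; exact: measurable_funX.
    - by move=> x _; rewrite lee_fin sqr_ge0.
  under eq_integral do rewrite EFinD (EFinM dl).
  have p2 (w : R) : (0 <= w ^+ 2 / 2)%R by rewrite divr_ge0 ?sqr_ge0.
  have ms : measurable_fun setT (fun x => ((1 + (u x ^+ 2 / 2 + v x ^+ 2 / 2 + 1))%:E)).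
    apply/measurable_EFinP/measurable_funD => //.
    apply/measurable_funD => //; apply/measurable_funD; exact/measurable_EFinP.
  have s0 x : (0 <= 1 + (u x ^+ 2 / 2 + v x ^+ 2 / 2 + 1))%R.
    by rewrite !addr_ge0.
  rewrite ge0_integralD//; last 4 first.
  - by move=> x _; rewrite lee_fin mulr_ge0.
  - by apply/measurable_EFinP; exact: measurable_funM.
  - by move=> x _; rewrite mule_ge0// lee_fin// ltW.
  - exact: measurable_funeM.
  congr (_ + _).
  rewrite ge0_integralZl//; last 2 first.
  - by move=> x _; rewrite lee_fin.
  - by rewrite lee_fin ltW.
  rewrite EFinM; congr (_ * _).
  under eq_integral do rewrite EFinD EFinD EFinD.
  have i1 : \int[m]_x (1%:E) = M%:E by rewrite integral_cst//= mul1e mE.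
  rewrite ge0_integralD//; last 2 first.
  - by move=> x _; rewrite -!EFinD lee_fin !addr_ge0.
  - by apply: emeasurable_funD => //; exact: emeasurable_funD.
  rewrite ge0_integralD//; last 2 first.
  - by move=> x _; rewrite -!EFinD lee_fin !addr_ge0.
  - exact: emeasurable_funD.
  rewrite ge0_integralD//; last 2 first.
  - by move=> x _; rewrite lee_fin.
  - by move=> x _; rewrite lee_fin.
  rewrite !i1 !half//; last 2 first.
  - exact: integral_sqr_sqrt_density.
  - exact: integral_sqr_sqrt_density.
  by rewrite -!EFinD; congr EFin; field.
move: key; rewrite IE.
have : 0 <= \int[m]_x (u x * v x)%:E.
  by apply: integral_ge0 => x _; rewrite lee_fin mulr_ge0.
case: (\int[m]_x (u x * v x)%:E) => [I| |]//=.
- rewrite -!EFinD !lee_fin => I0 h.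
  by nra.
- by move=> _ _; rewrite addye// leey.
Qed.

Lemma integral_sqr_sub_sqrt_density_le (m : {finite_measure set T -> \bar R})
    P P' a : P `<< m -> P' `<< m -> affinity_ge P P' a ->
  \int[m]_x ((Num.sqrt (density m P x) - Num.sqrt (density m P' x)) ^+ 2)%:E
    <= (2 - 2 * a)%:E.
Proof.
move=> Pm P'm /(affinity_ge_le_integral Pm P'm).
set u := fun x => Num.sqrt (density m P x).
set v := fun x => Num.sqrt (density m P' x).
have mu_ : measurable_fun setT u by exact: measurable_sqrt_density.
have mv_ : measurable_fun setT v by exact: measurable_sqrt_density.
have u0 x : (0 <= u x)%R by exact: sqrtr_ge0.
have v0 x : (0 <= v x)%R by exact: sqrtr_ge0.
have E : \int[m]_x ((u x - v x) ^+ 2)%:E + 2%:E * \int[m]_x (u x * v x)%:E = 2%:E.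
  rewrite -ge0_integralZl//; last 2 first.
  - by apply/measurable_EFinP; exact: measurable_funM.
  - by move=> x _; rewrite lee_fin mulr_ge0.
  rewrite -ge0_integralD//; last 4 first.
  - by move=> x _; rewrite lee_fin sqr_ge0.
  - by apply/measurable_EFinP/measurable_funX; exact: measurable_funB.
  - by move=> x _; rewrite -EFinM lee_fin mulr_ge0// mulr_ge0.
  - by apply: measurable_funeM; apply/measurable_EFinP; exact: measurable_funM.
  transitivity (\int[m]_x ((u x ^+ 2)%:E + (v x ^+ 2)%:E)).
    by apply: eq_integral => x _; rewrite -EFinM -!EFinD; congr EFin; ring.
  rewrite ge0_integralD//; last 4 first.
  - by move=> x _; rewrite lee_fin sqr_ge0.
  - by apply/measurable_EFinP; exact: measurable_funX.
  - by move=> x _; rewrite lee_fin sqr_ge0.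
  - by apply/measurable_EFinP; exact: measurable_funX.
  by rewrite !integral_sqr_sqrt_density.
move: E.
case: (\int[m]_x (u x * v x)%:E) => [I| |]//=.
- case: (\int[m]_x ((u x - v x) ^+ 2)%:E) => [J| |]//=.
  by rewrite -EFinM -EFinD !lee_fin => -[] h1 h2; lra.
- by rewrite mulry gtr0_sg// mul1e; case: (\int[m]_x ((u x - v x) ^+ 2)%:E).
Qed.

Lemma hellinger2_ge0 P P' : 0 <= hellinger2 P P'.
Proof. by apply: integral_ge0 => x _; rewrite lee_fin sqr_ge0. Qed.

Lemma hellinger2_le P P' a : affinity_ge P P' a ->
  hellinger2 P P' <= (2 - 2 * a)%:E.
Proof.
move=> aff; apply: integral_sqr_sub_sqrt_density_le => //.
- apply/null_content_dominatesP => A mA.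
  rewrite (_ : _ A = P A + P' A); last exact: measure_addE.
  move=> /eqP.
  by rewrite padde_eq0// => /andP[/eqP].
- apply/null_content_dominatesP => A mA.
  rewrite (_ : _ A = P A + P' A); last exact: measure_addE.
  move=> /eqP.
  by rewrite padde_eq0// => /andP[_ /eqP].
Qed.

(** With respect to the midpoint [m] the densities satisfy [p + p' = 2], so with
[u] and [v] their roots [(p' - 1)^2 = (u - v)^2 (u + v)^2 / 4], and
[(u + v)^2 <= 2 (u^2 + v^2) = 4]: the integrand is at most that of the squared
Hellinger distance. *)
Lemma chi2_mixture_le (l : {i01 R}) P P' a : (l%:num = 2^-1)%R ->
  affinity_ge P P' a -> chi2 P' (mixture l P' P) <= (2 - 2 * a)%:E.
Proof.
move=> l2 aff; set m : probability T R := mixture l P' P.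
have mE A : m A = 2^-1%:E * P' A + 2^-1%:E * P A.
  rewrite (_ : m A = (l%:num)%:E * P' A + (1 - l%:num)%:E * P A).
    by rewrite l2; congr (_ + _%:E * _); lra.
  by rewrite /m/= /mixture measure_addE.
have P'm : P' `<< m.
  apply/null_content_dominatesP => A mA mA0; have : m A = 0 by exact: mA0.
  rewrite mE => /eqP.
  rewrite padde_eq0 ?mule_ge0 ?lee_fin// => /andP[/eqP + _] => /eqP.
  by rewrite mule_eq0 eqe invr_eq0 pnatr_eq0/= => /eqP.
have Pm : P `<< m.
  apply/null_content_dominatesP => A mA mA0; have : m A = 0 by exact: mA0.
  rewrite mE => /eqP.
  rewrite padde_eq0 ?mule_ge0 ?lee_fin// => /andP[_ /eqP] => /eqP.
  by rewrite mule_eq0 eqe invr_eq0 pnatr_eq0/= => /eqP.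
rewrite /chi2 asboolT//.
apply: le_trans (integral_sqr_sub_sqrt_density_le Pm P'm aff).
set p := density m P; set p' := density m P'.
have sum2 : ae_eq m setT (fun x => (p x + p' x)%:E) (cst 2%:E).
  apply: integral_ae_eq => //.
    under eq_fun do rewrite EFinD.
    by apply: integrableD => //; exact: integrable_density.
  move=> A _ mA; rewrite integral_cst// [X in _ = _ * X](mE A).
  under eq_integral do rewrite EFinD.
  rewrite integralD//; last 2 first.
  - by apply: (integrableS measurableT) => //; exact: integrable_density.
  - by apply: (integrableS measurableT) => //; exact: integrable_density.
  rewrite !integral_density// muleDr; last 2 first.
  - by [].
  - by apply: fin_num_adde_defl; rewrite fin_numM// fin_num_measure.
  by rewrite !muleA -EFinM divff// !mul1e addeC.
have mp (P1 : probability T R) : P1 `<< m -> measurable_fun setT (density m P1).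
  exact: measurable_density.
apply: ae_ge0_le_integral => //.
- by move=> x _; rewrite lee_fin sqr_ge0.
- apply/measurable_EFinP/measurable_funX/measurable_funB => //; exact: mp.
- by move=> x _; rewrite lee_fin sqr_ge0.
- by apply/measurable_EFinP/measurable_funX/measurable_funB; exact: measurable_sqrt_density.
have := density_ae_ge0 Pm; have := density_ae_ge0 P'm.
move: sum2; apply: filterS3 => x /(_ I) [s2] p'0 p0 _; rewrite lee_fin.
rewrite -/(p x) -/(p' x) in p0 p'0 *; move: s2 => /= s2.
have := sqr_sqrtr p0; have := sqr_sqrtr p'0.
have := sqrtr_ge0 (p x); have := sqrtr_ge0 (p' x).
set u := Num.sqrt (p x); set v := Num.sqrt (p' x) => v0 u0 v2 u2.
rewrite -subr_ge0 [leRHS](_ : _ = (u - v) ^+ 4 / 4)%R.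
  by rewrite divr_ge0// exprn_even_ge0.
have -> : (p' x - 1 = (v ^+ 2 - u ^+ 2) / 2)%R by rewrite u2 v2; lra.
rewrite [in LHS](_ : (u - v) ^+ 2 = (u - v) ^+ 2 * ((u ^+ 2 + v ^+ 2) / 2))%R.
  by field.
by rewrite u2 v2 s2 divff// mulr1.
Qed.

End affinity_bounds.

Section mean_difference.
Context d (T : measurableType d) (R : realType).
Implicit Types (P : probability T R) (S : T -> R).

Lemma integrable_of_sqr P S : measurable_fun setT S ->
  P.-integrable setT (fun x => (S x ^+ 2)%:E) ->
  P.-integrable setT (EFin \o S).
Proof.
move=> mS iS2; apply: (@le_integrable _ _ _ P setT measurableT _
  (fun x => (1 + S x ^+ 2)%:E)) => //.
- exact/measurable_EFinP.
- move=> x _ /=; rewrite lee_fin [leRHS]ger0_norm ?addr_ge0 ?sqr_ge0//.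
  rewrite ler_norml; apply/andP; split.
    by have := sqr_ge0 (S x + 1); nra.
  by have := sqr_ge0 (S x - 1); nra.
- under eq_fun do rewrite EFinD.
  by apply: integrableD => //; exact: finite_measure_integrable_cst.
Qed.

Lemma integrable_sqr_shift P S c : measurable_fun setT S ->
  \int[P]_x ((S x - c) ^+ 2)%:E < +oo ->
  P.-integrable setT (fun x => (S x ^+ 2)%:E).
Proof.
move=> mS fin; have mSc : measurable_fun setT (fun x => ((S x - c) ^+ 2)%:E).
  by apply/measurable_EFinP/measurable_funX; exact: measurable_funB.
have iSc : P.-integrable setT (fun x => ((S x - c) ^+ 2)%:E).
  apply/integrableP; split=> //.
  by under eq_integral do rewrite gee0_abs ?lee_fin ?sqr_ge0//.
apply: (@le_integrable _ _ _ P setT measurableT _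
  (fun x => (2 * (S x - c) ^+ 2 + 2 * c ^+ 2)%:E)) => //.
- by apply/measurable_EFinP; exact: measurable_funX.
- move=> x _ /=; rewrite lee_fin !ger0_norm ?sqr_ge0//; last first.
    by rewrite addr_ge0// mulr_ge0 ?sqr_ge0.
  by rewrite -subr_ge0; have := sqr_ge0 (S x - c - c); nra.
- under eq_fun do rewrite EFinD.
  apply: integrableD => //; last exact: finite_measure_integrable_cst.
  by under eq_fun do rewrite EFinM; exact: integrableZl.
Qed.

Lemma expectation_sqr_shift P S c : measurable_fun setT S ->
  P.-integrable setT (fun x => (S x ^+ 2)%:E) ->
  \int[P]_x ((S x - c) ^+ 2)%:E =
  (\int[P]_x (S x ^+ 2) - 2 * c * \int[P]_x S x + c ^+ 2)%:E%R.
Proof.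
move=> mS iS2; have iS := integrable_of_sqr mS iS2.
rewrite (_ : (fun x => _) = (fun x => (S x ^+ 2 - (2 * c * S x - c ^+ 2))%:E)); last first.
  by apply/funext => x; congr EFin; ring.
have ic : P.-integrable setT (EFin \o cst (c ^+ 2)%R).
  exact: finite_measure_integrable_cst.
have iZ : P.-integrable setT (EFin \o (fun x => 2 * c * S x)%R).
  by rewrite /comp; under eq_fun do rewrite EFinM; exact: integrableZl.
have iB : P.-integrable setT (EFin \o (fun x => 2 * c * S x - c ^+ 2)%R).
  by rewrite /comp; under eq_fun do rewrite EFinB; exact: integrableB.
rewrite -[LHS]fineK; last first.
  apply: integrable_fin_num => //.
  by under eq_fun do rewrite EFinB; exact: integrableB.
congr EFin; rewrite -/(Rintegral _ _ _).
rewrite RintegralB// RintegralB// RintegralZl// Rintegral_cst//=.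
by rewrite probability_setT/=; ring.
Qed.

Lemma sqr_expectation_le P S : measurable_fun setT S ->
  P.-integrable setT (fun x => (S x ^+ 2)%:E) ->
  ((\int[P]_x S x) ^+ 2 <= \int[P]_x (S x ^+ 2))%R.
Proof.
move=> mS iS2.
have := expectation_sqr_shift (\int[P]_x S x)%R mS iS2.
set m := (\int[P]_x S x)%R => E.
have : 0 <= \int[P]_x ((S x - m) ^+ 2)%:E.
  by apply: integral_ge0 => x _; rewrite lee_fin sqr_ge0.
by rewrite E lee_fin; lra.
Qed.

(** Take [f = (1 + (tau S)^2)^(1/2) + tau S] as test function.  Its inverse is
[(1 + (tau S)^2)^(1/2) - tau S], so the linear terms produce the difference of
the means, and the square roots are at most [1 + (tau S)^2 / 2]. *)
Lemma affinity_ge_mean_difference P P' (a : R) S (tau : R) :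
  affinity_ge P P' a -> (0 < tau)%R -> measurable_fun setT S ->
  P.-integrable setT (fun x => (S x ^+ 2)%:E) ->
  P'.-integrable setT (fun x => (S x ^+ 2)%:E) ->
  (\int[P']_x S x - \int[P]_x S x <=
    (2 - 2 * a) / tau
    + tau / 2 * (\int[P]_x (S x ^+ 2) + \int[P']_x (S x ^+ 2)))%R.
Proof.
move=> aff tau0 mS iS iS'.
pose g x := Num.sqrt (1 + (tau * S x) ^+ 2)%R.
have p0 x : (0 < 1 + (tau * S x) ^+ 2)%R by rewrite ltr_wpDr ?sqr_ge0.
have g2 x : (g x ^+ 2 = 1 + (tau * S x) ^+ 2)%R by rewrite sqr_sqrtr// ltW.
have g0 x : (0 < g x)%R by rewrite sqrtr_gt0.
have gabs x : (`|tau * S x| < g x)%R.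
  rewrite -sqrtr_sqr; rewrite ltr_sqrt//.
  by rewrite ltrDr.
have mtS : measurable_fun setT (fun x => tau * S x)%R.
  by apply: measurable_funM.
have mg : measurable_fun setT g.
  apply: (@measurableT_comp _ _ _ _ _ _ (@Num.sqrt R)).
    by apply: continuous_measurable_fun; exact: sqrt_continuous.
  by apply: measurable_funD => //; exact: measurable_funX.
pose f x := (g x + tau * S x)%R.
have f0 x : (0 < f x)%R.
  by have := gabs x; rewrite ltr_norml => /andP[h _]; rewrite /f; lra.
have fV x : ((f x)^-1 = g x - tau * S x)%R.
  apply: (mulfI (lt0r_neq0 (f0 x))); rewrite mulfV ?gt_eqF//.
  rewrite [RHS](_ : _ = g x ^+ 2 - (tau * S x) ^+ 2)%R; last by rewrite /f; ring.
  by rewrite g2; ring.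
have gle x : (g x <= 1 + tau ^+ 2 / 2 * S x ^+ 2)%R.
  have q0 : (0 <= tau ^+ 2 / 2 * S x ^+ 2)%R.
    by rewrite mulr_ge0 ?sqr_ge0// divr_ge0 ?sqr_ge0.
  rewrite -[leRHS]ger0_norm ?addr_ge0// -sqrtr_sqr ler_wsqrtr//.
  rewrite -subr_ge0 [leRHS](_ : _ = (tau ^+ 2 / 2 * S x ^+ 2) ^+ 2)%R.
    exact: sqr_ge0.
  by field.
have mf : measurable_fun setT f by exact: measurable_funD.
have E (P1 : probability T R) s : P1.-integrable setT (fun x => (S x ^+ 2)%:E) ->
    \int[P1]_x (1 + tau ^+ 2 / 2 * S x ^+ 2 + s * S x)%:E =
    (1 + tau ^+ 2 / 2 * \int[P1]_x (S x ^+ 2) + s * \int[P1]_x S x)%:E%R.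
  move=> iS2; have iS1 := integrable_of_sqr mS iS2.
  have i1 : P1.-integrable setT (EFin \o cst 1%R).
    exact: finite_measure_integrable_cst.
  have i2 : P1.-integrable setT (EFin \o (fun x => tau ^+ 2 / 2 * S x ^+ 2)%R).
    by rewrite /comp; under eq_fun do rewrite EFinM; exact: integrableZl.
  have i3 : P1.-integrable setT (EFin \o (fun x => s * S x)%R).
    by rewrite /comp; under eq_fun do rewrite EFinM; exact: integrableZl.
  have i4 : P1.-integrable setT (EFin \o (fun x => 1 + tau ^+ 2 / 2 * S x ^+ 2)%R).
    by rewrite /comp; under eq_fun do rewrite EFinD; exact: integrableD.
  rewrite -[LHS]fineK; last first.
    apply: integrable_fin_num => //.
    by under eq_fun do rewrite EFinD; exact: integrableD.
  congr EFin; rewrite -/(Rintegral _ _ _).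
  rewrite RintegralD// RintegralD// !RintegralZl// Rintegral_cst//=.
  by rewrite probability_setT/= mulr1.
have := aff f mf f0.
have h1 : \int[P]_x (f x)%:E <=
    \int[P]_x (1 + tau ^+ 2 / 2 * S x ^+ 2 + tau * S x)%:E.
  apply: ge0_le_lower_integral => x _; rewrite lee_fin; first exact: ltW.
  by rewrite lerD2r.
have h2 : \int[P']_x ((f x)^-1)%:E <=
    \int[P']_x (1 + tau ^+ 2 / 2 * S x ^+ 2 + (- tau) * S x)%:E.
  apply: ge0_le_lower_integral => x _; rewrite lee_fin.
    by rewrite invr_ge0 ltW.
  by rewrite fV mulNr lerD2r.
move=> /le_trans /(_ (leeD h1 h2)); rewrite !E// -EFinD lee_fin.
set A := (\int[P]_x (S x ^+ 2))%R; set B := (\int[P']_x (S x ^+ 2))%R.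
set m := (\int[P]_x S x)%R; set m' := (\int[P']_x S x)%R => h.
rewrite -subr_ge0 [leRHS](_ : _ = tau^-1 * (1 + tau ^+ 2 / 2 * A + tau * m
    + (1 + tau ^+ 2 / 2 * B + - tau * m') - 2 * a))%R.
  by rewrite mulr_ge0 ?subr_ge0// invr_ge0 ltW.
by field; rewrite gt_eqF.
Qed.

(** Along a chain of laws, the mean of an estimator with risk at most [rho^2]
everywhere grows per step by at most the bound of [affinity_ge_mean_difference]
for [S - c j], whose second moments under [K j] and [K j.+1] are at most
[rho^2] and [(rho + beta)^2].  Its bias is at most [rho] at both ends of the
chain. *)
Lemma risk_telescoping (K : nat -> probability T R) (c : nat -> R) (S : T -> R)
    (N : nat) (a rho beta tau : R) :
  measurable_fun setT S -> (0 < rho)%R -> (0 < tau)%R ->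
  (forall j, (j <= N)%N -> \int[K j]_x ((S x - c j) ^+ 2)%:E <= (rho ^+ 2)%:E) ->
  (forall j, (j < N)%N -> affinity_ge (K j) (K j.+1) a) ->
  (forall j, (j < N)%N -> `|c j.+1 - c j| <= beta)%R ->
  (c N - c 0%N <=
    2 * rho + N%:R * ((2 - 2 * a) / tau + tau * (rho + beta) ^+ 2))%R.
Proof.
move=> mS rho0 tau0 risk aff beta_.
pose m j := (\int[K j]_x S x)%R; pose s j := (\int[K j]_x (S x ^+ 2))%R.
have iS j : (j <= N)%N -> (K j).-integrable setT (fun x => (S x ^+ 2)%:E).
  by move=> /risk h; apply: (integrable_sqr_shift (c := c j)) => //;
    exact: le_lt_trans h (ltry _).
have r j : (j <= N)%N -> (s j - 2 * c j * m j + c j ^+ 2 <= rho ^+ 2)%R.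
  by move=> jN; have := risk j jN; rewrite expectation_sqr_shift ?iS// lee_fin.
have ms j : (j <= N)%N -> (m j ^+ 2 <= s j)%R.
  by move=> jN; apply: sqr_expectation_le => //; exact: iS.
have b j : (j <= N)%N -> (`|m j - c j| <= rho)%R.
  move=> jN; rewrite -(ler_pXn2r (n := 2)) ?nnegrE ?(ltW rho0)//.
  rewrite real_normK ?num_real//; have := r j jN; have := ms j jN; nra.
have step j : (j < N)%N -> (m j.+1 - m j <=
    (2 - 2 * a) / tau + tau * (rho + beta) ^+ 2)%R.
  move=> jN; have jN' := ltnW jN.
  have := affinity_ge_mean_difference (S := fun x => (S x - c j)%R)
    (aff j jN) tau0.
  have mSc : measurable_fun setT (fun x => S x - c j)%R by exact: measurable_funB.
  have iSc k : (k <= N)%N -> (K k).-integrable setT (fun x => ((S x - c j) ^+ 2)%:E).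
    move=> kN; apply: (integrable_sqr_shift (c := - c j)%R) => //.
    under eq_integral do rewrite opprK subrK.
    have /integrableP[_] := iS k kN; apply: le_lt_trans.
    apply: ge0_le_lower_integral => x _; first by rewrite lee_fin sqr_ge0.
    exact: lee_abs.
  move=> /(_ mSc (iSc j jN') (iSc j.+1 jN)).
  have E1 k : (k <= N)%N -> (\int[K k]_x ((S x - c j) ^+ 2))%R =
      (s k - 2 * c j * m k + c j ^+ 2)%R.
    by move=> kN; rewrite /Rintegral expectation_sqr_shift ?iS.
  have E2 k : (k <= N)%N -> (\int[K k]_x (S x - c j))%R = (m k - c j)%R.
    move=> kN; rewrite RintegralB//; last 2 first.
    - exact: integrable_of_sqr (iS k kN).
    - exact: finite_measure_integrable_cst.
    by rewrite Rintegral_cst//= probability_setT/= mulr1.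
  rewrite !E1// !E2// => h.
  have : (m j.+1 - m j <= (2 - 2 * a) / tau + tau / 2 *
    (rho ^+ 2 + (rho ^+ 2 + 2 * (beta * rho) + beta ^+ 2)))%R.
    apply: le_trans (_ : _ <= (2 - 2 * a) / tau + tau / 2 *
      (s j - 2 * c j * m j + c j ^+ 2 +
       (s j.+1 - 2 * c j * m j.+1 + c j ^+ 2)))%R _.
      by apply: le_trans h; lra.
    rewrite lerD2l ler_wpM2l ?divr_ge0 ?(ltW tau0)// lerD ?r//.
    have := r j.+1 jN; have := b j.+1 jN; have := beta_ j jN.
    set D := (c j.+1 - c j)%R; set M := (m j.+1 - c j.+1)%R => hD hM hr.
    have hDM : (D * M <= beta * rho)%R.
      apply: le_trans (ler_norm _) _; rewrite normrM.
      exact: ler_pM.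
    have hD2 : (D ^+ 2 <= beta ^+ 2)%R.
      rewrite -(real_normK (num_real D)) ler_pXn2r// nnegrE.
      exact: le_trans hD.
    rewrite /D /M in hDM hD2 *; lra.
  move=> /le_trans; apply; rewrite lerD2l.
  have hb : (0 <= beta)%R by apply: le_trans (beta_ j jN).
  have : (0 <= tau * (2 * (beta * rho) + beta ^+ 2))%R.
    by rewrite mulr_ge0 ?(ltW tau0)// addr_ge0 ?sqr_ge0// mulr_ge0// mulr_ge0// ltW.
  lra.
have tel k : (k <= N)%N -> (m k - m 0%N <=
    k%:R * ((2 - 2 * a) / tau + tau * (rho + beta) ^+ 2))%R.
  elim: k => [_|k IH kN]; first by rewrite subrr mul0r.
  rewrite mulrSr mulrDl mul1r.
  have := IH (ltnW kN); have := step k kN; lra.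
have := tel N (leqnn N); have := b N (leqnn N); have := b 0%N (leq0n N).
rewrite !ler_norml => /andP[_ h1] /andP[h2 _] h3; lra.
Qed.

End mean_difference.

(** * Real calculus, the two-point constant, and lower limits *)

Section real_calculus.
Context (R : realType).

Lemma is_derive_continuous (f : R -> R) (x df : R) :
  is_derive x 1%R f df -> {for x, continuous f}.
Proof.
by move=> [fx _]; apply: differentiable_continuous; exact/derivable1_diffP.
Qed.

Lemma ger0_is_derive_le (f df : R -> R) (a b : R) : (a <= b)%R ->
  (forall x : R, is_derive x 1%R f (df x)) ->
  (forall x, (a <= x <= b)%R -> (0 <= df x)%R) -> (f a <= f b)%R.
Proof.
move=> ab fdf df0.
have [|c] := MVT_segment ab (fun x _ => fdf x).
- by apply: derivable_within_continuous => x _; have [] := fdf x.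
- by rewrite in_itv/= => /df0 dc; rewrite -subr_ge0 => ->; rewrite mulr_ge0// subr_ge0.
Qed.

Lemma continuous_at0_gt (F : R -> R) (y b : R) : {for 0%R, continuous F} ->
  (y < F 0)%R -> (0 < b)%R -> exists e : R, [/\ 0 < e, e < b & y < F e]%R.
Proof.
move=> cF yF b0.
have /nbhs_ballP[/= dl dl0 H] : \forall e \near (0%R : R), (y < F e)%R.
  exact: (cvgr_gt _ cF).
exists (Num.min dl b / 2)%R.
have m0 : (0 < Num.min dl b)%R by rewrite lt_min dl0.
have h1 : (Num.min dl b / 2 < Num.min dl b)%R by lra.
split; first by rewrite divr_gt0.
  by apply: (lt_le_trans h1); rewrite ge_min lexx orbT.
apply: H; rewrite /ball/= sub0r normrN gtr0_norm ?divr_gt0//.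
by apply: (lt_le_trans h1); rewrite ge_min lexx.
Qed.

Lemma sqrt_eventually_gt (b : R) : exists n0, forall n, (n0 <= n)%N ->
  (0 < n)%N /\ (b < Num.sqrt n%:R)%R.
Proof.
exists (Num.bound (b ^+ 2)).+1 => n hn; split; first exact: leq_trans hn.
have : (b ^+ 2 < n%:R)%R.
  have := archi_boundP (sqr_ge0 b) => /lt_trans; apply.
  by rewrite ltr_nat.
rewrite -(ltr_sqrt (b ^+ 2)).
  by rewrite sqrtr_sqr; apply: le_lt_trans; exact: ler_norm.
by rewrite ltr0n (leq_trans _ hn).
Qed.

End real_calculus.

Section exponential_enclosure.
Context (R : realType).

(** [exp (- y) <= 1 - y] fails, but [exp (- (1 + e) y) <= 1 - y] holds for [y]
small compared with [e]. *)
Lemma expR_le_expr1B (x e : R) n : (0 < n)%N -> (0 <= x)%R -> (0 < e)%R ->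
  (x * (1 + e) / e < n%:R)%R -> (expR (- (x * (1 + e))) <= (1 - x / n%:R) ^+ n)%R.
Proof.
move=> n0 x0 e0 h.
have n0' : (0 < n%:R :> R)%R by rewrite ltr0n.
have e1 : (0 < 1 + e)%R by rewrite addr_gt0.
set y := (x / n%:R)%R.
have xn : (x = y * n%:R)%R by rewrite /y divfK// gt_eqF.
have y0 : (0 <= y)%R by rewrite divr_ge0// ltW.
have ye : (y * (1 + e) < e)%R.
  by rewrite /y mulrAC ltr_pdivrMr// [ltRHS]mulrC -ltr_pdivrMr.
have y1 : (y < 1)%R by nra.
have -> : (- (x * (1 + e)) = - (y * (1 + e)) * n%:R)%R by rewrite [in LHS]xn; ring.
rewrite expRM_natr ler_pXn2r ?nnegrE ?expR_ge0 ?subr_ge0 ?(ltW y1)//; last first.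
have D : (0 < 1 - y)%R by rewrite subr_gt0.
rewrite expRN -[leRHS]invrK lef_pV2 ?posrE ?expR_gt0 ?invr_gt0//.
apply: (le_trans _ (expR_ge1Dx _)).
by rewrite -[leLHS]mul1r ler_pdivrMr//; nra.
Qed.

(** The Taylor polynomial of [exp (- x)] at 0, with [n] terms. *)
Definition expN_taylor (n : nat) : {poly R} :=
  (\poly_(k < n) ((-1) ^+ k / k`!%:R))%R.

Lemma deriv_expN_taylor n :
  ((expN_taylor n.+1)^`() = - expN_taylor n)%R.
Proof.
apply/polyP => k; rewrite coef_deriv coefN !coef_poly ltnS.
case: ifP => kn; last by rewrite mul0rn oppr0.
rewrite factS natrM -mulr_natr exprS; field.
by rewrite pnatr_eq0 -lt0n fact_gt0 nat1r pnatr_eq0.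
Qed.

(** By induction, as the derivative of the [n.+1]-st remainder is minus the
[n]-th remainder: the truncations enclose [exp (- x)]. *)
Lemma expN_taylor_alternating (n : nat) (x : R) : (0 <= x)%R ->
  (0 <= (-1) ^+ n * (expR (- x) - (expN_taylor n).[x]))%R.
Proof.
elim: n x => [|n IH] x x0.
  by rewrite /expN_taylor poly_def big_ord0 horner0 subr0 expr0 mul1r expR_ge0.
pose f (y : R) := ((-1) ^+ n.+1 * (expR (- y) - (expN_taylor n.+1).[y]))%R.
pose df (y : R) := ((-1) ^+ n * (expR (- y) - (expN_taylor n).[y]))%R.
have fdf (y : R) : is_derive y 1%R f (df y).
  rewrite /f; apply: is_derive_eq.
  rewrite deriv_expN_taylor hornerN /df exprS /GRing.scale/=; ring.
have f0 : f 0%R = 0%R.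
  rewrite /f oppr0 expR0 /expN_taylor horner_poly big_ord_recl big1 => [|i _].
    by rewrite fact0 !expr0 divr1 mulr1 addr0 subrr mulr0.
  by rewrite expr0n/= mulr0.
rewrite -f0; apply: (ger0_is_derive_le (df := df)) => // y /andP[y0 _].
exact: IH.
Qed.

(** With [z = eps^2 / 8] the two-point constant is the maximum of
[4 z exp (- z) - 2 z], attained close to [z = 0.315]. *)
Lemma expRN315_bounds :
  (7297 / 10 ^+ 4 + 87 / 10 ^+ 6 <= expR (- (315 / 1000) : R) <= 7297 / 10 ^+ 4 + 89 / 10 ^+ 6)%R.
Proof.
have x0 : (0 <= 315 / 1000 :> R)%R by lra.
have := expN_taylor_alternating 6 x0; have := expN_taylor_alternating 7 x0.
rewrite /expN_taylor !horner_poly !big_ord_recr !big_ord0/=.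
rewrite (_ : 6`! = 720%N)// (_ : 5`! = 120%N)// (_ : 4`! = 24%N)//.
rewrite (_ : 3`! = 6%N)// (_ : 2`! = 2%N)// fact0 (_ : 1`! = 1%N)// => h7 h6; apply/andP; split; lra.
Qed.

(** From [exp (z - z1) >= 1 + (z - z1)], with [z1 = 0.315], the exponential
is at most [exp (- z1) / (1 + z - z1)]; what remains is a quadratic inequality
in [z]. *)
Lemma two_point_function_le (z : R) : (0 <= z)%R ->
  (4 * z * expR (- z) - 2 * z <= (289 + 535 / 1000) / 1000)%R.
Proof.
move=> z0; have /andP[_ E] := expRN315_bounds.
pose z1 : R := (315 / 1000)%R.
have e1 : (1 + (z - z1) <= expR (z - z1))%R by exact: expR_ge1Dx.
have D0 : (0 < 1 + (z - z1))%R by rewrite /z1; lra.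
have ez : (expR (- z) * (1 + (z - z1)) <= expR (- z1))%R.
  rewrite [leRHS](_ : _ = expR (- z) * expR (z - z1))%R; last first.
    by rewrite -expRD; congr expR; ring.
  by apply: ler_wpM2l => //; exact: expR_ge0.
rewrite -/z1 in E.
have ez' : (expR (- z) * (1 + (z - z1)) <= 7297 / 10 ^+ 4 + 89 / 10 ^+ 6)%R by lra.
have h4 : (4 * z * (expR (- z) * (1 + (z - z1))) <= 4 * z * (7297 / 10 ^+ 4 + 89 / 10 ^+ 6))%R.
  by rewrite ler_wpM2l// mulr_ge0.
(* 0.314906 is close to the minimiser of the quadratic polynomial. *)
have sq := sqr_ge0 (z - (3149 / 10 ^+ 4 + 6 / 10 ^+ 6)).
have sz := sqr_ge0 z.
rewrite -(ler_pM2r D0) mulrBl -(mulrA (4 * z)%R); apply: le_trans (lerB h4 (lexx _)) _.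
rewrite /z1; lra.
Qed.

Lemma two_point_set_bound : ubound [set eps ^+ 2 * (2^-1 * expR (- (eps ^+ 2 / 8)) - 4^-1)
  | eps in [set eps : R | 0 <= eps]]%R ((289 + 535 / 1000) / 1000)%R.
Proof.
move=> _ [eps _ <-].
have z0 : (0 <= eps ^+ 2 / 8)%R by rewrite divr_ge0// sqr_ge0.
by have := two_point_function_le z0; lra.
Qed.

Lemma two_point_constant_has_sup :
  has_sup [set eps ^+ 2 * (2^-1 * expR (- (eps ^+ 2 / 8)) - 4^-1)
    | eps in [set eps : R | 0 <= eps]]%R.
Proof.
split; first by exists (0 ^+ 2 * (2^-1 * expR (- (0 ^+ 2 / 8)) - 4^-1))%R; exists 0%R => /=.
by exists ((289 + 535 / 1000) / 1000)%R; exact: two_point_set_bound.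
Qed.

Lemma two_point_constant_approx :
  (`|two_point_constant R - (289 + 53 / 100) / 1000| <= 5 / 10 ^+ 6)%R.
Proof.
have [ne bd] := two_point_constant_has_sup.
have up : (two_point_constant R <= (289 + 535 / 1000) / 1000)%R.
  exact: (ge_sup ne two_point_set_bound).
have lo : ((289 + 525 / 1000) / 1000 <= two_point_constant R)%R.
  apply: (@le_trans _ _ (252 / 100 * (2^-1 * expR (- (252 / 100 / 8)) - 4^-1))%R).
    have /andP[E _] := expRN315_bounds.
    by rewrite (_ : 252 / 100 / 8 = 315 / 1000)%R; lra.
  apply: ub_le_sup => //; exists (Num.sqrt (252 / 100)%R) => /=.
    exact: sqrtr_ge0.
  by rewrite sqr_sqrtr; lra.
by rewrite ler_norml; apply/andP; split; lra.
Qed.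

End exponential_enclosure.

Section lower_limits.
Context (R : realType).

Lemma limf_einf_ge (T : choiceType) (X : filteredType T) (f : X -> \bar R)
    (F : set_system X) (y : \bar R) :
  F [set x | y <= f x] -> y <= limf_einf f F.
Proof.
move=> Fy; rewrite limf_einfE; apply: le_ereal_sup_tmp.
exists (ereal_inf (f @` [set x | y <= f x])).
  by exists [set x | y <= f x].
by apply: le_ereal_inf_tmp => _ [x /= yx <-].
Qed.

(** The iterated lower limit of [n * L c n], first in [n] and then in [c], is at
least [v]. *)
Definition eventually_above (L : R -> nat -> \bar R) (v : R) :=
  forall y : R, (y < v)%R -> exists c0 : R, forall c, (c0 < c)%R ->
    exists n0, forall n, (n0 <= n)%N -> y%:E <= n%:R%:E * L c n.

(** Values [y < 0] follow from nonnegativity, so square roots of [y] may be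
taken. *)
Lemma eventually_above_ge0 (L : R -> nat -> \bar R) (V : R) : (0 <= V)%R ->
  (forall c : R, (0 < c)%R -> exists n0, forall n, (n0 <= n)%N -> 0 <= L c n) ->
  (forall y : R, (0 <= y)%R -> (y < V)%R -> exists c0 : R, forall c, (c0 < c)%R ->
    exists n0, forall n, (n0 <= n)%N -> y%:E <= n%:R%:E * L c n) ->
  eventually_above L V.
Proof.
move=> V0 L0 H y yV; have [y0|y0] := ltP y 0%R; last exact: H.
exists 0%R => c /L0[n0 Hn]; exists n0 => n nn0.
apply: (@le_trans _ _ 0); first by rewrite lee_fin ltW.
by rewrite mule_ge0// ?Hn// lee_fin.
Qed.

Lemma local_limit_ge d (X : measurableType d)
    (nu : {sigma_finite_measure set X -> \bar R}) (P0 : model nu)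
    (P : (X -> R) -> R -> model nu) (L : (R -> model nu) -> R -> nat -> \bar R)
    (g : X -> R) (v : R) : L20 P0 g -> eventually_above (L (P g)) v ->
  v%:E <= local_limit P0 P L.
Proof.
move=> g0 H; apply/lee_subgt0Pr => e e0; rewrite -EFinB.
have [c0 Hc] := H (v - e)%R ltac:(by rewrite ltrBlDr ltrDl).
apply: ereal_sup_ge; eexists; first by exists g.
apply: limf_einf_ge; exists c0; split; first exact: num_real.
move=> c /Hc[n0 Hn] /=; apply: limf_einf_ge.
by exists n0.
Qed.

End lower_limits.

(** * Local expansion of a path *)

Section quadratic_mean.
Context d (X : measurableType d) (R : realType).
Variable nu : {sigma_finite_measure set X -> \bar R}.
Implicit Types (P : R -> model nu) (M : model nu).

Lemma model_dominated M : M `<< nu.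
Proof.
have [p [mp p0 pE]] := has_density M.
apply/null_content_dominatesP => A mA nuA0; rewrite pE//.
by apply: null_set_integral => //; exact: measurable_funTS.
Qed.

Lemma measurable_root_density M : measurable_fun setT (root_density M).
Proof. exact: measurable_sqrt_density (model_dominated M). Qed.

Lemma integral_sqr_root_density M (g : X -> R) : measurable_fun setT g ->
  \int[nu]_x ((g x * root_density M x) ^+ 2)%:E = \int[M]_x (g x ^+ 2)%:E.
Proof.
move=> mg; rewrite (ge0_integral_density (model_dominated M)).
- by apply: eq_integral => x _; rewrite exprMn EFinM.
- by apply/measurable_EFinP; exact: measurable_funX.
- by move=> x; rewrite lee_fin sqr_ge0.
Qed.

Lemma ge0_integral_sqr_le (mu : {measure set X -> \bar R}) (f g h : X -> R)
    (a b : R) :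
  measurable_fun setT g -> measurable_fun setT h -> (0 <= a)%R -> (0 <= b)%R ->
  (forall x, f x ^+ 2 <= a * g x ^+ 2 + b * h x ^+ 2)%R ->
  \int[mu]_x (f x ^+ 2)%:E <=
    a%:E * \int[mu]_x (g x ^+ 2)%:E + b%:E * \int[mu]_x (h x ^+ 2)%:E.
Proof.
move=> mg mh a0 b0 fgh.
have m2 (k : X -> R) : measurable_fun setT k ->
    measurable_fun setT (fun x => (k x ^+ 2)%:E).
  by move=> mk; apply/measurable_EFinP; exact: measurable_funX.
have p2 (k : X -> R) x : setT x -> 0 <= (k x ^+ 2)%:E.
  by rewrite lee_fin sqr_ge0.
rewrite -!ge0_integralZl// ?lee_fin//; [|exact: m2|exact: p2|exact: m2|exact: p2].
rewrite -ge0_integralD//.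
- apply: ge0_le_lower_integral => x _; first by rewrite lee_fin sqr_ge0.
  by rewrite -!EFinM -EFinD lee_fin.
- by move=> x _; rewrite mule_ge0 ?lee_fin// sqr_ge0.
- by apply: measurable_funeM; exact: m2.
- by move=> x _; rewrite mule_ge0 ?lee_fin// sqr_ge0.
- by apply: measurable_funeM; exact: m2.
Qed.

Lemma root_expansion0P P (xi : X -> R) (e : R) :
  root_expansion P 0%R xi -> (0 < e)%R ->
  exists2 dl : R, (0 < dl)%R & forall h : R, (`|h| < dl)%R ->
    \int[nu]_x ((root_density (P h) x - root_density (P 0%R) x - h * xi x) ^+ 2)%:E
      <= (e * h ^+ 2)%:E.
Proof.
move=> /fine_cvgP[/nbhs_ballP[/= d1 d10 fin] /cvgr0Pnorm_lt small] e0.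
have /nbhs_ballP[/= d2 d20 {}small] := small e e0.
exists (Num.min d1 d2); first by rewrite lt_min d10.
move=> h; rewrite lt_min => /andP[hd1 hd2].
have [->|h0] := eqVneq h 0%R.
  rewrite expr0n/= mulr0 (_ : \int[nu]_x _ = 0)//.
  by apply: integral0_eq => x _; rewrite mul0r subr0 subrr expr0n.
have {fin}fin := fin h; have {small}small := small h.
move: fin small; rewrite /ball/= sub0r normrN add0r => fin small.
have {}fin := fin hd1 h0; have {}small := small hd2 h0.
set I := \int[nu]_x _ in fin small *.
have I0 : 0 <= I by apply: integral_ge0 => x _; rewrite lee_fin sqr_ge0.
have h2 : (0 < h ^- 2)%R by rewrite invr_gt0 exprn_even_gt0.
move: fin small I0; case: I => [r| |].
- move=> _ /= + _; rewrite !lee_fin => rlt.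
  have := le_lt_trans (ler_norm _) rlt.
  by rewrite mulrC ltr_pdivrMr ?exprn_even_gt0// => /ltW.
- by rewrite mulry gtr0_sg// mul1e.
- by rewrite mulrNy gtr0_sg// mul1e.
Qed.

(** Expand both root densities around 0: their difference is [(t - t') G] up to
remainders of squared norm [o(t^2)] and [o(t'^2)], and the cross terms are absorbed by
[2 a b <= eta a^2 + b^2 / eta]. *)
Lemma root_expansion_pair P (G : X -> R) (V e : R) :
  measurable_fun setT G -> root_expansion P 0%R G ->
  \int[nu]_x (G x ^+ 2)%:E = (V / 4)%:E -> (0 < e)%R ->
  exists2 dl : R, (0 < dl)%R & forall t t' : R, (`|t| < dl)%R -> (`|t'| < dl)%R ->
    \int[nu]_x ((root_density (P t) x - root_density (P t') x) ^+ 2)%:E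
      <= ((t - t') ^+ 2 * (V / 4) + e * (t ^+ 2 + t' ^+ 2))%:E.
Proof.
move=> mG exG GV e0.
have V0 : (0 <= V)%R.
  have : 0 <= \int[nu]_x (G x ^+ 2)%:E.
    by apply: integral_ge0 => x _; rewrite lee_fin sqr_ge0.
  by rewrite GV lee_fin pmulr_lge0// invr_gt0.
(* eta bounds the loss on (t - t') G, and e' is small enough for the
   remainders even after division by eta. *)
pose eta := (e / (V + 1))%R.
have eta0 : (0 < eta)%R by rewrite divr_gt0// ltr_wpDl.
have etaV : (eta * V <= e)%R.
  by rewrite /eta mulrAC ler_pdivrMr ?ltr_wpDl// ler_pM2l// lerDl.
pose e' := (e / (4 * (1 + eta^-1)))%R.
have D0 : (0 < 4 * (1 + eta^-1))%R by rewrite mulr_gt0// addr_gt0// invr_gt0.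
have e'0 : (0 < e')%R by rewrite divr_gt0.
have [dl dl0 H] := root_expansion0P exG e'0.
exists dl => // t t' td t'd.
pose r s x := (root_density (P s) x - root_density (P 0%R) x - s * G x)%R.
have mr s : measurable_fun setT (r s).
  apply: measurable_funB; last exact: measurable_funM.
  by apply: measurable_funB; exact: measurable_root_density.
have h1 : \int[nu]_x ((root_density (P t) x - root_density (P t') x) ^+ 2)%:E <=
    ((1 + eta) * (t - t') ^+ 2)%:E * \int[nu]_x (G x ^+ 2)%:E
    + (1 + eta^-1)%:E * \int[nu]_x ((r t x - r t' x) ^+ 2)%:E.
  apply: ge0_integral_sqr_le => //.
  - exact: measurable_funB.
  - by rewrite mulr_ge0 ?sqr_ge0// addr_ge0// ltW.
  - by rewrite addr_ge0// invr_ge0 ltW.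
  move=> x.
  rewrite (_ : root_density (P t) x - root_density (P t') x =
     (t - t') * G x + (r t x - r t' x))%R; last by rewrite /r; ring.
  set a := ((t - t') * G x)%R; set b := (r t x - r t' x)%R.
  rewrite -mulrA -exprMn -/a -subr_ge0.
  rewrite [leRHS](_ : _ = eta^-1 * (eta * a - b) ^+ 2)%R.
    by rewrite mulr_ge0 ?sqr_ge0// invr_ge0 ltW.
  by field; rewrite gt_eqF.
have h2 : \int[nu]_x ((r t x - r t' x) ^+ 2)%:E <=
    2%:E * \int[nu]_x (r t x ^+ 2)%:E + 2%:E * \int[nu]_x (r t' x ^+ 2)%:E.
  apply: ge0_integral_sqr_le => // x; rewrite -subr_ge0.
  by rewrite [leRHS](_ : _ = (r t x + r t' x) ^+ 2)%R ?sqr_ge0//; ring.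
have h3 : \int[nu]_x ((r t x - r t' x) ^+ 2)%:E <=
    (2 * (e' * t ^+ 2) + 2 * (e' * t' ^+ 2))%:E.
  apply: (le_trans h2); rewrite [leRHS]EFinD; apply: leeD.
    by rewrite [leRHS]EFinM; apply: lee_wpmul2l => //; exact: H.
  by rewrite [leRHS]EFinM; apply: lee_wpmul2l => //; exact: H.
apply: (le_trans h1).
apply: (@le_trans _ _ (((1 + eta) * (t - t') ^+ 2) * (V / 4)
   + (1 + eta^-1) * (2 * (e' * t ^+ 2) + 2 * (e' * t' ^+ 2)))%:E).
  rewrite GV [leRHS]EFinD -EFinM leeD2l// [leRHS]EFinM; apply: lee_wpmul2l => //.
  by rewrite lee_fin addr_ge0// invr_ge0 ltW.
rewrite lee_fin.
have -> : ((1 + eta^-1) * (2 * (e' * t ^+ 2) + 2 * (e' * t' ^+ 2)) =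
    e / 2 * (t ^+ 2 + t' ^+ 2))%R.
  rewrite /e'; field; rewrite gt_eqF//= gt_eqF//.
  by rewrite addr_gt0.
have : (eta * V * (t - t') ^+ 2 <= e * (t - t') ^+ 2)%R.
  by rewrite ler_wpM2r ?sqr_ge0.
have : (e * (t - t') ^+ 2 <= e * (2 * (t ^+ 2 + t' ^+ 2)))%R.
  by rewrite ler_pM2l//; have := sqr_ge0 (t + t'); lra.
lra.
Qed.

(** A derivative at 0 is unique up to a null set.  Here [G] is the one given by the score,
and [xi] is the one chosen in the definition of the Fisher information. *)
Lemma root_expansion_norm_le P (G xi : X -> R) (V : R) :
  measurable_fun setT G -> measurable_fun setT xi ->
  root_expansion P 0%R G -> root_expansion P 0%R xi ->
  \int[nu]_x (G x ^+ 2)%:E = V%:E ->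
  \int[nu]_x (xi x ^+ 2)%:E <= V%:E.
Proof.
move=> mG mxi exG exxi GV.
have d0 : \int[nu]_x ((xi x - G x) ^+ 2)%:E = 0.
  apply/eqP; rewrite eq_le; apply/andP; split; last first.
    by apply: integral_ge0 => x _; rewrite lee_fin sqr_ge0.
  apply/lee_addgt0Pr => e e0; rewrite add0e.
  have e40 : (0 < e / 4)%R by rewrite divr_gt0.
  have [d1 d10 H1] := root_expansion0P exG e40.
  have [d2 d20 H2] := root_expansion0P exxi e40.
  pose h := (Num.min d1 d2 / 2)%R.
  have m0 : (0 < Num.min d1 d2)%R by rewrite lt_min d10.
  have h0 : (0 < h)%R by rewrite divr_gt0.
  have hm : (`|h| < Num.min d1 d2)%R by rewrite gtr0_norm// /h; lra.
  have hd1 : (`|h| < d1)%R by move: hm; rewrite lt_min => /andP[].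
  have hd2 : (`|h| < d2)%R by move: hm; rewrite lt_min => /andP[].
  pose r (f : X -> R) x := (root_density (P h) x - root_density (P 0%R) x - h * f x)%R.
  have mr f : measurable_fun setT f -> measurable_fun setT (r f).
    move=> mf; apply: measurable_funB; last exact: measurable_funM.
    by apply: measurable_funB; exact: measurable_root_density.
  have hc0 : (0 <= 2 * h ^- 2)%R by rewrite mulr_ge0// invr_ge0 sqr_ge0.
  apply: (@le_trans _ _ ((2 * h ^- 2)%:E * \int[nu]_x (r G x ^+ 2)%:E
      + (2 * h ^- 2)%:E * \int[nu]_x (r xi x ^+ 2)%:E)).
    apply: ge0_integral_sqr_le => //; [exact: mr|exact: mr|].
    move=> x; rewrite -mulrDr -subr_ge0.
    rewrite [leRHS](_ : _ = h ^- 2 * (r G x + r xi x) ^+ 2)%R.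
      by rewrite mulr_ge0 ?sqr_ge0// invr_ge0 sqr_ge0.
    by rewrite /r; field; rewrite gt_eqF.
  apply: (@le_trans _ _ ((2 * h ^- 2)%:E * (e / 4 * h ^+ 2)%:E
      + (2 * h ^- 2)%:E * (e / 4 * h ^+ 2)%:E)).
    by apply: leeD; apply: lee_wpmul2l => //; [exact: H1|exact: H2].
  rewrite -!EFinM -EFinD lee_fin le_eqVlt; apply/orP; left; apply/eqP.
  by field; rewrite gt_eqF.
apply/lee_addgt0Pr => e e0.
have V0 : (0 <= V)%R.
  have : 0 <= \int[nu]_x (G x ^+ 2)%:E.
    by apply: integral_ge0 => x _; rewrite lee_fin sqr_ge0.
  by rewrite GV lee_fin.
pose eta := (e / (V + 1))%R.
have eta0 : (0 < eta)%R by rewrite divr_gt0// ltr_wpDl.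
have etaV : (eta * V <= e)%R.
  by rewrite /eta mulrAC ler_pdivrMr ?ltr_wpDl// ler_pM2l// lerDl.
apply: (@le_trans _ _ ((1 + eta)%:E * \int[nu]_x (G x ^+ 2)%:E
    + (1 + eta^-1)%:E * \int[nu]_x ((xi x - G x) ^+ 2)%:E)).
  apply: ge0_integral_sqr_le => //.
  - exact: measurable_funB.
  - by rewrite addr_ge0// ltW.
  - by rewrite addr_ge0// invr_ge0 ltW.
  move=> x; rewrite -subr_ge0.
  rewrite [leRHS](_ : _ = eta^-1 * (eta * G x - (xi x - G x)) ^+ 2)%R.
    by rewrite mulr_ge0 ?sqr_ge0// invr_ge0 ltW.
  by field; rewrite gt_eqF.
by rewrite d0 mule0 adde0 GV -EFinM -EFinD lee_fin; lra.
Qed.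

End quadratic_mean.

Section local_expansion.
Context d (X : measurableType d) (R : realType).
Variables (nu : {sigma_finite_measure set X -> \bar R}) (psi : model nu -> R).
Implicit Types (P : R -> model nu).

(** The functional has slope [V] at 0, and the affinities are to second order those of
a Gaussian shift with information [V]. *)
Definition locally_gaussian P (V : R) := forall e : R, (0 < e)%R ->
  exists2 dl : R, (0 < dl)%R & forall t : R, (`|t| < dl)%R ->
    (`|psi (P t) - psi (P 0%R) - t * V| <= e * `|t|)%R /\
    forall t' : R, (`|t'| < dl)%R -> affinity_ge (P t) (P t')
      (1 - ((t - t') ^+ 2 * (V / 4) + e * (t ^+ 2 + t' ^+ 2)) / 2)%R.

Lemma integral_sqr_Lfun2 (mu : {measure set X -> \bar R}) (f : X -> R) :
  f \in Lfun mu 2%:E -> exists2 V : R, (0 <= V)%R &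
    \int[mu]_x (f x ^+ 2)%:E = V%:E.
Proof.
move=> /Lfun2_integrable_sqr/integrable_fin_num.
move=> /(_ measurableT) fin.
exists (fine (\int[mu]_x (f x ^+ 2)%:E)); last by rewrite fineK.
by apply: fine_ge0; apply: integral_ge0 => x _; rewrite lee_fin sqr_ge0.
Qed.

(** The root density has derivative [g/2 * dP0^(1/2)], hence a squared norm equal to a
quarter of the Fisher information. *)
Lemma score_integral (P0 : model nu) P (g : X -> R) (V : R) : P 0%R ≡μ P0 ->
  measurable_fun setT g -> \int[P0]_x (g x ^+ 2)%:E = V%:E ->
  \int[nu]_x ((2^-1 * g x * root_density (P 0%R) x) ^+ 2)%:E = (V / 4)%:E%R.
Proof.
move=> P00 mg gV.
rewrite (integral_sqr_root_density (P 0%R) (g := fun x => 2^-1 * g x)%R); last first.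
  exact: measurable_funM.
rewrite (eq_measure_integral P0); last by move=> A mA _; exact: P00.
rewrite (_ : (fun x => _) = (fun x => (4^-1)%:E * (g x ^+ 2)%:E)); last first.
  by apply/funext => x; rewrite -EFinM; congr EFin; rewrite exprMn; congr (_ * _)%R; lra.
rewrite ge0_integralZl//.
- by rewrite gV -EFinM mulrC.
- by apply/measurable_EFinP; exact: measurable_funX.
- by move=> x _; rewrite lee_fin sqr_ge0.
Qed.

(** The slope of [psi] is the inner product of the gradient with the score [eif],
which is [\int eif^2 dP0] because the gradient minus [eif] is orthogonal to
[eif]. *)
Lemma efficient_path_locally_gaussian (P0 : model nu) P (eif : X -> R) (V : R) :
  (forall M M' : model nu, M ≡μ M' -> psi M = psi M') ->
  efficient_influence_function P0 psi eif ->
  P 0%R ≡μ P0 -> qmd P eif -> \int[P0]_x (eif x ^+ 2)%:E = V%:E ->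
  locally_gaussian P V.
Proof.
move=> psi_ext [dpsi [dpsiL grad] [eif0 proj]] P00 qmdP eifV e e0.
have [eifL _] := eif0.
have meif : measurable_fun setT eif by have := sub_Lfun_mfun eifL; rewrite inE.
have mG : measurable_fun setT (fun x => 2^-1 * eif x * root_density (P 0%R) x)%R.
  apply: measurable_funM; first exact: measurable_funM.
  exact: measurable_root_density.
have [d1 d10 H1] := root_expansion_pair mG qmdP (score_integral P00 meif eifV) e0.
have psi0 : psi (P 0%R) = psi P0 by exact: psi_ext.
have VE : (\int[P0]_x (dpsi x * eif x))%R = V.
  have i1 : P0.-integrable setT (EFin \o (fun x => dpsi x * eif x)%R).
    by apply/Lfun1_integrable; exact: Lfun2_mul_Lfun1.
  have i2 : P0.-integrable setT (EFin \o (fun x => eif x * eif x)%R).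
    by apply/Lfun1_integrable; exact: Lfun2_mul_Lfun1.
  have := proj eif eif0; under eq_Rintegral do rewrite mulrBl.
  rewrite RintegralB// => /eqP; rewrite subr_eq0 => /eqP ->.
  by rewrite /Rintegral; under eq_integral do rewrite -expr2; rewrite eifV.
have := grad eif P eif0 P00 qmdP; rewrite VE => /cvgr0Pnorm_lt /(_ e e0).
move=> /nbhs_ballP[/= d2 d20 H2].
exists (Num.min d1 d2); first by rewrite lt_min d10.
move=> t; rewrite lt_min => /andP[td1 td2]; split; last first.
  move=> t'; rewrite lt_min => /andP[t'd1 _].
  apply: (affinity_ge_root_density (mu := nu)); [exact: model_dominated|exact: model_dominated|].
  exact: H1.
have [->|t0] := eqVneq t 0%R.
  by rewrite mul0r subrr subr0 normr0 mulr0.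
have := H2 t; rewrite /ball/= sub0r normrN => /(_ td2 t0).
rewrite normrM normr_id normfV normr_id.
by rewrite ltr_pdivrMr ?normr_gt0// psi0 => /ltW.
Qed.

(** Bernoulli's inequality for [(1 - x / (2 n))^n]; past [x = 2] the claimed
bound is negative. *)
Lemma affinity_ge_iid_bernoulli (M M' : model nu) (x : R) n : (0 < n)%N ->
  (0 <= x)%R -> affinity_ge M M' (1 - x / n%:R / 2) ->
  affinity_ge (iid M n) (iid M' n) (1 - x / 2).
Proof.
move=> n0 x0 aff; have [x2|x2] := leP x 2%R; last first.
  apply: (@affinity_geW _ _ _ _ _ 0%R); last exact: affinity_ge0.
  by lra.
have n0' : (0 < n%:R :> R)%R by rewrite ltr0n.
have n1 : (1 <= n%:R :> R)%R by rewrite ler1n.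
have y0 : (0 <= x / n%:R / 2)%R by rewrite divr_ge0// divr_ge0// ltW.
have y1 : (x / n%:R / 2 <= 1)%R.
  by rewrite ler_pdivrMr// mul1r ler_pdivrMr//; nra.
apply: (@affinity_geW _ _ _ _ _ ((1 - x / n%:R / 2) ^+ n)%R); last first.
  by apply: affinity_ge_iid => //; rewrite subr_ge0.
have bern (y : R) m : (0 <= y <= 1)%R -> (1 - m%:R * y <= (1 - y) ^+ m)%R.
  move=> /andP[h0 h1]; elim: m => [|m IH]; first by rewrite mul0r subr0 expr0.
  rewrite exprS -natr1.
  have : ((1 - y) * (1 - m%:R * y) <= (1 - y) * (1 - y) ^+ m)%R.
    by rewrite ler_wpM2l// subr_ge0.
  have : (0 <= m%:R * (y * y))%R by rewrite mulr_ge0// mulr_ge0.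
  lra.
apply: le_trans (bern _ n _); last by rewrite y0.
by rewrite le_eqVlt; apply/orP; left; apply/eqP; field; rewrite gt_eqF.
Qed.

(** [locally_gaussian] in the local scale [t = s / sqrt n], with errors uniform
on bounded sets of [s]. *)
Lemma rescaled_expansion P (V L e : R) : locally_gaussian P V ->
  (0 <= V)%R -> (0 < L)%R -> (0 < e)%R ->
  exists n0, forall n, (n0 <= n)%N -> (0 < n)%N /\ forall s s' : R,
    (`|s| <= L)%R -> (`|s'| <= L)%R ->
    (`|Num.sqrt n%:R * (psi (P (s / Num.sqrt n%:R)) - psi (P 0)) - s * V| <= e)%R
    /\ affinity_ge (P (s / Num.sqrt n%:R)%R) (P (s' / Num.sqrt n%:R)%R)
        (1 - ((s - s') ^+ 2 * (V / 4) + e) / n%:R / 2).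
Proof.
move=> H V0 L0 e0.
pose e1 := (Num.min (e / L) (e / (2 * L ^+ 2)))%R.
have L2 : (0 < 2 * L ^+ 2)%R by rewrite mulr_gt0// exprn_gt0.
have e10 : (0 < e1)%R by rewrite lt_min !divr_gt0.
have [dl dl0 {}H] := H e1 e10.
have [n0 Hn] := sqrt_eventually_gt (L / dl).
exists n0 => n /Hn[n1 hn]; split=> // s s' sL s'L.
set r := Num.sqrt _ in hn *.
have r0 : (0 < r)%R by rewrite sqrtr_gt0 ltr0n.
have r2 : (r ^+ 2 = n%:R)%R by rewrite sqr_sqrtr.
have small (u : R) : (`|u| <= L)%R -> (`|u / r| < dl)%R.
  move=> uL; rewrite normrM normfV (gtr0_norm r0) ltr_pdivrMr//.
  by apply: (le_lt_trans uL); rewrite mulrC -ltr_pdivrMr.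
have [h1 /(_ _ (small _ s'L)) h2] := H _ (small _ sL); split.
  rewrite (_ : r * _ - _ = r * (psi (P (s / r)) - psi (P 0) - s / r * V))%R; last first.
    by field; rewrite gt_eqF.
  rewrite normrM (gtr0_norm r0).
  apply: (@le_trans _ _ (r * (e1 * `|s / r|))%R); first by rewrite ler_pM2l.
  rewrite normrM normfV (gtr0_norm r0) [leLHS](_ : _ = e1 * `|s|)%R; last first.
    by field; rewrite gt_eqF.
  apply: (@le_trans _ _ (e1 * L)%R); first by rewrite ler_pM2l.
  by rewrite -ler_pdivlMr// ge_min lexx.
apply: affinity_geW h2.
rewrite lerD2l lerN2 ler_pM2r// -r2.
rewrite [leLHS](_ : _ = ((s - s') ^+ 2 * (V / 4) + e1 * (s ^+ 2 + s' ^+ 2)) / r ^+ 2)%R; last first.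
  by field; rewrite gt_eqF.
rewrite ler_pM2r ?invr_gt0 ?exprn_gt0// lerD2l.
apply: (@le_trans _ _ (e1 * (2 * L ^+ 2))%R).
  rewrite ler_pM2l// mulr_natl mulr2n lerD//.
    by rewrite -(real_normK (num_real s)) ler_pXn2r ?nnegrE// ltW.
  by rewrite -(real_normK (num_real s')) ler_pXn2r ?nnegrE// ltW.
by rewrite -ler_pdivlMr// ge_min lexx orbT.
Qed.

Lemma Theta_div (c s : R) n : (0 < n)%N -> (`|s| < c)%R ->
  Theta c n (s / Num.sqrt n%:R)%R.
Proof.
move=> n0 sc; rewrite /Theta/= in_itv/= /theta_radius.
have r0 : (0 < (Num.sqrt n%:R : R)^-1)%R by rewrite invr_gt0 sqrtr_gt0 ltr0n.
by rewrite -mulNr !ltr_pM2r// -ltr_norml.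
Qed.

End local_expansion.

(** * The two-point bound and the minimax risk *)

Section two_point_and_minimax.
Context d (X : measurableType d) (R : realType).
Variables (nu : {sigma_finite_measure set X -> \bar R}) (psi : model nu -> R).
Implicit Types (P : R -> model nu).

(** Evaluate the bound at [t1 = s / sqrt n] and [t2 = 0], where [s = eps / sqrt V] for a
nearly optimal [eps]: the affinity of the products is about [exp (- eps^2 / 8)]
and [n] times the squared difference of the functionals is about
[V eps^2]. *)
Lemma bound4_eventually_above P (V : R) : (0 <= V)%R -> locally_gaussian psi P V ->
  eventually_above (bound4 psi P) (two_point_constant R * V).
Proof.
move=> V0 HP.
have C0 : (0 <= two_point_constant R)%R.
  have := @two_point_constant_approx R; rewrite ler_norml => /andP[+ _]; lra.
apply: eventually_above_ge0.
- by rewrite mulr_ge0.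
- move=> c c0; exists 1%N => n n0.
  apply: ereal_sup_ge.
  exists (maxe 0 ((1 - hellinger2 (iid (P 0%R) n) (iid (P 0%R) n)) / 4%:E)
          * (`|psi (P 0%R) - psi (P 0%R)| ^+ 2)%:E).
    have T0 : Theta c n 0%R by have := Theta_div n0 (_ : `|0| < c)%R; rewrite mul0r normr0; apply.
    by exists 0%R, 0%R.
  by rewrite mule_ge0// ?le_max ?lexx// lee_fin sqr_ge0.
move=> y y0 yCV.
have {}V0 : (0 < V)%R.
  rewrite lt_neqAle V0 andbT; apply: contraTneq yCV => <-.
  by rewrite mulr0 -leNgt.
have yV : (y / V < two_point_constant R)%R by rewrite ltr_pdivrMr.
have [_ [eps eps0 <-] yeps] := sup_gt (proj1 (two_point_constant_has_sup R)) yV.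
rewrite /= in eps0.
have {}eps0 : (0 < eps)%R.
  rewrite lt_neqAle eps0 andbT; apply: contraTneq yeps => <-.
  by rewrite expr0n/= mul0r -leNgt divr_ge0// ltW.
pose s := (eps / Num.sqrt V)%R.
have sV0 : (0 < Num.sqrt V)%R by rewrite sqrtr_gt0.
have sV2 : (Num.sqrt V ^+ 2 = V)%R by rewrite sqr_sqrtr// ltW.
have s0 : (0 < s)%R by rewrite divr_gt0.
have s2 : (s ^+ 2 * V = eps ^+ 2)%R.
  by rewrite /s expr_div_n sV2 divfK// gt_eqF.
(* A lower bound for n times the two-point bound when the expansion has
   error e. *)
pose F (e : R) := ((2^-1 * expR (- ((s ^+ 2 * (V / 4) + e) / 2 * (1 + e))) - 4^-1)
   * (s * V - e) ^+ 2)%R.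
have cF : {for 0%R, continuous F} by apply: is_derive_continuous.
have F0 : (y < F 0)%R.
  rewrite /F subr0 !addr0 mulr1.
  rewrite (_ : (s * V) ^+ 2 = V * eps ^+ 2)%R; last by rewrite -s2; ring.
  rewrite (_ : s ^+ 2 * (V / 4) / 2 = eps ^+ 2 / 8)%R; last by rewrite -s2; field.
  by move: yeps; rewrite ltr_pdivrMr//; lra.
have [e [e0 esV yFe]] := continuous_at0_gt cF F0 (mulr_gt0 s0 V0).
exists s => c sc.
have [n1 H1] := rescaled_expansion HP (ltW V0) s0 e0.
pose x := (s ^+ 2 * (V / 4) + e)%R.
have x0 : (0 < x)%R by rewrite addr_gt0// mulr_gt0 ?exprn_gt0// divr_gt0.
exists (maxn n1 (Num.bound (x / 2 * (1 + e) / e)).+1) => n.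
rewrite geq_max => /andP[/H1[n0 {}H1] n2].
have nbig : (x / 2 * (1 + e) / e < n%:R)%R.
  have p0 : (0 <= x / 2 * (1 + e) / e)%R.
    by rewrite divr_ge0 ?(ltW e0)// mulr_ge0 ?divr_ge0 ?(ltW x0)// addr_ge0// ltW.
  by apply: (lt_trans (archi_boundP p0)); rewrite ltr_nat.
have s00 : (`|0 : R| <= s)%R by rewrite normr0 ltW.
have ss : (`|s| <= s)%R by rewrite gtr0_norm.
have [psis aff] := H1 s 0%R ss s00.
move: aff; rewrite mul0r subr0 -/x (_ : x / n%:R / 2 = x / 2 / n%:R)%R; last by field; rewrite pnatr_eq0 -lt0n.
set r := Num.sqrt _ in psis *.
have r0 : (0 < r)%R by rewrite sqrtr_gt0 ltr0n.
have r2 : (r ^+ 2 = n%:R)%R by rewrite sqr_sqrtr.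
move=> aff.
have a0 : (0 <= 1 - x / 2 / n%:R)%R.
  rewrite subr_ge0 ler_pdivrMr ?ltr0n// mul1r.
  have x20 : (0 < x / 2)%R by rewrite divr_gt0.
  have : (x / 2 <= x / 2 * (1 + e) / e)%R by rewrite ler_pdivlMr// ler_pM2l// lerDr.
  move=> /le_trans; apply; exact: ltW.
have := hellinger2_le (affinity_ge_iid (n := n) a0 aff).
have := hellinger2_ge0 (iid (P (s / r)%R) n) (iid (P 0%R) n).
set H := hellinger2 _ _ => H0 HA.
have A1 : (expR (- (x / 2 * (1 + e))) <= (1 - x / 2 / n%:R) ^+ n)%R.
  by apply: expR_le_expr1B => //; rewrite divr_ge0// ltW.
apply: (@le_trans _ _ (n%:R%:E * (maxe 0 ((1 - H) / 4%:E)
        * (`|psi (P (s / r)%R) - psi (P 0%R)| ^+ 2)%:E))); last first.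
  apply: lee_wpmul2l; first by rewrite lee_fin.
  apply: ereal_sup_ubound; exists (s / r)%R, 0%R; split=> //.
    by apply: Theta_div; rewrite // gtr0_norm.
  have := Theta_div n0 (_ : `|0| < c)%R; rewrite mul0r normr0; apply.
  exact: lt_trans sc.
have HE : H = (fine H)%:E.
  by rewrite fineK// ge0_fin_numE//; exact: le_lt_trans HA (ltry _).
move: HA; rewrite HE lee_fin => HA.
rewrite inver pnatr_eq0/= -EFinB -EFinM -EFin_max -!EFinM lee_fin.
set k := (2^-1 * expR (- (x / 2 * (1 + e))) - 4^-1)%R.
have k0 : (0 < k)%R.
  have := le_lt_trans y0 yFe; rewrite /F -/x -/k pmulr_lgt0//.
  by rewrite exprn_gt0// subr_gt0.
have kle : (k <= Num.max 0 ((1 - fine H) / 4))%R.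
  by rewrite le_max; apply/orP; right; rewrite /k; lra.
have psi2 : ((s * V - e) ^+ 2 <= n%:R * `|psi (P (s / r)) - psi (P 0)| ^+ 2)%R.
  have m1 : (0 <= s * V - e)%R by rewrite subr_ge0 ltW.
  have m2 : (s * V - e <= r * (psi (P (s / r)) - psi (P 0)))%R.
    by move: psis; rewrite ler_norml => /andP[+ _]; lra.
  rewrite -r2 real_normK ?num_real// -exprMn.
  by rewrite ler_pXn2r ?nnegrE ?m1 ?(le_trans m1 m2).
apply: (@le_trans _ _ (F e)); first exact: ltW.
by rewrite /F -/x -/k [leRHS]mulrCA; apply: ler_pM => //; [exact: ltW|exact: sqr_ge0].
Qed.

(** Suppose that the risk is less than [q^2 / n] on the chain of points
[j h / sqrt n], [j <= N], where [q < w = sqrt V].  With the optimal [tau], each step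
raises the mean of the estimator, in units of [1 / sqrt n], by at most
[h w (q + h V)] up to small errors, and [psi] by [h V = h w^2].  For the given [h] the
difference per step is [z = h w (w - q) / 2], so for [N z > 2 q] the two ends contradict
the bound [q] on the bias. *)
Lemma minimax_eventually_above P (V : R) : (0 <= V)%R -> locally_gaussian psi P V ->
  eventually_above (minimax_risk psi P) V.
Proof.
move=> V0 HP; apply: eventually_above_ge0 => //.
  move=> c c0; exists 1%N => n n0; apply: le_ereal_inf_tmp => _ [T mT <-].
  apply: ereal_sup_ge; exists (\int[iid (P 0%R) n]_x ((T x - psi (P 0%R)) ^+ 2)%:E).
    exists 0%R => //.
    by have := Theta_div n0 (_ : `|0| < c)%R; rewrite mul0r normr0; apply.
  by apply: integral_ge0 => x _; rewrite lee_fin sqr_ge0.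
move=> y y0 yV.
have {}V0 : (0 < V)%R by exact: le_lt_trans yV.
(* Replacing y by y1 makes the assumed risk positive. *)
pose y1 := ((y + V) / 2)%R.
have y10 : (0 < y1)%R by rewrite /y1; lra.
have yy1 : (y <= y1)%R by rewrite /y1; lra.
have y1V : (y1 < V)%R by rewrite /y1; lra.
pose q := Num.sqrt y1; pose w := Num.sqrt V.
have q0 : (0 < q)%R by rewrite sqrtr_gt0.
have q2 : (q ^+ 2 = y1)%R by rewrite sqr_sqrtr// ltW.
have w0 : (0 < w)%R by rewrite sqrtr_gt0.
have w2 : (w ^+ 2 = V)%R by rewrite sqr_sqrtr// ltW.
have qw : (q < w)%R by rewrite ltr_sqrt.
pose h := ((w - q) / (2 * V))%R.
have h0 : (0 < h)%R by rewrite divr_gt0 ?subr_gt0// mulr_gt0.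
have hV : (h * V = (w - q) / 2)%R by rewrite /h; field; rewrite gt_eqF.
(* ka minimises h ^+ 2 * V / 4 / ka + ka * (q + h * V) ^+ 2, the growth of the
   mean in one step as ka stands for tau / sqrt n. *)
pose ka := (h * w / 2 / (q + h * V))%R.
have D0 : (0 < q + h * V)%R by rewrite addr_gt0// mulr_gt0.
have ka0 : (0 < ka)%R by rewrite divr_gt0// divr_gt0// mulr_gt0.
pose z := (h * w * (w - q) / 2)%R.
have z0 : (0 < z)%R by rewrite divr_gt0// mulr_gt0 ?subr_gt0// mulr_gt0.
pose N := (Num.bound (2 * q / z)).+1.
have Nz : (2 * q < N%:R * z)%R.
  rewrite -ltr_pdivrMr//; apply: lt_trans (_ : _ < (Num.bound (2 * q / z))%:R)%R _.
    by apply: archi_boundP; apply: divr_ge0; [apply: mulr_ge0 => //|]; exact: ltW.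
  by rewrite ltr_nat.
(* G e is the margin of the contradiction when the expansion has error e. *)
pose G (e : R) := (N%:R * h * V - e - 2 * q
  - N%:R * ((h ^+ 2 * (V / 4) + e) / ka + ka * (q + (h * V + 2 * e)) ^+ 2))%R.
have cG : {for 0%R, continuous G} by apply: is_derive_continuous.
have G0 : (0 < G 0)%R.
  rewrite /G mulr0 !addr0 subr0.
  have -> : (h ^+ 2 * (V / 4) / ka + ka * (q + h * V) ^+ 2 = h * w * (q + h * V))%R.
    rewrite /ka -w2; field.
    by rewrite !gt_eqF//= w2.
  have -> : (N%:R * h * V - 2 * q - N%:R * (h * w * (q + h * V)) = N%:R * z - 2 * q)%R.
    by rewrite hV -w2 /z; field.
  by rewrite subr_gt0.
have [e [e0 _ Ge]] := continuous_at0_gt cG G0 ltr01.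
exists (N%:R * h)%R => c Nhc.
have Nh0 : (0 < N%:R * h)%R by rewrite mulr_gt0.
have [n0 H0] := rescaled_expansion HP (ltW V0) Nh0 e0.
exists n0 => n /H0[n1 {}H0].
set r := Num.sqrt _ in H0.
have r0 : (0 < r)%R by rewrite sqrtr_gt0 ltr0n.
have r2 : (r ^+ 2 = n%:R)%R by rewrite sqr_sqrtr.
apply: (@le_trans _ _ y1%:E); first by rewrite lee_fin.
have -> : y1%:E = n%:R%:E * ((q / r) ^+ 2)%:E.
  by rewrite -EFinM -r2 -q2; congr EFin; field; rewrite gt_eqF.
apply: lee_wpmul2l; first by rewrite lee_fin.
apply: le_ereal_inf_tmp => _ [T mT <-].
rewrite leNgt; apply/negP => risk.
pose K j := iid (P (j%:R * h / r)%R) n.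
pose cc j := psi (P (j%:R * h / r)%R).
have sN j : (j <= N)%N -> (`|j%:R * h| <= N%:R * h)%R.
  by move=> jN; rewrite normrM !ger0_norm ?(ltW h0)// ler_pM2r// ler_nat.
have riskK j : (j <= N)%N -> \int[K j]_x ((T x - cc j) ^+ 2)%:E <= ((q / r) ^+ 2)%:E.
  move=> jN; apply: ltW; apply: le_lt_trans risk.
  apply: ereal_sup_ubound; exists (j%:R * h / r)%R => //.
  by apply: Theta_div => //; exact: le_lt_trans (sN _ jN) _.
pose x := (h ^+ 2 * (V / 4) + e)%R.
have x0 : (0 <= x)%R by rewrite addr_ge0 ?(ltW e0)// mulr_ge0 ?sqr_ge0// divr_ge0// ltW.
have affK j : (j < N)%N -> affinity_ge (K j) (K j.+1) (1 - x / 2).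
  move=> jN; apply: affinity_ge_iid_bernoulli => //.
  have [_] := H0 _ _ (sN _ (ltnW jN)) (sN _ jN).
  rewrite (_ : (j%:R * h - j.+1%:R * h) ^+ 2 = h ^+ 2)%R//.
  by rewrite -natr1; ring.
have psiK j : (j <= N)%N -> (`|r * (cc j - psi (P 0)) - j%:R * h * V| <= e)%R.
  by move=> jN; have [] := H0 _ _ (sN _ jN) (sN _ jN).
have betaK j : (j < N)%N -> (`|cc j.+1 - cc j| <= (h * V + 2 * e) / r)%R.
  move=> jN; have := psiK _ jN; have := psiK _ (ltnW jN).
  rewrite -natr1 ler_pdivlMr// -{3}(gtr0_norm r0) -normrM !ler_norml.
  have hV0 : (0 < h * V)%R by rewrite mulr_gt0.
  move=> /andP[p1 p2] /andP[p3 p4]; apply/andP; split; nra.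
have qr0 : (0 < q / r)%R by rewrite divr_gt0.
have kr0 : (0 < r * ka)%R by rewrite mulr_gt0.
have := risk_telescoping mT qr0 kr0 riskK affK betaK.
rewrite -(ler_pM2l r0).
have -> : (r * (2 * (q / r) + N%:R * ((2 - 2 * (1 - x / 2)) / (r * ka) +
    r * ka * (q / r + (h * V + 2 * e) / r) ^+ 2)) =
    2 * q + N%:R * (x / ka + ka * (q + (h * V + 2 * e)) ^+ 2))%R.
  by field; rewrite !gt_eqF.
have := psiK N (leqnn N); rewrite ler_norml => /andP[h1 _].
have -> : cc 0%N = psi (P 0%R) by rewrite /cc mul0r mul0r.
move: Ge; rewrite /G -/x => Ge h2; lra.
Qed.

End two_point_and_minimax.

(** * The Chapman-Robbins and Hellinger bounds, with a lattice prior *)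

Section squash.
Context (R : realType).

(** For [s = 1] this maps the line onto [(-r, r)], and for [s = -1] it is the
inverse map.  It is almost the identity near 0, so lattices are almost
preserved. *)
Definition squash (s r u : R) : R := (u * (Num.sqrt (1 + s * (u / r) ^+ 2))^-1)%R.

Variable r : R.
Hypothesis r0 : (0 < r)%R.

Lemma is_derive_squash (s u : R) : (0 < 1 + s * (u / r) ^+ 2)%R ->
  is_derive u 1%R (fun x : R => (Num.sqrt (1 + s * (x / r) ^+ 2))^-1)%R
    (- (s * u / r ^+ 2) * (Num.sqrt (1 + s * (u / r) ^+ 2))^-1 ^+ 3)%R /\
  is_derive u 1%R (squash s r) ((Num.sqrt (1 + s * (u / r) ^+ 2))^-1 ^+ 3)%R.
Proof.
move=> w0; have rn0 := lt0r_neq0 r0.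
pose w (x : R) := (1 + s * (x / r) ^+ 2)%R.
have q0 : (0 < Num.sqrt (w u))%R by rewrite sqrtr_gt0.
have q2 : (Num.sqrt (w u) ^+ 2 = w u)%R by rewrite sqr_sqrtr// ltW.
have dw : is_derive u 1%R w (2 * s * u / r ^+ 2)%R.
  by rewrite /w; apply: is_derive_eq; rewrite /GRing.scale/=; field.
have dq : is_derive u 1%R (fun x => Num.sqrt (w x))
    ((2 * Num.sqrt (w u))^-1 * (2 * s * u / r ^+ 2))%R.
  have := is_derive1_sqrt w0 => dsq.
  have := @is_derive1_comp R (@Num.sqrt R) w u _ _ dsq dw.
  by move=> ?; apply: is_derive_eq.
have dv : is_derive u 1%R (fun x : R => (Num.sqrt (w x))^-1)%R
    (- (s * u / r ^+ 2) * (Num.sqrt (w u))^-1 ^+ 3)%R.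
  have := @is_deriveV R (fun x => Num.sqrt (w x)) u _ _ (lt0r_neq0 q0) dq.
  move=> dV; apply: is_derive_eq; rewrite /GRing.scale/=.
  by field; rewrite rn0 gt_eqF.
split=> //.
rewrite /squash; apply: is_derive_eq; rewrite /GRing.scale/= -/(w u) mulr1.
move: q2 q0; set q := Num.sqrt _ => q2 q0.
have e : (s * u ^+ 2 / r ^+ 2 = q ^+ 2 - 1)%R by rewrite q2 /w; field.
transitivity (q^-1 ^+ 3 * (q ^+ 2 - s * u ^+ 2 / r ^+ 2))%R; last by rewrite e; ring.
by field; rewrite rn0 gt_eqF.
Qed.

Lemma continuously_derivable_squash (s : R) (I : set R) : open I ->
  (forall u, I u -> (0 < 1 + s * (u / r) ^+ 2)%R) ->
  continuously_derivable I (squash s r).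
Proof.
move=> oI Iw; split=> u Iu.
  by have [_ []] := is_derive_squash (Iw u Iu).
have [dv _] := is_derive_squash (Iw u Iu).
have cv := is_derive_continuous dv.
have E : \forall x \near u, derive1 (squash s r) x =
    ((Num.sqrt (1 + s * (x / r) ^+ 2))^-1 ^+ 3)%R.
  have := open_nbhs_nbhs (conj oI Iu); apply: filterS => x Ix.
  have [_ [_ <-]] := is_derive_squash (Iw x Ix).
  by rewrite derive1E.
have Eu := nbhs_singleton E; rewrite /prop_for /continuous_at Eu.
apply: cvg_trans (near_eq_cvg _) _.
  by near=> x; near: x; move: E; apply: filterS => x ->.
exact: (continuous_comp cv (@exprn_continuous _ 3 _)).
Unshelve. all: by end_near.
Qed.

Lemma squashK (s u : R) : (0 < 1 + s * (u / r) ^+ 2)%R ->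
  squash (- s) r (squash s r u) = u.
Proof.
move=> w0; rewrite /squash.
set q := Num.sqrt (1 + s * (u / r) ^+ 2)%R.
have q0 : (0 < q)%R by rewrite sqrtr_gt0.
have q2 : (q ^+ 2 = 1 + s * (u / r) ^+ 2)%R by rewrite sqr_sqrtr// ltW.
have -> : (1 + - s * (u * q^-1 / r) ^+ 2 = q^-1 ^+ 2)%R.
  transitivity ((q ^+ 2 - s * (u / r) ^+ 2) / q ^+ 2)%R.
    by field; rewrite !gt_eqF.
  rewrite (_ : q ^+ 2 - s * (u / r) ^+ 2 = 1)%R; last by rewrite q2; ring.
  by rewrite div1r exprVn.
by rewrite sqrtr_sqr ger0_norm ?invr_ge0 ?(ltW q0)// invrK divfK// gt_eqF.
Qed.

Lemma squash_radicand_gt0 (u : R) : (0 < 1 + 1 * (u / r) ^+ 2)%R.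
Proof. by rewrite mul1r ltr_wpDr ?sqr_ge0. Qed.

Lemma unsquash_radicand_gt0 (t : R) : `](- r)%R, r[%classic t ->
  (0 < 1 + - 1 * (t / r) ^+ 2)%R.
Proof.
rewrite /= in_itv/= -ltr_norml => tr; rewrite mulN1r subr_gt0.
rewrite -(real_normK (num_real _)) expr_lt1// normrM normfV (gtr0_norm r0).
by rewrite ltr_pdivrMr// mul1r.
Qed.

Lemma squash_in (u : R) : `](- r)%R, r[%classic (squash 1 r u).
Proof.
rewrite /= in_itv/= -ltr_norml /squash normrM normfV.
rewrite (ger0_norm (sqrtr_ge0 _)) mul1r.
have w0 : (0 < 1 + (u / r) ^+ 2)%R by rewrite ltr_wpDr ?sqr_ge0.
rewrite ltr_pdivrMr ?sqrtr_gt0// -(ltr_pXn2r (n := 2)) ?nnegrE ?mulr_ge0 ?sqrtr_ge0 ?(ltW r0)//.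
rewrite real_normK ?num_real// exprMn sqr_sqrtr ?(ltW w0)//.
rewrite mulrDr mulr1 -exprMn mulrCA divff ?gt_eqF// mulr1 ltrDr.
by rewrite exprn_gt0.
Qed.

Lemma squash_diffeomorphism :
  diffeomorphism_onto `](- r)%R, r[%classic (squash 1 r).
Proof.
exists (squash (- 1) r); split.
- exact: squash_in.
- by move=> u; apply: squashK; exact: squash_radicand_gt0.
- move=> t It; rewrite -[X in squash X]opprK; apply: squashK.
  exact: unsquash_radicand_gt0.
- by apply: continuously_derivable_squash openT _ => u _; exact: squash_radicand_gt0.
- apply: continuously_derivable_squash; first exact: interval_open.
  exact: unsquash_radicand_gt0.
Qed.

Lemma squash0 : squash 1 r 0 = 0%R.
Proof. by rewrite /squash mul0r. Qed.

Lemma squash_increment (a b : R) : (a <= b)%R ->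
  (0 <= squash 1 r b - squash 1 r a <= b - a)%R.
Proof.
move=> ab.
pose df (x : R) := ((Num.sqrt (1 + 1 * (x / r) ^+ 2))^-1 ^+ 3)%R.
have dsq (x : R) : is_derive x 1%R (squash 1 r) (df x).
  by have [] := is_derive_squash (squash_radicand_gt0 x).
have df0 x : (0 <= df x)%R by rewrite exprn_ge0// invr_ge0 sqrtr_ge0.
have df1 x : (df x <= 1)%R.
  rewrite exprn_ile1 ?invr_ge0 ?sqrtr_ge0// invf_le1.
    by rewrite -[leLHS]sqrtr1 ler_wsqrtr// mul1r lerDl sqr_ge0.
  by rewrite sqrtr_gt0 squash_radicand_gt0.
have dB (x : R) : is_derive x 1%R (fun y : R => y - squash 1 r y)%R (1 - df x)%R.
  by have := dsq x => dx; apply: is_derive_eq.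
apply/andP; split; first by rewrite subr_ge0; apply: ger0_is_derive_le dsq _.
have : (a - squash 1 r a <= b - squash 1 r b)%R.
  by apply: ger0_is_derive_le dB _ => // x _; rewrite subr_ge0.
lra.
Qed.

(** Together with [squash_increment] this bounds the distortion of lattice points. *)
Lemma squash_ge (u : R) : (0 <= u)%R -> (u * (1 - u / r) <= squash 1 r u)%R.
Proof.
move=> u0; rewrite /squash ler_wpM2l// mul1r.
set y := (u / r)%R; have y0 : (0 <= y)%R by rewrite divr_ge0// ltW.
have w0 : (0 < 1 + y ^+ 2)%R by rewrite ltr_wpDr ?sqr_ge0.
have q0 : (0 < Num.sqrt (1 + y ^+ 2))%R by rewrite sqrtr_gt0.
rewrite -[leRHS]mul1r ler_pdivlMr//.
have q1 : (Num.sqrt (1 + y ^+ 2) <= 1 + y)%R.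
  rewrite -[leRHS]ger0_norm ?addr_ge0// -sqrtr_sqr ler_wsqrtr//; nra.
nra.
Qed.

End squash.

Section lattice_law.
Context (R : realType).

(** A function modified arbitrarily on a finite set of points: this makes kernels and
integrands that matter only at the atoms of a discrete prior measurable. *)
Lemma measurable_fun_patch_seq d (T : measurableType d) (s : seq R)
    (f g : R -> T) : measurable_fun setT g ->
  measurable_fun setT (fun t => if t \in s then f t else g t).
Proof.
move=> mg; elim: s => [//|a s IH].
rewrite (_ : (fun t => _) = (fun t => if t == a then f a
    else if t \in s then f t else g t)); last first.
  by apply/funext => t; rewrite inE; have [->|] := eqVneq t a.
apply: measurable_fun_ifT => //.
by apply: measurable_fun_eqr.
Qed.

Lemma measurable_seq (s : seq R) : measurable [set` s].
Proof.
apply: countable_measurable; first exact: measurable_set1.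
exact/finite_set_countable/finite_seq.
Qed.

Definition lattice_law (M : nat) (u : nat -> R) : set R -> \bar R :=
  mscale (M.+1%:R^-1)%:nng%R (msum (fun i => \d_(u i)) M.+1).

HB.instance Definition _ M u := Measure.on (lattice_law M u).

Let lattice_law_setT M u : lattice_law M u setT = 1.
Proof.
rewrite /lattice_law /mscale/= /msum.
rewrite (eq_bigr (fun=> 1%:E)); last by move=> i _; exact: diracT.
by rewrite sumEFin -EFinM sumr_const card_ord mulVf// pnatr_eq0.
Qed.

HB.instance Definition _ M u := Measure_isProbability.Build _ _ _
  (lattice_law M u) (lattice_law_setT M u).

Lemma lattice_lawE M (u : nat -> R) A :
  lattice_law M u A = (M.+1%:R^-1)%:E * \sum_(i < M.+1) \d_(u i) A.
Proof. by []. Qed.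

Lemma lattice_law_null M (u : nat -> R) :
  measurable (~` [set` [seq u i | i <- iota 0 M.+1]] : set R) /\
  lattice_law M u (~` [set` [seq u i | i <- iota 0 M.+1]]) = 0.
Proof.
split; first by apply: measurableC; exact: measurable_seq.
rewrite lattice_lawE big1 ?mule0// => i _.
rewrite diracE memNset// => /(_ _); apply.
by apply: map_f; rewrite mem_iota add0n ltn_ord.
Qed.

Lemma lattice_law_ae M (u : nat -> R) (p : R -> Prop) :
  (forall i, (i < M.+1)%N -> p (u i)) -> {ae lattice_law M u, forall t, p t}.
Proof.
move=> pu; exists (~` [set` [seq u i | i <- iota 0 M.+1]]); split.
- exact: (lattice_law_null M u).1.
- exact: (lattice_law_null M u).2.
- move=> t npt ts; apply: npt.
  have /mapP[i] : t \in [seq u i | i <- iota 0 M.+1] by exact: ts.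
  by rewrite mem_iota add0n => /andP[_ iM] -> /=; exact: pu.
Qed.

Lemma ge0_integral_lattice_law M (u : nat -> R) (f : R -> \bar R) :
  (forall t, 0 <= f t) ->
  \int[lattice_law M u]_t f t = (M.+1%:R^-1)%:E * \sum_(i < M.+1) f (u i).
Proof.
move=> f0; pose s := [seq u i | i <- iota 0 M.+1].
pose g t := if t \in s then f t else 0.
have mg : measurable_fun setT g by exact: measurable_fun_patch_seq.
have g0 t : 0 <= g t by rewrite /g; case: ifP.
rewrite (@eq_integral_off_null _ _ _ (lattice_law M u) (~` [set` s]) f g); last 3 first.
- exact: (lattice_law_null M u).1.
- exact: (lattice_law_null M u).2.
- by move=> t /contrapT /= ts; rewrite /g ts.
rewrite ge0_integral_mscale//= ge0_integral_measure_sum//.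
congr (_ * _); apply: eq_bigr => i _.
rewrite integral_dirac//= diracT mul1e /g.
by rewrite ifT//; apply: map_f; rewrite mem_iota add0n ltn_ord.
Qed.

Lemma integral_lattice_law M (u : nat -> R) (f : R -> R) :
  \int[lattice_law M u]_t (f t)%:E =
    (M.+1%:R^-1 * \sum_(i < M.+1) f (u i))%:E%R.
Proof.
rewrite integralE !ge0_integral_lattice_law//.
under eq_bigr do rewrite funeposE -EFin_max.
under [X in _ - _ * X]eq_bigr do rewrite funenegE -EFinN -EFin_max.
rewrite !sumEFin -!EFinM -EFinB -mulrBr -sumrB; congr (_ * _)%:E%R.
apply: eq_bigr => i _; rewrite !maxEle.
case: (leP (f (u i)) 0%R) => h1; case: (leP (- f (u i))%R 0%R) => h2; lra.
Qed.

Lemma lattice_law_ae_integrable M (u : nat -> R) (f : R -> R) :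
  ae_integrable (lattice_law M u) setT f.
Proof.
pose s := [seq u i | i <- iota 0 M.+1].
exists (fun t => if t \in s then f t else 0%R).
  apply/integrableP; split.
    by apply/measurable_EFinP; exact: measurable_fun_patch_seq.
  rewrite (eq_integral (fun t => (`|if t \in s then f t else 0|)%:E%R))//.
  by rewrite integral_lattice_law ltry.
apply: lattice_law_ae => i iM _; rewrite ifT//.
by apply: map_f; rewrite mem_iota add0n.
Qed.

End lattice_law.

Section lattice_joint_law.
Context d (Y : measurableType d) (R : realType).

Definition pair_with (c : R) (x : Y) : Y * R := (x, c).

Let measurable_pair_with c : measurable_fun setT (pair_with c).
Proof. exact: measurable_pair2. Qed.

HB.instance Definition _ c :=
  isMeasurableFun.Build _ _ _ _ (pair_with c) (measurable_pair_with c).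

Lemma ge0_integral_joint_lattice_law M (u : nat -> R) (k : R.-pker R ~> Y)
    (K : nat -> probability Y R) (h : R) (f : Y * R -> \bar R) :
  (forall i, (i <= M)%N -> k (u i) ≡μ K i) -> measurable_fun setT f ->
  (forall z, 0 <= f z) ->
  \int[joint_law (lattice_law M u) k h]_z f z =
  (M.+1%:R^-1)%:E * \sum_(i < M.+1) \int[K i]_x f (x, (u i - h)%R).
Proof.
move=> kK mf f0.
pose m_ i : {measure set (Y * R) -> \bar R} :=
  distribution (K i) (pair_with (u i - h)%R).
rewrite (eq_measure_integral
  (mscale (M.+1%:R^-1)%:nng%R (msum m_ M.+1))); last first.
  move=> A mA _.
  transitivity (\int[lattice_law M u]_t k t [set x | A (x, (t - h)%R)]) => //.
  rewrite ge0_integral_lattice_law//.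
  congr (_ * _); apply: eq_bigr => i _; apply: kK; first by rewrite -ltnS.
  rewrite -[X in measurable X]setTI.
  exact: (measurable_pair_with (u i - h)%R measurableT mA).
rewrite ge0_integral_mscale//= ge0_integral_measure_sum//.
by congr (_ * _); apply: eq_bigr => i _; rewrite ge0_integral_distribution.
Qed.

(** The unshifted law has the atom [u i] coupled with [K i], the shifted one couples the
same atom with [K i.+1]; the last atom of the first and the first atom of the
second law are lost. *)
Lemma affinity_ge_joint_lattice_law M (u : nat -> R) (k : R.-pker R ~> Y)
    (h : R) (K : nat -> probability Y R) (a : R) :
  (forall i, (i <= M)%N -> k (u i) ≡μ K i) ->
  (forall i, (i < M)%N -> (u i.+1 - h)%R = u i) ->
  (forall i, (i < M)%N -> affinity_ge (K i) (K i.+1) a) ->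
  affinity_ge (joint_law (lattice_law M u) k 0%R)
    (joint_law (lattice_law M u) k h) (M%:R / M.+1%:R * a).
Proof.
move=> kK uh aff f mf f0.
have mif : measurable_fun setT (fun z => (f z)^-1)%R by exact: measurable_inv.
rewrite !(ge0_integral_joint_lattice_law _ kK); last 4 first.
- exact/measurable_EFinP.
- by move=> z; rewrite lee_fin invr_ge0 ltW.
- exact/measurable_EFinP.
- by move=> z; rewrite lee_fin ltW.
have pf (M1 : {measure set Y -> \bar R}) c : 0 <= \int[M1]_x (f (x, c))%:E.
  by apply: integral_ge0 => x _; rewrite lee_fin ltW.
have pif (M1 : {measure set Y -> \bar R}) c :
    0 <= \int[M1]_x ((f (x, c))^-1)%:E.
  by apply: integral_ge0 => x _; rewrite lee_fin invr_ge0 ltW.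
rewrite -ge0_muleDr; last 2 first.
- by apply: sume_ge0 => i _; exact: pf.
- by apply: sume_ge0 => i _; exact: pif.
rewrite (_ : (2 * (M%:R / M.+1%:R * a))%:E =
    (M.+1%:R^-1)%:E * (M%:R * (2 * a))%:E); last first.
  by rewrite -EFinM; congr EFin; field; rewrite nat1r pnatr_eq0.
apply: lee_wpmul2l; first by rewrite lee_fin.
apply: (@le_trans _ _ (\sum_(i < M) (\int[K i]_x (f (x, u i))%:E
    + \int[K i.+1]_x ((f (x, u i))^-1)%:E))).
  apply: (@le_trans _ _ (\sum_(i < M) (2 * a)%:E)).
    by rewrite sumEFin sumr_const card_ord mulr_natl.
  apply: lee_sum => i _; apply: (aff i (ltn_ord i) (fun x => f (x, u i))).
    by apply: (measurableT_comp mf); exact: measurable_pair2.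
  by move=> x; exact: f0.
rewrite big_split/=; apply: leeD.
  rewrite big_ord_recr/= -[leLHS]adde0; apply: leeD; last exact: pf.
  by apply: lee_sum => i _; rewrite subr0.
rewrite big_ord_recl/= -[leLHS]add0e; apply: leeD; first exact: pif.
by apply: lee_sum => i _; rewrite /bump/= add1n uh.
Qed.

End lattice_joint_law.

Section bracket.
Context (R : realType).

Lemma bracket2_ge (x y : \bar R) (a b : R) : a%:E <= x -> y <= b%:E ->
  (b <= a)%R -> ((a - b) ^+ 2)%:E <= bracket2 x y.
Proof.
move=> ax yb ba.
have h : (a - b)%:E <= maxe 0 (x - y).
  by rewrite le_max; apply/orP; right; rewrite EFinB; exact: leeB.
have h0 : 0 <= (a - b)%:E by rewrite lee_fin subr_ge0.
by rewrite /bracket2 expr2 EFinM; exact: lee_pmul.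
Qed.

Lemma bracket2_ge0 (x y : \bar R) : 0 <= bracket2 x y.
Proof.
have h : 0 <= maxe 0 (x - y) by rewrite le_max lexx.
exact: mule_ge0.
Qed.

(** The divergence [H] may vanish, in which case the ratio is infinite or,
for [m = 0], zero. *)
Lemma sqrte_ratio_ge (m D : R) (H : \bar R) : (0 <= m)%R -> (0 < D)%R ->
  0 <= H -> H <= D%:E -> (m / Num.sqrt D)%:E <= sqrte ((m ^+ 2)%:E / H).
Proof.
move=> m0 D0 H0 HD.
have h : (m ^+ 2 / D)%:E <= (m ^+ 2)%:E / H.
  rewrite EFinM; apply: lee_wpmul2l; first by rewrite lee_fin sqr_ge0.
  rewrite (_ : (D^-1)%:E = D%:E^-1); last by rewrite inver gt_eqF.
  by rewrite lee_pV2// inE ?lee_fin// ltW.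
have mDE : sqrte (m ^+ 2 / D)%:E = (m / Num.sqrt D)%:E.
  by rewrite /= sqrtrM ?sqr_ge0// sqrtr_sqr ger0_norm// sqrtrV// ltW.
by rewrite -mDE lee_sqrt// mule_ge0 ?inve_ge0// lee_fin sqr_ge0.
Qed.

End bracket.

Section chapman_robbins_bounds.
Context d (X : measurableType d) (R : realType).
Variables (nu : {sigma_finite_measure set X -> \bar R}) (psi : model nu -> R).
Implicit Types (P : R -> model nu).

Definition lattice_points (h : R) (i : nat) : R := (i.+1%:R * h)%R.

(** The product laws at the lattice points, and that of [P 0] elsewhere, as the path need not be
measurable in the parameter. *)
Definition lattice_kernel P (c : R) n M (h : R) : R.-pker R ~> n.-tuple X :=
  kprobability (measurable_fun_patch_seq
    [seq lattice_points h i | i <- iota 0 M.+1]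
    (fun t => iid (P (squash 1 (theta_radius c n) t)) n : pprobability _ R)
    (measurable_cst (iid (P 0%R) n : pprobability _ R))).

Lemma lattice_kernelE P c n M h i : (i <= M)%N ->
  lattice_kernel P c n M h (lattice_points h i) ≡μ
  iid (P (squash 1 (theta_radius c n) (lattice_points h i))) n.
Proof.
move=> iM A mA.
have ip : lattice_points h i \in [seq lattice_points h i | i <- iota 0 M.+1].
  by apply: map_f; rewrite mem_iota add0n ltnS.
by rewrite /lattice_kernel /kprobability/=; case: ifPn => // /negP[].
Qed.

Lemma theta_radius_gt0 (c : R) n : (0 < c)%R -> (0 < n)%N ->
  (0 < theta_radius c n)%R.
Proof. by move=> c0 n0; rewrite divr_gt0// sqrtr_gt0 ltr0n. Qed.

Lemma lattice_admissible P (c : R) n M h : (0 < c)%R -> (0 < n)%N ->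
  admissible psi P c (squash 1 (theta_radius c n))
    (lattice_law M (lattice_points h)) h (lattice_kernel P c n M h).
Proof.
move=> c0 n0; split.
- exact: squash_diffeomorphism (theta_radius_gt0 c0 n0).
- by apply: lattice_law_ae => i iM; exact: lattice_kernelE.
- exact: lattice_law_ae_integrable.
Qed.

(** The sum of the increments over a lattice telescopes. *)
Lemma lattice_shift_mean2 P (phi : R -> R) M h :
  shift_mean2 psi P phi (lattice_law M (lattice_points h)) h =
  ((M.+1%:R^-1 * (psi (P (phi (M.+1%:R * h))) - psi (P (phi 0)))) ^+ 2)%:E%R.
Proof.
rewrite /shift_mean2 integral_lattice_law abse_EFin.
pose v (j : nat) := psi (P (phi (j%:R * h)%R)).
have -> : (\sum_(i < M.+1) (psi (P (phi (lattice_points h i)))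
    - psi (P (phi (lattice_points h i - h)))) = v M.+1 - v 0%N)%R.
  rewrite -(telescope_sumr v (leq0n M.+1)) big_mkord; apply: eq_bigr => i _.
  by rewrite /v /lattice_points -natr1 mulrDl mul1r addrK.
rewrite /v mul0r expe2 -EFinM; congr EFin.
by rewrite -expr2 real_normK// num_real.
Qed.

Lemma lattice_mean_shift2 P (phi : R -> R) M h (b : R) :
  (forall i, (i <= M)%N ->
    `|psi (P (phi (i.+1%:R * h))) - psi (P (phi (i%:R * h)))| <= b)%R ->
  exists B : R, [/\ mean_shift2 psi P phi (lattice_law M (lattice_points h)) h = B%:E,
    (0 <= B)%R & (B <= b ^+ 2)%R].
Proof.
move=> Hb; eexists; split; first exact: integral_lattice_law.
  by rewrite mulr_ge0// sumr_ge0// => i _; exact: sqr_ge0.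
rewrite ler_pdivrMl// mulr_natl -[X in (_ *+ X)%R](card_ord M.+1) -sumr_const.
apply: ler_sum => i _.
have b0 : (0 <= b)%R by apply: le_trans (Hb 0%N _).
rewrite -(real_normK (num_real (_ - _))) ler_pXn2r ?nnegrE//.
have := Hb i (ltn_ord i).
by rewrite /lattice_points -natr1 mulrDl mul1r addrK.
Qed.

Lemma lattice_affinity P (c : R) n M h a : (0 < c)%R -> (0 < n)%N ->
  (forall i, (i < M)%N -> affinity_ge
    (iid (P (squash 1 (theta_radius c n) (i.+1%:R * h))) n)
    (iid (P (squash 1 (theta_radius c n) (i.+2%:R * h))) n) a)%R ->
  affinity_ge
    (joint_law (lattice_law M (lattice_points h)) (lattice_kernel P c n M h) 0%R)
    (joint_law (lattice_law M (lattice_points h)) (lattice_kernel P c n M h) h)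
    (M%:R / M.+1%:R * a).
Proof.
move=> c0 n0 aff; apply: affinity_ge_joint_lattice_law.
- exact: lattice_kernelE.
- move=> i _; rewrite /lattice_points -[in LHS]natr1; ring.
- exact: aff.
Qed.

(** What [bound2] and [bound3] need of a lattice prior: [m / (2 sqrt D)] bounds the first
term of each bracket from below and [sqrt B] the second from above. *)
Definition lattice_evidence P (c : R) n (y : R) :=
  exists M h, exists m B D : R,
  [/\ [/\ shift_mean2 psi P (squash 1 (theta_radius c n))
         (lattice_law M (lattice_points h)) h = (m ^+ 2)%:E,
       mean_shift2 psi P (squash 1 (theta_radius c n))
         (lattice_law M (lattice_points h)) h = B%:E &
       affinity_ge
         (joint_law (lattice_law M (lattice_points h)) (lattice_kernel P c n M h) 0%R)
         (joint_law (lattice_law M (lattice_points h)) (lattice_kernel P c n M h) h)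
         (1 - D / 2)],
    (0 <= m /\ 0 < D)%R, (0 <= B)%R, (Num.sqrt B <= m / (2 * Num.sqrt D))%R &
    (y <= n%:R * (m / (2 * Num.sqrt D) - Num.sqrt B) ^+ 2)%R].

(** In units of [1 / sqrt n] the mean shift [m] is about [h V], [sqrt B] at most [h V], and
[D] about [h^2 V / 4], so the difference [m / (2 sqrt D) - sqrt B] is about
[w - h V] with [w = sqrt V].  The choice of [h] makes this [(w + q) / 2], which is more
than [q = sqrt y].  One number [e] controls all errors: those of the expansion, [2 / N],
and the distortion [N h / c] by [squash]. *)
Lemma lattice_evidence_eventually P (V y : R) : locally_gaussian psi P V ->
  (0 <= y)%R -> (y < V)%R ->
  exists c0 : R, forall c, (c0 < c)%R -> exists n0, forall n, (n0 <= n)%N ->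
    [/\ (0 < c)%R, (0 < n)%N & lattice_evidence P c n y].
Proof.
move=> HP y0 yV.
have V0 : (0 < V)%R by exact: le_lt_trans yV.
pose q := Num.sqrt y; pose w := Num.sqrt V.
have q0 : (0 <= q)%R by rewrite sqrtr_ge0.
have q2 : (q ^+ 2 = y)%R by rewrite sqr_sqrtr.
have w0 : (0 < w)%R by rewrite sqrtr_gt0.
have w2 : (w ^+ 2 = V)%R by rewrite sqr_sqrtr// ltW.
have qw : (q < w)%R by rewrite ltr_sqrt.
pose h := ((w - q) / (2 * V))%R.
have h0 : (0 < h)%R by rewrite divr_gt0 ?subr_gt0// mulr_gt0.
have hV : (h * V = (w - q) / 2)%R by rewrite /h; field; rewrite gt_eqF.
pose a := (h * w / 2)%R.
have a0 : (0 < a)%R by rewrite divr_gt0// mulr_gt0.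
(* 0 < G e says that m / (2 sqrt D) exceeds q + b when the errors are at
   most e; sqrt D is estimated by a + e / a, whose square is at least
   a ^+ 2 + 2 * e, to keep G polynomial in e. *)
pose G (e : R) := (h * (1 - e) * V - e - 2 * (q + (h * V + 2 * e)) * (a + e / a))%R.
have cG : {for 0%R, continuous G} by apply: is_derive_continuous.
have G0 : (0 < G 0)%R.
  rewrite /G mulr0 mul0r !addr0 !subr0 mulr1.
  have -> : (h * V - 2 * (q + h * V) * a = h * w * ((w - q) / 2))%R.
    have qE : (q = w - 2 * (h * V))%R by rewrite hV; field.
    by rewrite qE /a -w2; field.
  by apply: mulr_gt0; [exact: mulr_gt0|rewrite divr_gt0// subr_gt0].
have [e [e0 e1 Ge]] := continuous_at0_gt cG G0 ltr01.
pose M := Num.bound (2 / e).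
pose N : R := M.+1%:R.
have N0 : (0 < N)%R by rewrite ltr0n.
have N1 : (1 <= N)%R by rewrite ler1n.
have Ne : (2 / N <= e)%R.
  rewrite ler_pdivrMr// mulrC -ler_pdivrMr// ltW//.
  apply: lt_trans (_ : M%:R < _)%R; last by rewrite ltr_nat.
  by apply: archi_boundP; rewrite divr_ge0// ltW.
pose L := (N * h)%R.
have L0 : (0 < L)%R by rewrite mulr_gt0.
exists (L / e)%R => c cL.
have c0 : (0 < c)%R by apply: lt_trans cL; rewrite divr_gt0.
have [n0 H0] := rescaled_expansion HP (ltW V0) L0 e0.
exists n0 => n /H0[n1 {}H0]; split=> //.
set r := Num.sqrt _ in H0.
have r0 : (0 < r)%R by rewrite sqrtr_gt0 ltr0n.
have r2 : (r ^+ 2 = n%:R)%R by rewrite sqr_sqrtr.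
have th0 := theta_radius_gt0 c0 n1.
set th := theta_radius c n in th0.
have thE : th = (c / r)%R by [].
pose phi := squash 1 th.
pose h' := (h / r)%R.
have h'0 : (0 < h')%R by rewrite divr_gt0.
(* The image of the lattice, in the local scale. *)
pose s (j : nat) := (r * phi (j%:R * h'))%R.
have sphi j : (s j / r = phi (j%:R * h'))%R by rewrite /s mulrC mulKf// gt_eqF.
have rh' : (r * h' = h)%R by rewrite /h' mulrC divfK// gt_eqF.
have sinc j : (0 <= s j.+1 - s j <= h)%R.
  have le1 : (j%:R * h' <= j.+1%:R * h')%R by rewrite ler_pM2r// ler_nat.
  have := squash_increment th0 le1 => /andP[p1 p2].
  rewrite /s -mulrBr mulr_ge0 ?(ltW r0)//= -rh' ler_pM2l//.
  by apply: (le_trans p2); rewrite -natr1; lra.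
have sL j : (j <= M.+1)%N -> (`|s j| <= L)%R.
  move=> jN; have le1 : (0 <= j%:R * h')%R by rewrite mulr_ge0// ltW.
  have := squash_increment th0 le1; rewrite squash0// !subr0 => /andP[p1 p2].
  rewrite /s normrM (gtr0_norm r0) ger0_norm//.
  apply: (@le_trans _ _ (r * (j%:R * h'))%R); first by rewrite ler_pM2l.
  by rewrite mulrCA rh' ler_pM2r// ler_nat.
pose v j := psi (P (phi (j%:R * h'))%R).
have vs j : (j <= M.+1)%N -> (`|r * (v j - psi (P 0)) - s j * V| <= e)%R.
  by move=> jN; have [] := H0 _ _ (sL _ jN) (sL _ jN); rewrite sphi.
pose b := (h * V + 2 * e)%R.
have vb i : (i <= M)%N -> (`|v i.+1 - v i| <= b / r)%R.
  move=> iM; have := vs i (leqW iM); have := vs i.+1 iM; have /andP[i1 i2] := sinc i.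
  rewrite ler_pdivlMr// -{3}(gtr0_norm r0) -normrM !ler_norml /b.
  move: i1 i2; set s1 := s i.+1; set s0 := s i => i1 i2 /andP[p1 p2] /andP[p3 p4].
  have : (0 <= (s1 - s0) * V)%R by rewrite mulr_ge0// ltW.
  have : ((s1 - s0) * V <= h * V)%R by rewrite ler_pM2r.
  move=> k1 k2; apply/andP; split; lra.
pose x := (h ^+ 2 * (V / 4) + e)%R.
have x0 : (0 <= x)%R by rewrite addr_ge0 ?(ltW e0)// mulr_ge0 ?sqr_ge0// divr_ge0// ltW.
have aff i : (i < M)%N -> affinity_ge (iid (P (phi (i.+1%:R * h'))%R) n)
    (iid (P (phi (i.+2%:R * h'))%R) n) (1 - x / 2).
  move=> iM; apply: affinity_ge_iid_bernoulli => //.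
  have l1 : (i.+1 <= M.+1)%N by rewrite ltnS ltnW.
  have l2 : (i.+2 <= M.+1)%N by rewrite ltnS.
  have [_] := H0 _ _ (sL _ l1) (sL _ l2).
  rewrite !sphi; apply: affinity_geW.
  rewrite lerD2l lerN2 !ler_pM2r ?invr_gt0 ?ltr0n// lerD2r ler_pM2r ?divr_gt0//.
  have /andP[i1 i2] := sinc i.+1.
  by rewrite -[leLHS]sqrrN opprB ler_pXn2r ?nnegrE// ltW.
pose D := (2 / N + x)%R.
have D0 : (0 < D)%R by rewrite ltr_pwDl ?divr_gt0.
have [B [BE B0 Bb]] := lattice_mean_shift2 (P := P) (phi := phi) (M := M) (h := h') vb.
pose m := (N^-1 * (v M.+1 - v 0%N))%R.
have v0 : v 0%N = psi (P 0%R) by rewrite /v mul0r /phi squash0.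
have sN : (L * (1 - e) <= s M.+1)%R.
  have le1 : (0 <= N * h')%R by rewrite mulr_ge0// ltW.
  have := squash_ge th0 le1; rewrite -/phi -(ler_pM2l r0); apply: le_trans.
  rewrite mulrA (mulrCA r) rh' -/L ler_pM2l// lerD2l lerN2 thE.
  rewrite (_ : N * h' / (c / r) = L / c)%R; last first.
    by rewrite /h' /L; field; rewrite !gt_eqF.
  by rewrite ler_pdivrMr// mulrC -ler_pdivrMr// ltW.
pose m0 := (h * (1 - e) * V - e)%R.
have rm : (m0 <= r * m)%R.
  have := vs _ (leqnn M.+1); rewrite -v0 ler_norml => /andP[p1 _].
  have p2 : (L * (1 - e) * V <= s M.+1 * V)%R by rewrite ler_pM2r.
  rewrite /m mulrCA ler_pdivlMl// /m0.
  have : (e <= N * e)%R by rewrite ler_peMl// ltW.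
  by move: p2; rewrite /L; lra.
have b0 : (0 < b)%R by apply: addr_gt0; exact: mulr_gt0.
pose sD := Num.sqrt D.
have sD0 : (0 < sD)%R by rewrite sqrtr_gt0.
have sDa : (sD <= a + e / a)%R.
  have aa : (0 <= a + e / a)%R by apply: addr_ge0; [|apply: divr_ge0]; exact: ltW.
  rewrite -[leRHS]ger0_norm// -sqrtr_sqr ler_wsqrtr//.
  have -> : ((a + e / a) ^+ 2 = h ^+ 2 * (V / 4) + 2 * e + (e / a) ^+ 2)%R.
    transitivity (a ^+ 2 + 2 * e + (e / a) ^+ 2)%R; first by field; rewrite gt_eqF.
    by rewrite (_ : a ^+ 2 = h ^+ 2 * (V / 4))%R// /a -w2; field.
  have k0 := sqr_ge0 (e / a)%R.
  apply: (@le_trans _ _ (e + x)%R); first by rewrite lerD2r.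
  by rewrite /x addrCA -mulr2n -[(e *+ 2)%R]mulr_natl lerDl.
have m0q : (2 * (q + b) * sD < m0)%R.
  have : (2 * (q + b) * sD <= 2 * (q + b) * (a + e / a))%R.
    by rewrite ler_wpM2l// mulr_ge0// addr_ge0// ltW.
  by move: Ge; rewrite /G -/b -/m0; lra.
have m00 : (0 <= m)%R.
  rewrite -(pmulr_rge0 _ r0); apply: le_trans rm; apply: ltW.
  apply: le_lt_trans m0q; apply: mulr_ge0; last exact: ltW.
  by apply: mulr_ge0 => //; apply: addr_ge0 => //; exact: ltW.
have key : (q + b <= r * (m / (2 * sD)))%R.
  rewrite mulrA ler_pdivlMr ?mulr_gt0//.
  by apply: le_trans rm; apply/ltW; apply: le_lt_trans m0q; lra.
have rB : (r * Num.sqrt B <= b)%R.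
  have br : (0 <= b / r)%R by rewrite divr_ge0// ltW.
  have : (Num.sqrt B <= b / r)%R.
    by rewrite -[leRHS]ger0_norm// -sqrtr_sqr ler_wsqrtr.
  by rewrite ler_pdivlMr// mulrC.
exists M, h', m, B, D; split.
- split.
  + by rewrite lattice_shift_mean2 /m /v mul0r.
  + exact: BE.
  + apply: affinity_geW (lattice_affinity c0 n1 aff).
    have MN : (M%:R = N - 1)%R by rewrite /N -natr1 addrK.
    rewrite MN -/N /D -subr_ge0.
    rewrite [leRHS](_ : _ = x / (2 * N))%R; last by field; rewrite gt_eqF.
    by rewrite divr_ge0// mulr_ge0// ltW.
- by split.
- exact: B0.
- by rewrite -(ler_pM2l r0) (le_trans rB)//; lra.
- rewrite -r2 -exprMn -q2 ler_pXn2r ?nnegrE//.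
    by rewrite mulrBr; lra.
  by rewrite mulrBr; lra.
Qed.

Lemma bound3_eventually_above P (V : R) : (0 <= V)%R -> locally_gaussian psi P V ->
  eventually_above (bound3 psi P) V.
Proof.
move=> V0 HP; apply: eventually_above_ge0 => //.
  move=> c c0; exists 1%N => n n0; apply: le_trans; last first.
    apply: ereal_sup_ubound.
    exists (squash 1 (theta_radius c n)), (lattice_law 0 (lattice_points 0%R)), 0%R.
    exists (lattice_kernel P c n 0 0%R); split; last reflexivity.
    exact: lattice_admissible.
  exact: bracket2_ge0.
move=> y y0 yV; have [c1 H1] := lattice_evidence_eventually HP y0 yV.
exists c1 => c /H1[n1 {}H1]; exists n1 => n /H1[c0 n0].
move=> [M [h [m [B [D [[E1 E2 aff] [m0 D0] B0 Bm yle]]]]]].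
apply: (@le_trans _ _ (n%:R%:E * ((m / (2 * Num.sqrt D) - Num.sqrt B) ^+ 2)%:E)).
  by rewrite -EFinM lee_fin.
apply: lee_wpmul2l; first by rewrite lee_fin.
apply: le_trans; last first.
  apply: ereal_sup_ubound.
  exists (squash 1 (theta_radius c n)), (lattice_law M (lattice_points h)), h.
  exists (lattice_kernel P c n M h); split; last reflexivity.
  exact: lattice_admissible.
apply: bracket2_ge => //; last by rewrite E2.
rewrite E1 (_ : 2 * Num.sqrt D = Num.sqrt (4 * D))%R; last first.
  rewrite sqrtrM// (_ : 4 = 2 ^+ 2 :> R)%R; last by ring.
  by rewrite sqrtr_sqr ger0_norm.
apply: sqrte_ratio_ge => //; first by rewrite mulr_gt0.
  by rewrite mule_ge0// hellinger2_ge0.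
rewrite EFinM; apply: lee_wpmul2l => //.
have := hellinger2_le aff.
by rewrite (_ : 2 - 2 * (1 - D / 2) = D)%R//; field.
Qed.

(** With [lambda = 1/2] the factor [1 - lambda] takes the place of the [4] in [bound3],
the chi-square distance that of the squared Hellinger distance, and the subtracted
term only decreases. *)
Lemma bound2_eventually_above P (V : R) : (0 <= V)%R -> locally_gaussian psi P V ->
  eventually_above (bound2 psi P) V.
Proof.
move=> V0 HP.
have l0 : (0 <= 2^-1 :> R)%R by rewrite invr_ge0.
have l1 : (2^-1 <= 1 :> R)%R by rewrite invf_le1// ler1n.
pose l : {i01 R} := Itv01 l0 l1.
have lE : (l%:num = 2^-1)%R by [].
apply: eventually_above_ge0 => //.
  move=> c c0; exists 1%N => n n0; apply: le_trans; last first.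
    apply: ereal_sup_ubound.
    exists (squash 1 (theta_radius c n)), (lattice_law 0 (lattice_points 0%R)), l, 0%R.
    exists (lattice_kernel P c n 0 0%R); split; last reflexivity.
    exact: lattice_admissible.
  exact: bracket2_ge0.
move=> y y0 yV; have [c1 H1] := lattice_evidence_eventually HP y0 yV.
exists c1 => c /H1[n1 {}H1]; exists n1 => n /H1[c0 n0].
move=> [M [h [m [B [D [[E1 E2 aff] [m0 D0] B0 Bm yle]]]]]].
apply: (@le_trans _ _ (n%:R%:E * ((m / (2 * Num.sqrt D) - Num.sqrt B) ^+ 2)%:E)).
  by rewrite -EFinM lee_fin.
apply: lee_wpmul2l; first by rewrite lee_fin.
apply: le_trans; last first.
  apply: ereal_sup_ubound.
  exists (squash 1 (theta_radius c n)), (lattice_law M (lattice_points h)), l, h.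
  exists (lattice_kernel P c n M h); split; last reflexivity.
  exact: lattice_admissible.
apply: bracket2_ge => //; last first.
  rewrite E2 lE -EFinM /= lee_fin ler_wsqrtr//.
  by rewrite -[leRHS]mul1r ler_wpM2r//; lra.
rewrite E1 lE (_ : m / (2 * Num.sqrt D) = 2^-1 * (m / Num.sqrt D))%R; last first.
  by field; rewrite gt_eqF// sqrtr_gt0.
rewrite EFinM (_ : (1 - 2^-1 = 2^-1 :> R)%R); last by field.
apply: lee_wpmul2l => //.
apply: sqrte_ratio_ge => //.
  rewrite /chi2; case: ifP => // _.
  by apply: integral_ge0 => x _; rewrite lee_fin sqr_ge0.
have := chi2_mixture_le lE aff.
by rewrite (_ : 2 - 2 * (1 - D / 2) = D)%R//; field.
Qed.

End chapman_robbins_bounds.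

(** * The van Trees bound, with a polynomial prior *)

Section polynomial_prior.
Context (R : realType).
Local Notation mu := (@lebesgue_measure R).

Lemma integral_oo_is_derive (f F : R -> R) (a b : R) : (a < b)%R ->
  (forall x : R, is_derive x 1%R F (f x)) -> continuous f ->
  \int[mu]_(x in `]a, b[) (f x)%:E = (F b - F a)%:E%R.
Proof.
move=> ab dF cf.
rewrite -(@integral_itv_bndoo R a b (EFin \o f) true false); last first.
  by apply: measurable_funTS; apply/measurable_EFinP; exact: continuous_measurable_fun.
rewrite EFinB -(@continuous_FTC2 R f F a b ab)//.
- by apply: continuous_subspaceT => x; exact: cf.
- split.
  + by move=> x _; have [] := dF x.
  + by apply: cvg_at_right_filter; exact: is_derive_continuous (dF a).
  + by apply: cvg_at_left_filter; exact: is_derive_continuous (dF b).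
- by move=> x _; have [_ <-] := dF x; rewrite derive1E.
Qed.

Lemma lipschitz_abs_continuous (I : set R) (f : R -> R) (K : R) : (0 <= K)%R ->
  (forall x y, I x -> I y -> `|f x - f y| <= K * `|x - y|)%R ->
  abs_continuous I f.
Proof.
move=> K0 fK e e0; exists (e / (K + 1))%R.
  by rewrite divr_gt0// ltr_wpDl.
move=> m a b Iab _ sab.
apply: (@le_lt_trans _ _ (K * \sum_(i < m) (b i - a i))%R).
  rewrite mulr_sumr; apply: ler_sum => i _; have [Ia Ib ab] := Iab i.
  by have := fK _ _ Ib Ia; rewrite (ger0_norm (_ : 0 <= b i - a i)%R)// subr_ge0.
have s0 : (0 <= \sum_(i < m) (b i - a i))%R.
  by apply: sumr_ge0 => i _; have [_ _] := Iab i; rewrite subr_ge0.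
apply: (@le_lt_trans _ _ ((K + 1) * \sum_(i < m) (b i - a i))%R).
  by rewrite ler_wpM2r// lerDl.
by rewrite mulrC -ltr_pdivlMr// ltr_wpDl.
Qed.

Variable r : R.

Definition prior_poly (t : R) : R := (15 / 16 / r * (1 - (t / r) ^+ 2) ^+ 2)%R.

Definition prior_density (t : R) : R :=
  if t \in `](- r)%R, r[ then prior_poly t else 0%R.

(** The proof of [0 < r] is an argument so that the probability structure can be
attached to the law. *)
Definition prior_law (r0 : (0 < r)%R) (A : set R) : \bar R :=
  \int[mu]_(t in A) (prior_density t)%:E.

Hypothesis r0 : (0 < r)%R.

Lemma prior_density_ge0 t : (0 <= prior_density t)%R.
Proof.
rewrite /prior_density; case: ifP => // _.
by rewrite mulr_ge0 ?sqr_ge0// !divr_ge0// ltW.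
Qed.

Lemma is_derive_prior_poly (t : R) :
  is_derive t 1%R prior_poly (- (15 / 4) * t / r ^+ 3 * (1 - (t / r) ^+ 2))%R.
Proof.
rewrite /prior_poly; apply: is_derive_eq; rewrite /GRing.scale/=.
by field; rewrite gt_eqF.
Qed.

Lemma continuous_prior_poly : continuous prior_poly.
Proof. by move=> t; exact: is_derive_continuous (is_derive_prior_poly t). Qed.

Lemma measurable_prior_density : measurable_fun setT prior_density.
Proof.
apply: measurable_fun_ifT => //.
  rewrite (_ : (fun t => t \in `](- r)%R, r[) = (fun t => (- r < t)%R && (t < r)%R)); last first.
    by apply/funext => t; rewrite in_itv.
  by apply: measurable_and; exact: measurable_fun_ltr.
by apply: continuous_measurable_fun; exact: continuous_prior_poly.
Qed.

Let prior_law0 : prior_law r0 set0 = 0.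
Proof. by rewrite /prior_law integral_set0. Qed.

Let prior_law_ge0 A : 0 <= prior_law r0 A.
Proof. by apply: integral_ge0 => t _; rewrite lee_fin prior_density_ge0. Qed.

Let prior_law_sigma_additive : semi_sigma_additive (prior_law r0).
Proof.
move=> F mF tF mUF; rewrite /prior_law; apply: cvg_toP.
  apply: ereal_nondecreasing_is_cvgn => m n mn.
  apply: lee_sum_nneg_natr => // k _ _.
  by apply: integral_ge0 => t _; rewrite lee_fin prior_density_ge0.
rewrite ge0_integral_bigcup//=.
- by apply: measurable_funTS; apply/measurable_EFinP; exact: measurable_prior_density.
- by move=> t _; rewrite lee_fin prior_density_ge0.
Qed.

HB.instance Definition _ := isMeasure.Build _ _ _ (prior_law r0)
  prior_law0 prior_law_ge0 prior_law_sigma_additive.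

Lemma prior_law_interval : prior_law r0 `](- r)%R, r[ = 1.
Proof.
rewrite /prior_law.
pose F (t : R) := (15 / 16 * (t / r - 2 / 3 * (t / r) ^+ 3 + 5^-1 * (t / r) ^+ 5))%R.
transitivity (\int[mu]_(t in `](- r)%R, r[) (prior_poly t)%:E).
  by apply: eq_integral => t; rewrite inE/= /prior_density => ->.
have dF (t : R) : is_derive t 1%R F (prior_poly t).
  rewrite /F; apply: is_derive_eq; rewrite /prior_poly /GRing.scale/=.
  by field; rewrite gt_eqF.
rewrite (integral_oo_is_derive _ dF continuous_prior_poly) ?gtrN//.
by rewrite /F; congr EFin; field; rewrite gt_eqF.
Qed.

Let prior_law_setT : prior_law r0 setT = 1.
Proof.
rewrite -prior_law_interval /prior_law [RHS]integral_mkcond.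
apply: eq_integral => t _; rewrite patchE mem_setE /prior_density.
by case: ifPn.
Qed.

HB.instance Definition _ := Measure_isProbability.Build _ _ R
  (prior_law r0) prior_law_setT.

Lemma prior_density_gt0 t : (0 < prior_density t)%R = (t \in `](- r)%R, r[).
Proof.
rewrite /prior_density; case: ifPn => [|_]; last by rewrite ltxx.
rewrite in_itv/= -ltr_norml => tr.
rewrite mulr_gt0 ?divr_gt0// exprn_gt0// subr_gt0.
rewrite -(real_normK (num_real _)) expr_lt1// normrM normfV (gtr0_norm r0).
by rewrite ltr_pdivrMr// mul1r.
Qed.

Lemma prior_informationE : prior_information prior_density = (10 / r ^+ 2)%:E.
Proof.
rewrite /prior_information.
have -> : [set t | (0 < prior_density t)%R] = `](- r)%R, r[%classic.
  by apply/seteqP; split => t /=; rewrite prior_density_gt0.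
(* The factor (1 - (t / r) ^+ 2) ^+ 2 of the squared derivative cancels with
   the density. *)
transitivity (\int[mu]_(t in `](- r)%R, r[) (15 / r ^+ 5 * t ^+ 2)%:E%R).
  apply: eq_integral => t; rewrite inE/= => tr; congr EFin.
  have E : derive1 prior_density t =
      (- (15 / 4) * t / r ^+ 3 * (1 - (t / r) ^+ 2))%R.
    have [_ <-] := is_derive_prior_poly t; rewrite derive1E.
    apply: near_eq_derive.
    have := @near_in_itvoo R (- r)%R r t tr; apply: filterS => x xr.
    by rewrite /prior_density xr.
  have := prior_density_gt0 t; rewrite tr => q0.
  rewrite E; move: q0; rewrite /prior_density tr /prior_poly => q0.
  have p0 : ((1 - (t / r) ^+ 2)%R != 0%R).
    by apply: contraTneq q0 => ->; rewrite expr0n/= mulr0 ltxx.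
  have p1 : (r ^+ 2 - t ^+ 2 != 0)%R.
    apply: contra p0 => /eqP p1; rewrite expr_div_n.
    by rewrite (_ : t ^+ 2 = r ^+ 2)%R ?divff ?subrr// ?expf_neq0 ?gt_eqF//; lra.
  by field; rewrite gt_eqF//= p1.
pose F (t : R) := (5 / r ^+ 5 * t ^+ 3)%R.
have dF (t : R) : is_derive t 1%R F (15 / r ^+ 5 * t ^+ 2)%R.
  by rewrite /F; apply: is_derive_eq; rewrite /GRing.scale/=; field; rewrite gt_eqF.
rewrite (integral_oo_is_derive _ dF) ?gtrN//.
  by rewrite /F; congr EFin; field; rewrite gt_eqF.
by move=> t; apply: is_derive_continuous.
Qed.

(** The polynomial vanishes at the endpoints, so that on the closed interval the density is
the polynomial, which is Lipschitz. *)
Lemma prior_density_abs_continuous :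
  abs_continuous `[(- r)%R, r]%classic prior_density.
Proof.
have E t : `[(- r)%R, r]%classic t -> prior_density t = prior_poly t /\ (`|t / r| <= 1)%R.
  rewrite /= in_itv/= => tr; split; last first.
    by rewrite normrM normfV (gtr0_norm r0) ler_pdivrMr// mul1r ler_norml.
  rewrite /prior_density; case: ifPn => //; rewrite in_itv/= => ntr.
  have : (t = r \/ t = - r)%R.
    case/andP: tr => t1 t2; move: ntr; rewrite negb_and -!leNgt => /orP[h|h].
      by right; apply/eqP; rewrite eq_le h.
    by left; apply/eqP; rewrite eq_le t2.
  by move=> [->|->]; rewrite /prior_poly ?mulNr ?sqrrN divff ?gt_eqF// expr1n subrr expr0n/= mulr0.
apply: (@lipschitz_abs_continuous _ _ (15 / 4 / r ^+ 2)%R).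
  by rewrite !divr_ge0// sqr_ge0.
move=> a b /E[-> ar] /E[-> br].
rewrite /prior_poly -mulrBr normrM (ger0_norm (_ : 0 <= 15 / 16 / r)%R); last first.
  by rewrite !divr_ge0// ltW.
set x := (a / r)%R in ar *; set y := (b / r)%R in br *.
have -> : (`|a - b| = r * `|x - y|)%R.
  by rewrite -{1}(gtr0_norm r0) -normrM /x /y; congr Num.norm; field; rewrite gt_eqF.
have -> : ((1 - x ^+ 2) ^+ 2 - (1 - y ^+ 2) ^+ 2 =
    (x - y) * (- (x + y) * (2 - x ^+ 2 - y ^+ 2)))%R by ring.
rewrite normrM.
have -> : (15 / 4 / r ^+ 2 * (r * `|x - y|) = 15 / 16 / r * (`|x - y| * 4))%R.
  by field; rewrite gt_eqF.
rewrite ler_wpM2l ?divr_ge0 ?(ltW r0)// ler_wpM2l// normrM normrN.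
have h1 : (`|x + y| <= 2)%R by apply: (le_trans (ler_normD _ _)); lra.
have h2 : (`|2 - x ^+ 2 - y ^+ 2| <= 2)%R.
  have : (x ^+ 2 <= 1)%R by rewrite -(real_normK (num_real x)) expr_le1.
  have : (y ^+ 2 <= 1)%R by rewrite -(real_normK (num_real y)) expr_le1.
  have := sqr_ge0 x; have := sqr_ge0 y.
  by move=> *; rewrite ler_norml; apply/andP; split; lra.
rewrite (_ : 4 = 2 * 2 :> R)%R; last by ring.
exact: ler_pM.
Qed.

End polynomial_prior.

Section van_trees_bound.
Context d (X : measurableType d) (R : realType).
Variables (nu : {sigma_finite_measure set X -> \bar R}) (psi : model nu -> R).
Implicit Types (P : R -> model nu).
Local Notation mu := (@lebesgue_measure R).

Lemma fisher_information0_le P (G : X -> R) (V : R) :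
  measurable_fun setT G -> root_expansion P 0%R G ->
  \int[nu]_x (G x ^+ 2)%:E = (V / 4)%:E%R ->
  hellinger_differentiable P 0%R -> fisher_information P 0%R <= V%:E.
Proof.
move=> mG exG GV [xi0 xi0P]; rewrite /fisher_information.
have := @xgetPex _ (cst 0%R) (hellinger_derivative P 0%R) (ex_intro _ xi0 xi0P).
set xi := xget _ _ => -[xiL exxi].
have mxi : measurable_fun setT xi by have := sub_Lfun_mfun xiL; rewrite inE.
have := root_expansion_norm_le mG mxi exG exxi GV.
move=> h; rewrite (_ : V%:E = 4%:E * (V / 4)%:E)%E; last first.
  by rewrite -EFinM; congr EFin; field.
by apply: lee_wpmul2l h; rewrite lee_fin.
Qed.

Lemma theta_radius_eventually_lt (c dl : R) : (0 < c)%R -> (0 < dl)%R ->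
  exists n0, forall n, (n0 <= n)%N -> (0 < n)%N /\ (theta_radius c n < dl)%R.
Proof.
move=> c0 dl0; have [n0 H] := sqrt_eventually_gt (c / dl).
exists n0 => n /H[n1 h]; split=> //.
by rewrite /theta_radius ltr_pdivrMr ?sqrtr_gt0 ?ltr0n// mulrC -ltr_pdivrMr.
Qed.

Lemma prior_law_dominated (r : R) (r0 : (0 < r)%R) : prior_law r0 `<< mu.
Proof.
apply/null_content_dominatesP => A mA muA0; apply: null_set_integral => //.
by apply: measurable_funTS; apply/measurable_EFinP; exact: measurable_prior_density.
Qed.

(** The prior information is [10 / r^2 = 10 n / c^2], and continuity of the Fisher
information at 0 bounds its mean by [V + e]; the affine [phi] of slope [V] approximates
[psi] with error [e r]. *)
Lemma bound1_witness P (V c e : R) : (0 <= V)%R -> (0 < c)%R -> (0 < e)%R ->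
  locally_gaussian psi P V -> regular_near0 psi P ->
  fisher_information P 0%R <= V%:E ->
  exists n0, forall n, (n0 <= n)%N -> (0 < n)%N /\ exists x z : \bar R,
    [/\ bracket2 x z <= bound1 psi P c n,
      (V / Num.sqrt (n%:R * (10 / c ^+ 2 + V + e)))%:E%R <= x &
      z <= (e * theta_radius c n)%:E].
Proof.
move=> V0 c0 e0 HP [[rr rr0 [Hd [psi' mpsi' psipsi']]] Fcvg] FV.
have F0 : 0 <= fisher_information P 0%R.
  by rewrite /fisher_information mule_ge0// integral_ge0// => x _; rewrite lee_fin sqr_ge0.
have [d1 d10 H1] : exists2 d1 : R, (0 < d1)%R &
    forall t, (`|t| < d1)%R -> fisher_information P t <= (V + e)%:E.
  move: Fcvg F0 FV; case: (fisher_information P 0%R) => [f| |]//.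
  move=> /fine_cvgP[/nbhs_ballP[/= d1 d10 fin] /cvgr_lt small] _.
  rewrite lee_fin => fV; have fe : (f < V + e)%R by lra.
  have /nbhs_ballP[/= d2 d20 {}small] := small _ fe.
  exists (Num.min d1 d2); first by rewrite lt_min d10.
  move=> t; rewrite lt_min => /andP[td1 td2].
  have := fin t; have := small t; rewrite /ball/= sub0r normrN.
  move=> /(_ td2) + /(_ td1); case: (fisher_information P t) => [g| |]//= h _.
  by rewrite lee_fin ltW.
have [d2 d20 H2] := HP e e0.
pose dl := Num.min rr (Num.min d1 d2).
have dl0 : (0 < dl)%R by rewrite !lt_min rr0 d10.
have [n0 Hn] := theta_radius_eventually_lt c0 dl0.
exists n0 => n /Hn[n1 rdl]; split=> //.
set r := theta_radius c n in rdl *.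
have r0 : (0 < r)%R by exact: theta_radius_gt0.
have [rrr rd1 rd2] : [/\ r < rr, r < d1 & r < d2]%R.
  by move: rdl; rewrite !lt_min => /andP[-> /andP[-> ->]].
have TE t : Theta c n t = (`|t| < r)%R :> Prop.
  by rewrite /Theta/= in_itv/= ltr_norml.
pose Q : probability R R := prior_law r0.
pose phi (t : R) := (psi (P 0%R) + V * t)%R.
have dphi (t : R) : is_derive t 1%R phi V.
  by rewrite /phi; apply: is_derive_eq; rewrite /GRing.scale/=; ring.
have phi' : derive1 phi = cst V.
  by apply/funext => t; rewrite derive1E; have [_ ->] := dphi t.
have mphi : measurable_fun setT phi.
  by apply: continuous_measurable_fun => t; exact: is_derive_continuous (dphi t).
have mT : measurable (Theta c n) by exact: measurable_itv.
have QT : Q (Theta c n) = 1 by exact: prior_law_interval.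
have Fle : \int[Q]_(t in Theta c n) fisher_information P t <= (V + e)%:E.
  rewrite -[leRHS]mule1 -QT -integral_cst//.
  apply: ge0_le_lower_integral => t; rewrite TE => tr.
    by rewrite /fisher_information mule_ge0// integral_ge0// => x _; rewrite lee_fin sqr_ge0.
  by apply: H1; exact: lt_trans rd1.
have F00 : 0 <= \int[Q]_(t in Theta c n) fisher_information P t.
  apply: integral_ge0 => t _.
  by rewrite /fisher_information mule_ge0// integral_ge0// => x _; rewrite lee_fin sqr_ge0.
have r2 : (r ^+ 2 = c ^+ 2 / n%:R)%R by rewrite /r /theta_radius expr_div_n sqr_sqrtr.
have nn0 : (0 < n%:R :> R)%R by rewrite ltr0n.
eexists; eexists; split.
- apply: ereal_sup_ubound; exists phi, (prior_density r), Q; split; last reflexivity.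
  split.
  + split.
    * exact: prior_density_ge0.
    * by move=> t Tt; rewrite /prior_density; case: ifPn.
    * exact: prior_density_abs_continuous.
    * by [].
    * by rewrite prior_informationE// lte_fin ltry andbT divr_gt0// exprn_gt0.
  + apply: (@lipschitz_abs_continuous _ _ _ V) => // t t' _ _.
    by rewrite /phi opprD addrACA subrr add0r -mulrBr normrM ger0_norm.
  + split.
      exists phi; last exact: ae_eq_refl.
      apply: (@le_integrable _ _ _ Q _ mT _ (cst (`|psi (P 0%R)| + V * r)%:E%R)).
      * by apply/measurable_EFinP; exact: measurable_funTS.
      * move=> t; rewrite TE /= => tr; rewrite lee_fin [leRHS]ger0_norm; last first.
          by rewrite addr_ge0// mulr_ge0// ltW.
        rewrite (le_trans (ler_normD _ _))// lerD2l normrM (ger0_norm V0).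
        by rewrite ler_wpM2l// ltW.
      * exact: finite_measure_integrable_cst.
    exists (cst V); last by rewrite phi'; exact: ae_eq_refl.
    exact: finite_measure_integrable_cst.
  + exact: le_lt_trans Fle (ltry _).
  + have sub : Theta c n `<=` `](- rr)%R, rr[%classic.
      move=> t; rewrite TE /= in_itv/= -ltr_norml => tr; exact: lt_trans rrr.
    exists (fun t => psi' t - phi t)%R.
      apply: measurable_funB; last exact: measurable_funTS.
      exact: measurable_funS mpsi'.
    have [A [mA A0 sA]] := psipsi'.
    exists A; split=> //.
      by have /null_content_dominatesP := prior_law_dominated r0; apply.
    move=> t /= h; apply: sA => /= h'; apply: h => Tt.
    by rewrite h'//; exact: sub.
- have -> : \int[Q]_(t in Theta c n) (derive1 phi t)%:E = V%:E.
    by rewrite phi' -[RHS]mule1 -QT -integral_cst.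
  rewrite abse_EFin (ger0_norm V0) prior_informationE//.
  move: F00 Fle; case: (\int[Q]_(t in Theta c n) fisher_information P t) => [f| |]// f0 fle.
  rewrite -EFinM -EFinD /=.
  have Z0 : (0 < 10 / r ^+ 2 + n%:R * f)%R.
    by rewrite ltr_pwDl ?divr_gt0 ?exprn_gt0// mulr_ge0// ltW.
  rewrite inver gt_eqF ?sqrtr_gt0// -EFinM lee_fin ler_wpM2l//.
  rewrite lef_pV2 ?posrE ?sqrtr_gt0//; last first.
    by rewrite mulr_gt0// addr_gt0// ltr_pwDl// divr_gt0// exprn_gt0.
  apply: ler_wsqrtr; rewrite r2.
  rewrite (_ : 10 / (c ^+ 2 / n%:R) = n%:R * (10 / c ^+ 2))%R; last first.
    by field; rewrite !gt_eqF.
  by rewrite -mulrDr ler_pM2l// -addrA lerD2l -lee_fin.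
- rewrite (_ : (e * r)%:E = sqrte ((e * r) ^+ 2)%:E); last first.
    by rewrite /= sqrtr_sqr ger0_norm// mulr_ge0// ltW.
  rewrite lee_sqrt ?lee_fin ?sqr_ge0//.
  rewrite -[leRHS]mule1 -QT -integral_cst//.
  apply: ge0_le_lower_integral => t; rewrite TE => tr; rewrite lee_fin ?sqr_ge0//.
  have [h _] := H2 t (lt_trans tr rd2).
  rewrite /phi -(real_normK (num_real (_ - _))).
  have er0 : (0 <= e * r)%R by rewrite mulr_ge0// ltW.
  rewrite ler_pXn2r ?nnegrE//.
  rewrite opprD addrA mulrC; apply: (le_trans h).
  by rewrite ler_pM2l// ltW.
Qed.

(** After multiplication by [sqrt n] the difference of the two terms is
[V / sqrt (10 / c^2 + V + e) - e c], whose square tends to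
[V^2 / (10 / c^2 + V)] with [e]; this exceeds [y] for [c] large. *)
Lemma bound1_eventually_above P (V : R) : (0 <= V)%R ->
  locally_gaussian psi P V -> regular_near0 psi P ->
  fisher_information P 0%R <= V%:E -> eventually_above (bound1 psi P) V.
Proof.
move=> V0 HP reg FV; apply: eventually_above_ge0 => //.
  move=> c c0; have [n0 Hn] := bound1_witness V0 c0 ltr01 HP reg FV.
  exists n0 => n /Hn[_ [x [z [h _ _]]]].
  exact: le_trans (bracket2_ge0 _ _) h.
move=> y y0 yV.
have {}V0 : (0 < V)%R by exact: le_lt_trans yV.
pose q := Num.sqrt y.
have q0 : (0 <= q)%R by rewrite sqrtr_ge0.
have q2 : (q ^+ 2 = y)%R by rewrite sqr_sqrtr.
have VyV : (0 < V * (V - y))%R by rewrite mulr_gt0// subr_gt0.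
(* For c > 1 it suffices that 10 * y < c * (V * (V - y)). *)
exists (1 + 10 * y / (V * (V - y)))%R => c cc.
have k0 : (0 <= 10 * y / (V * (V - y)))%R by rewrite divr_ge0 ?(ltW VyV)// mulr_ge0.
have c1 : (1 < c)%R by lra.
have c0 : (0 < c)%R by lra.
pose G (e : R) := (V ^+ 2 - (q + e * c) ^+ 2 * (10 / c ^+ 2 + V + e))%R.
have cG : {for 0%R, continuous G} by apply: is_derive_continuous.
have G0 : (0 < G 0)%R.
  rewrite /G mul0r !addr0 q2.
  have : (10 * y < c ^+ 2 * (V * (V - y)))%R.
    rewrite -ltr_pdivrMr//; apply: (@lt_trans _ _ c); first by lra.
    by rewrite expr2 ltr_pMl.
  rewrite -ltr_pdivrMl ?exprn_gt0// => h.
  have -> : (V ^+ 2 - y * (10 / c ^+ 2 + V) = V * (V - y) - (c ^+ 2)^-1 * (10 * y))%R.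
    by ring.
  by rewrite subr_gt0.
have [e [e0 _ Ge]] := continuous_at0_gt cG G0 ltr01.
have [n0 Hn] := bound1_witness (ltW V0) c0 e0 HP reg FV.
exists n0 => n /Hn[n1 [x [z [h hx hz]]]].
apply: (@le_trans _ _ (n%:R%:E * bracket2 x z)); last first.
  by apply: lee_wpmul2l => //; rewrite lee_fin.
set Z := (10 / c ^+ 2 + V + e)%R in hx Ge *.
have Z0 : (0 < Z)%R by rewrite addr_gt0// ltr_pwDr// divr_ge0// sqr_ge0.
pose r := Num.sqrt (n%:R : R).
have r0 : (0 < r)%R by rewrite sqrtr_gt0 ltr0n.
have r2 : (r ^+ 2 = n%:R)%R by rewrite sqr_sqrtr.
have sZ0 : (0 < Num.sqrt Z)%R by rewrite sqrtr_gt0.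
have key : (q + e * c <= V / Num.sqrt Z)%R.
  rewrite ler_pdivlMr// -(ler_pXn2r (n := 2)) ?nnegrE//; first last.
  - exact: ltW.
  - by rewrite mulr_ge0 ?(ltW sZ0)// addr_ge0// mulr_ge0// ltW.
  rewrite exprMn sqr_sqrtr ?(ltW Z0)//.
  by move: Ge; rewrite /G -/Z; lra.
have aE : (V / Num.sqrt (n%:R * Z) = V / Num.sqrt Z / r)%R.
  by rewrite sqrtrM// -/r; field; rewrite !gt_eqF.
have bE : (e * theta_radius c n = e * c / r)%R by rewrite /theta_radius mulrA.
rewrite aE in hx; rewrite bE in hz.
have ba : (e * c / r <= V / Num.sqrt Z / r)%R.
  by rewrite ler_pM2r ?invr_gt0//; lra.
apply: (@le_trans _ _ (n%:R%:E * ((V / Num.sqrt Z / r - e * c / r) ^+ 2)%:E)).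
  rewrite -EFinM lee_fin -r2 -exprMn.
  have -> : (r * (V / Num.sqrt Z / r - e * c / r) = V / Num.sqrt Z - e * c)%R.
    by field; rewrite !gt_eqF.
  rewrite -q2 ler_pXn2r ?nnegrE//; lra.
apply: lee_wpmul2l; first by rewrite lee_fin.
exact: bracket2_ge.
Qed.

End van_trees_bound.

(** * The efficiency bounds *)

Theorem proposition1 (d : measure_display) (X : measurableType d)
  (R : realType) (nu : {sigma_finite_measure set X -> \bar R})
  (P0 : model nu) (psi : model nu -> R)
  (psi_ext : forall P P' : model nu, P ≡μ P' -> psi P = psi P')
  (eif : X -> R) (psi_eif : efficient_influence_function P0 psi eif)
  (P : (X -> R) -> R -> model nu)
  (P_qmd : forall g : X -> R, L20 P0 g -> P g 0%R ≡μ P0 /\ qmd (P g) g) :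
  [/\ (forall g : X -> R, L20 P0 g -> regular_near0 psi (P g)) ->
        \int[P0]_x ((eif x) ^+ 2)%:E <= local_limit P0 P (bound1 psi),
      forall kappa : R -> R, tilting_function kappa ->
        (forall g : X -> R, L20 P0 g -> tilted_path P0 kappa g (P g)) ->
        \int[P0]_x ((eif x) ^+ 2)%:E <= local_limit P0 P (bound2 psi),
      \int[P0]_x ((eif x) ^+ 2)%:E <= local_limit P0 P (bound3 psi),
      (two_point_constant R)%:E * \int[P0]_x ((eif x) ^+ 2)%:E
          <= local_limit P0 P (bound4 psi)
        /\ (`|two_point_constant R - (289 + 53 / 100) / 1000|
              <= 5 / 10 ^+ 6)%R &
      \int[P0]_x ((eif x) ^+ 2)%:E <= local_limit P0 P (minimax_risk psi)].
Proof.
have [_ _ [eif0 _]] := psi_eif.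
have [eifL _] := eif0.
have [P00 qmdP] := P_qmd eif eif0.
have [V V0 eifV] := integral_sqr_Lfun2 eifL.
have lg := efficient_path_locally_gaussian psi_ext psi_eif P00 qmdP eifV.
have above L : eventually_above (L (P eif)) V -> V%:E <= local_limit P0 P L.
  exact: local_limit_ge.
rewrite eifV; split.
- move=> reg; apply: above; have [[r r0 [hd _]] _] := reg eif eif0.
  apply: bound1_eventually_above => //; first exact: reg.
  have meif : measurable_fun setT eif by have := sub_Lfun_mfun eifL; rewrite inE.
  apply: (fisher_information0_le _ qmdP (score_integral P00 meif eifV)).
    apply: measurable_funM; first exact: measurable_funM.
    exact: measurable_root_density.
  by apply: hd; rewrite /= in_itv/= oppr_lt0 r0.
- by move=> kappa _ _; apply: above; exact: bound2_eventually_above.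
- by apply: above; exact: bound3_eventually_above.
- split; last exact: two_point_constant_approx.
  by rewrite -EFinM; apply: local_limit_ge eif0 _; exact: bound4_eventually_above.
- by apply: above; exact: minimax_eventually_above.
Qed.
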